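(* There is an algorithm which, given a unitary $n\times n$ diagonal matrix $D$ and matrices $U,V\in\mathbb{C}^{n\times k}$ with $k\le n$, computes a unitary matrix $Q$ (as a product of elementary unitary transformations) and a condensed representation of the matrix $H=QAQ^H$, where $A=D+UV^H$, such that $H$ is in upper Hessenberg form, using $O(n^2k)$ arithmetic operations (with a constant independent of both $n$ and $k$).
   Context: A matrix $H=(h_{ij})$ is upper Hessenberg if $h_{ij}=0$ for $i>j+1$. Computations are in exact arithmetic; arithmetic operations are operations on complex numbers, including the square roots needed to form Givens rotations and QR factorizations. A condensed representation of $H$ means a description from which $H$ is determined and which consists of $O(nk)$ parameters ($O(n)$ vectors of length $O(k)$ and $O(nk)$ Givens rotations). $Q$ may be returned as the sequence of elementary unitary transformations. $X^H$ denotes the conjugate transpose of $X$. *)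

(* Defs.v *)
From HB Require Import structures.
From mathcomp Require Import all_boot all_order all_algebra.

Set Implicit Arguments.
Unset Strict Implicit.
Unset Printing Implicit Defensive.

Import Order.TTheory GRing.Theory Num.Theory.
Local Open Scope ring_scope.
Local Open Scope sesquilinear_scope.

Definition upper_hessenberg (C : numClosedFieldType) n (H : 'M[C]_n) : Prop :=
  forall i j : 'I_n, (j.+1 < i)%N -> H i j = 0.

(* Elementary unitary transformations.                                        *)

(* The rotation  [ c  s ; - s^*  c^* ]  in the coordinates (gi, gj). *)
Record givens (C : Type) := Givens { gi : nat; gj : nat; gc : C; gs : C }.

Definition givens_ok (C : numClosedFieldType) (n : nat) (g : givens C) : bool :=
  [&& (gi g < n)%N, (gj g < n)%N, gi g != gj g
    & gc g * (gc g)^* + gs g * (gs g)^* == 1].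

Definition givens_mx (C : numClosedFieldType) (n : nat) (g : givens C) : 'M[C]_n :=
  \matrix_(i, j)
    if (i == gi g :> nat) && (j == gi g :> nat) then gc g
    else if (i == gi g :> nat) && (j == gj g :> nat) then gs g
    else if (i == gj g :> nat) && (j == gi g :> nat) then - (gs g)^*
    else if (i == gj g :> nat) && (j == gj g :> nat) then (gc g)^*
    else (i == j)%:R.

(* The Householder reflection  I - (2 / v^H v) v v^H. *)
Definition reflector_mx (C : numClosedFieldType) n (v : 'cV[C]_n) : 'M[C]_n :=
  1%:M - (2%:R / (v^t* *m v) 0 0) *: (v *m v^t*).

Inductive elementary (C : Type) :=
| Rotation of givens C
| Reflection of seq C.

Definition elementary_ok (C : numClosedFieldType) (n : nat) (e : elementary C) :=
  match e with
  | Rotation g => givens_ok n g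
  | Reflection v => (size v == n) && has (fun x => x != 0) v
  end.

Definition elementary_mx (C : numClosedFieldType) (n : nat) (e : elementary C) :
    'M[C]_n :=
  match e with
  | Rotation g => givens_mx n g
  | Reflection v => reflector_mx (\col_(i < n) v`_i)
  end.

(* [:: E_1; ...; E_m]  |->  E_m *m ... *m E_1,  i.e. E_1 is applied first. *)
Definition compose_mx (C : numClosedFieldType) (n : nat) (Es : seq 'M[C]_n) :
    'M[C]_n :=
  foldl (fun M E => E *m M) 1%:M Es.

(* Condensed representations.  "H is determined by the parameters" has to be  *)
(* made concrete: for an arbitrary decoding function it would be void, since  *)
(* n ^ 2 complex numbers can be encoded in a single one.  The decoding used   *)
(* here is  H = (product of Givens rotations) diag(d) + X Y^H.                *)

Record condensed (C : Type) (n : nat) := Condensed {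
  crots : seq (givens C);
  cdiag : 'rV[C]_n;
  crank : nat;
  cleft : 'M[C]_(n, crank);
  cright : 'M[C]_(n, crank)
}.

Definition condensed_ok (C : numClosedFieldType) (c n k : nat)
    (K : condensed C n) : bool :=
  [&& all (givens_ok n) (crots K), (size (crots K) <= c * (n * k))%N
    & (crank K <= c * k)%N].

Definition condensed_mx (C : numClosedFieldType) n (K : condensed C n) : 'M[C]_n :=
  compose_mx [seq givens_mx n g | g <- crots K] *m diag_mx (cdiag K)
  + cleft K *m (cright K)^t*.

(* The model of computation.  A program is a finite piece of syntax, the same *)
(* for all sizes n and k and containing no complex constants except natural   *)
(* numbers.  It works on an unbounded memory of integers (arrays with one     *)
(* index, used for control and indexing) and of complex numbers (arrays with  *)
(* two indices).  Complex values influence the control flow and the integers  *)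
(* only through equality tests.                                               *)

Inductive iexp :=
| ICst of nat
| IGet of nat & iexp              (* IGet a e : entry e of integer array a *)
| IAdd of iexp & iexp
| ISub of iexp & iexp             (* truncated *)
| IMul of iexp & iexp
| IDiv of iexp & iexp
| IMod of iexp & iexp.

(* Ref a e1 e2 : entry (e1, e2) of complex array a *)
Inductive ref := Ref of nat & iexp & iexp.

Inductive cexp :=
| CNat of nat
| CCopy of ref
| COpp of ref
| CConj of ref
| CInv of ref
| CSqrt of ref
| CAdd of ref & ref
| CSub of ref & ref
| CMul of ref & ref
| CDiv of ref & ref.

Inductive prog :=
| Skip
| Seq of prog & prog
| ISet of nat & iexp & iexp       (* ISet a e1 e2 : a[e1] := e2 *)
| CSet of ref & cexp
| IfLe of iexp & iexp & prog & prog
| IfEq of ref & ref & prog & prog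
| For of nat & iexp & prog        (* For a e p : for a[0] := 0 .. e - 1 do p *)
(* output of an elementary transformation for Q: *)
| OutRot of iexp & iexp & ref & ref  (* Givens rotation *)
| OutRefl of nat & iexp & iexp (* OutRefl a e1 e2: v = a[e1, 0 .. e2 - 1] *)
(* output of a Givens rotation for the representation of H: *)
| OutRep of iexp & iexp & ref & ref.

Record state (C : Type) := State {
  imem : nat -> nat -> nat;
  cmem : nat -> nat -> nat -> C;
  qout : seq (elementary C);
  hout : seq (givens C);
  ops : nat
}.

Section Semantics.
Variable C : numClosedFieldType.
Implicit Type s : state C.

Fixpoint ieval s (e : iexp) : nat :=
  match e with
  | ICst m => m
  | IGet a e => imem s a (ieval s e)
  | IAdd e1 e2 => ieval s e1 + ieval s e2
  | ISub e1 e2 => ieval s e1 - ieval s e2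
  | IMul e1 e2 => ieval s e1 * ieval s e2
  | IDiv e1 e2 => ieval s e1 %/ ieval s e2
  | IMod e1 e2 => ieval s e1 %% ieval s e2
  end%N.

Definition cget s (r : ref) : C :=
  let: Ref a e1 e2 := r in cmem s a (ieval s e1) (ieval s e2).

(* As in the library, 0^-1 = 0. *)
Definition ceval s (e : cexp) : C :=
  match e with
  | CNat m => m%:R
  | CCopy r => cget s r
  | COpp r => - cget s r
  | CConj r => (cget s r)^*
  | CInv r => (cget s r)^-1
  | CSqrt r => sqrtC (cget s r)
  | CAdd r1 r2 => cget s r1 + cget s r2
  | CSub r1 r2 => cget s r1 - cget s r2
  | CMul r1 r2 => cget s r1 * cget s r2
  | CDiv r1 r2 => cget s r1 / cget s r2
  end.

Definition iset s (a i m : nat) : state C :=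
  State (fun a' i' => if (a' == a) && (i' == i) then m else imem s a' i')
        (cmem s) (qout s) (hout s) (ops s).

Definition cset s (r : ref) (z : C) : state C :=
  let: Ref a e1 e2 := r in
  let i := ieval s e1 in let j := ieval s e2 in
  State (imem s)
        (fun a' i' j' =>
           if [&& a' == a, i' == i & j' == j] then z else cmem s a' i' j')
        (qout s) (hout s) (ops s).

Definition tick (m : nat) s : state C :=
  State (imem s) (cmem s) (qout s) (hout s) (ops s + m).

Definition outq s (e : elementary C) : state C :=
  State (imem s) (cmem s) (rcons (qout s) e) (hout s) (ops s).

Definition outh s (g : givens C) : state C :=
  State (imem s) (cmem s) (qout s) (rcons (hout s) g) (ops s).

Definition get_givens s (e1 e2 : iexp) (r1 r2 : ref) : givens C :=
  Givens (ieval s e1) (ieval s e2) (cget s r1) (cget s r2).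

(* Every arithmetic operation (including conjugation and square root), every  *)
(* equality test, and also every complex number copied or output counts as    *)
(* one operation, so that ops bounds the number of arithmetic operations.     *)
(* Integer bookkeeping is not counted.                                        *)
Fixpoint exec (p : prog) s : state C :=
  match p with
  | Skip => s
  | Seq p1 p2 => exec p2 (exec p1 s)
  | ISet a e1 e2 => iset s a (ieval s e1) (ieval s e2)
  | CSet r e => tick 1 (cset s r (ceval s e))
  | IfLe e1 e2 p1 p2 =>
      if (ieval s e1 <= ieval s e2)%N then exec p1 s else exec p2 s
  | IfEq r1 r2 p1 p2 =>
      if cget s r1 == cget s r2 then exec p1 (tick 1 s) else exec p2 (tick 1 s)
  | For a e p1 => iteri (ieval s e) (fun i s' => exec p1 (iset s' a 0 i)) s
  | OutRot e1 e2 r1 r2 =>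
      tick 2 (outq s (Rotation (get_givens s e1 e2 r1 r2)))
  | OutRefl a e1 e2 =>
      let m := ieval s e2 in
      tick m (outq s (Reflection (mkseq (cmem s a (ieval s e1)) m)))
  | OutRep e1 e2 r1 r2 => tick 2 (outh s (get_givens s e1 e2 r1 r2))
  end.

(* Input and output conventions.                                              *)

Definition entry m n (A : 'M[C]_(m, n)) (i j : nat) : C :=
  match insub i, insub j with
  | Some i', Some j' => A i' j'
  | _, _ => 0
  end.

(* n and k are in entry 0 of the integer arrays 0 and 1; the diagonal of D is *)
(* in column 0 of the complex array 0; U and V are in the complex arrays 1, 2. *)
Definition init n k (D : 'M[C]_n) (U V : 'M[C]_(n, k)) : state C :=
  State
    (fun a i => match a, i with 0, 0 => n | 1, 0 => k | _, _ => 0 end)%N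
    (fun a i j =>
       match a with
       | 0%N => if j == 0%N then entry D i i else 0
       | 1%N => entry U i j
       | 2%N => entry V i j
       | _ => 0
       end)
    [::] [::] 0.

Definition result_Q n s : 'M[C]_n :=
  compose_mx [seq elementary_mx n e | e <- qout s].

(* The rank is read in entry 0 of the integer array 2; d, X, Y are read in    *)
(* column 0 of the complex array 3 and in the complex arrays 4 and 5.         *)
Definition result_H n s : condensed C n :=
  let r := imem s 2 0 in
  Condensed (hout s) (\row_(i < n) cmem s 3 i 0)
    (\matrix_(i < n, j < r) cmem s 4 i j) (\matrix_(i < n, j < r) cmem s 5 i j).

End Semantics.

(* Main.v *)
(** The unitary part W = Q D Q^H of H = Q A Q^H = W + X Y^H, with X = Q U and
    Y = Q V, is never formed.  It is kept in the form W = S L_1 ... L_k D, where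
    every chain L_i is a product of rotations of the coordinates (p, p + 1), with
    p increasing from left to right, and S is a list of such rotations.  A
    rotation at p multiplied to the right of W passes through D and, by one
    turnover per chain, through L_1 ... L_k; it leaves the chains on the left at
    p + k.  If it commutes with S, conjugation by its inverse puts it back on the
    right of W.  In this way it is chased off the bottom by at most n turnovers,
    and X and Y have to be rotated at every k-th turnover only.

    Phase 1 takes in the coordinates c = n - 1, ..., 0.  The k rotations that
    restore the triangular shape of X become the new heads of the chains, at the
    staggered positions c + k - i, and their inverses are chased to the bottom.
    Afterwards X vanishes below its first k rows.

    In phase 2, column c of H is supported in the rows up to c + k, since every
    chain moves the support down by one.  It is evaluated in O(nk) operations
    from the factored form; its entries below the subdiagonal are annihilated by
    k - 1 rotations, which are appended to S, and their inverses are chased.  The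
    chased rotations act on rows below c + k and therefore commute with S.

    In the end S and the chains consist of at most 2 n k rotations, so that they
    are a condensed representation of W, and D never changes. *)

Require Import Defs.
From mathcomp Require Import all_boot all_order all_algebra.
From mathcomp Require Import complex reals.
From mathcomp Require Import ring zify.
From Stdlib Require Import FunctionalExtensionality.

Set Implicit Arguments.
Unset Strict Implicit.
Unset Printing Implicit Defensive.
Import Order.TTheory GRing.Theory Num.Theory.
Local Open Scope ring_scope.
Local Open Scope sesquilinear_scope.

(** * Rotations of adjacent coordinates and the turnover *)

Section Rotations.
Variable C : numClosedFieldType.
Implicit Types (f h : nat -> C) (g : C * C) (p q r n : nat).

(** Rotations are pairs (c, s) of determinant one. For this reason a turnover returns three
    rotations with no phase left over, and a unitary diagonal is passed by changing the sine alone.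
    The obstacle is the cost when k grows with n: updating X and Y at each position of every descent
    would cost n^2 k^2. A batch of at most k rotations is therefore moved in about n / k rounds,
    each with k^2 turnovers and O(k^2) operations on X and Y, hence in O(nk) operations; there are 2
    n batches. No loop bound depends on the data. [mkrotf] returns the exact identity when there is
    nothing to annihilate, [turnf] preserves this at the lower end, and a rotation that does not fit
    into n coordinates may be skipped because it is the identity. The cost can thus be computed from
    the syntax. The staggering of the chains is forced by the order of the factors: a rotation
    multiplied to W from the left becomes a head of a chain only if the chains further to the left
    are trivial around its position. Every stretch of the program conjugates by one product of
    rotations, and a lower bound on the positions in that product tells which zeros survive. *)

Definition unitg g : bool := g.1 * g.1^* + g.2 * g.2^* == 1.
Definition gid : C * C := (1, 0).
Definition ginv g : C * C := (g.1^*, - g.2).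

(* Vectors are functions on nat, so that no rotation is ever out of range. *)
Definition rot p g f : nat -> C := fun r =>
  if r == p then g.1 * f p + g.2 * f p.+1
  else if r == p.+1 then - g.2^* * f p + g.1^* * f p.+1 else f r.

Lemma unitg_id : unitg gid.
Proof. by rewrite /unitg /= rmorph1 rmorph0 mulr0 addr0 mulr1. Qed.

Lemma unitg_inv g : unitg g -> unitg (ginv g).
Proof.
by move=> /eqP gu; apply/eqP; rewrite /= conjCK rmorphN mulrNN -[RHS]gu; ring.
Qed.

Lemma ginvK : involutive ginv.
Proof. by case=> c s; rewrite /ginv /= conjCK opprK. Qed.

Lemma ginv_id : ginv gid = gid.
Proof. by rewrite /ginv /= rmorph1 oppr0. Qed.

Lemma rot_id p f : rot p gid f = f.
Proof.
apply: functional_extensionality => r; rewrite /rot /=.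
case: eqP => [->|_]; first by rewrite mul1r mul0r addr0.
by case: eqP => [->|//]; rewrite rmorph0 rmorph1 oppr0 mul0r mul1r add0r.
Qed.

Lemma rotK p g f : unitg g -> rot p (ginv g) (rot p g f) = f.
Proof.
move=> /eqP gu; apply: functional_extensionality => r; rewrite /rot /= !eqxx.
have -> : (p.+1 == p) = false by lia.
rewrite conjCK rmorphN /= opprK.
case: eqP => [->|_].
  by transitivity ((g.1 * g.1^* + g.2 * g.2^*) * f p); [ring | rewrite gu mul1r].
case: eqP => [->|//].
by transitivity ((g.1 * g.1^* + g.2 * g.2^*) * f p.+1); [ring | rewrite gu mul1r].
Qed.

Lemma rotKV p g f : unitg g -> rot p g (rot p (ginv g) f) = f.
Proof. by move=> /unitg_inv gu; rewrite -{1}[g]ginvK rotK. Qed.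

Lemma rot_comm p q g1 g2 f : (p.+1 < q)%N ->
  rot p g1 (rot q g2 f) = rot q g2 (rot p g1 f).
Proof.
move=> pq; apply: functional_extensionality => r; rewrite /rot.
have -> : (p == q) = false by lia.
have -> : (p == q.+1) = false by lia.
have -> : (p.+1 == q) = false by lia.
have -> : (p.+1 == q.+1) = false by lia.
have -> : (q == p) = false by lia.
have -> : (q == p.+1) = false by lia.
have -> : (q.+1 == p) = false by lia.
have -> : (q.+1 == p.+1) = false by lia.
case: (eqVneq r p) => [->|rp].
  by have [-> ->] : (p == q) = false /\ (p == q.+1) = false by lia.
case: (eqVneq r p.+1) => [->|//].
by have [-> ->] : (p.+1 == q) = false /\ (p.+1 == q.+1) = false by lia.
Qed.

Lemma rotD p g f h : rot p g (fun r => f r + h r) = fun r => rot p g f r + rot p g h r.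
Proof.
by apply: functional_extensionality => r; rewrite /rot; do 2?case: ifP => _ //; ring.
Qed.

Lemma rotZ p g (a : C) f : rot p g (fun r => f r * a) = fun r => rot p g f r * a.
Proof.
by apply: functional_extensionality => r; rewrite /rot; do 2?case: ifP => _ //; ring.
Qed.

Lemma rot0 p g : rot p g (fun=> 0) = fun=> 0.
Proof.
by apply: functional_extensionality => r; rewrite /rot; do 2?case: ifP => _ //; ring.
Qed.

Lemma rot_supp p g f : f p = 0 -> f p.+1 = 0 -> rot p g f = f.
Proof.
move=> fp fp1; apply: functional_extensionality => r; rewrite /rot fp fp1 !mulr0 addr0.
by case: eqP => [->//|_]; case: eqP => [->//|].
Qed.

(** The case [b = 0] does more than avoid a division by zero: only an exact identity may be left out
    when it sticks out of the first n coordinates. *)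
Definition mkrotf (a b : C) : C * C :=
  if b == 0 then gid
  else let r := sqrtC (a * a^* + b * b^*) in (a^* / r, b^* / r).

Lemma mkrotfP (a b : C) (g := mkrotf a b) :
  [/\ unitg g, - g.2^* * a + g.1^* * b = 0 & b = 0 -> g = gid].
Proof.
rewrite {}/g /mkrotf; case: eqP => [->|/eqP b0].
  by split=> //; [exact: unitg_id | rewrite /= rmorph0; ring].
set x := _ + _; set r := sqrtC x.
have x0 : 0 < x.
  rewrite /x ltr_wpDl ?mul_conjC_ge0 // lt_def mul_conjC_ge0 andbT.
  by rewrite mul_conjC_eq0.
have r0 : 0 < r by rewrite sqrtC_gt0.
have rr : r^* = r by apply/CrealP/gtr0_real.
have rx : r ^+ 2 = x by rewrite sqrtCK.
split=> /=; last by move/eqP; rewrite (negPf b0).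
  2: by rewrite !rmorphM /= !fmorphV /= !conjCK rr; ring.
rewrite /unitg /= !rmorphM /= !fmorphV /= !conjCK rr; apply/eqP.
have {}r0 : r != 0 by rewrite gt_eqF.
transitivity (x / r ^+ 2); last by rewrite rx divff // gt_eqF.
by rewrite /x; field.
Qed.

(* The relation says that b is the conjugate of the cross product of a and e,
   i.e. that (e, b, a) are the columns of an element of SU(3), up to norms. *)
Definition cross (a e b : C * C * C) : Prop :=
  [/\ b.1.1 = (a.1.2 * e.2 - a.2 * e.1.2)^*,
      b.1.2 = (a.2 * e.1.1 - a.1.1 * e.2)^*
    & b.2 = (a.1.1 * e.1.2 - a.1.2 * e.1.1)^*].

Definition rot12 g (v : C * C * C) : C * C * C :=
  (g.1 * v.1.1 + g.2 * v.1.2, - g.2^* * v.1.1 + g.1^* * v.1.2, v.2).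
Definition rot23 g (v : C * C * C) : C * C * C :=
  (v.1.1, g.1 * v.1.2 + g.2 * v.2, - g.2^* * v.1.2 + g.1^* * v.2).

(** Conjugated cross products are equivariant under unitary maps of determinant one. The coordinate
    that the rotation leaves alone is a 2 by 2 minor and picks up the determinant, which is where
    [unitg] enters. *)
Lemma cross_rot12 g a e b : unitg g -> cross a e b ->
  cross (rot12 g a) (rot12 g e) (rot12 g b).
Proof.
case: g a e b => c s [[a1 a2] a3] [[e1 e2] e3] [[b1 b2] b3] /eqP /= gu [/= -> -> ->].
split; rewrite /= !(rmorphB, rmorphD, rmorphM, rmorphN) /= ?conjCK; try ring.
rewrite -[LHS]mul1r -gu; ring.
Qed.

Lemma cross_rot23 g a e b : unitg g -> cross a e b ->
  cross (rot23 g a) (rot23 g e) (rot23 g b).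
Proof.
case: g a e b => c s [[a1 a2] a3] [[e1 e2] e3] [[b1 b2] b3] /eqP /= gu [/= -> -> ->].
split; rewrite /= !(rmorphB, rmorphD, rmorphM, rmorphN) /= ?conjCK; try ring.
rewrite -[LHS]mul1r -gu; ring.
Qed.

Definition tri p f : C * C * C := (f p, f p.+1, f p.+2).

Lemma tri_rot12 p g f : tri p (rot p g f) = rot12 g (tri p f).
Proof.
rewrite /tri /rot /rot12 /= !eqxx.
have -> : (p.+1 == p) = false by lia.
have -> : (p.+2 == p) = false by lia.
by have -> : (p.+2 == p.+1) = false by lia.
Qed.

Lemma tri_rot23 p g f : tri p (rot p.+1 g f) = rot23 g (tri p f).
Proof.
rewrite /tri /rot /rot23 /= !eqxx.
have -> : (p == p.+1) = false by lia.
have -> : (p == p.+2) = false by lia.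
by have -> : (p.+2 == p.+1) = false by lia.
Qed.

Lemma tri_ext p f h : tri p f = tri p h ->
  (forall r, r != p -> r != p.+1 -> r != p.+2 -> f r = h r) -> f = h.
Proof.
move=> [h0 h1 h2] e; apply: functional_extensionality => r.
case: (eqVneq r p) => [->//|r0]; case: (eqVneq r p.+1) => [->//|r1].
by case: (eqVneq r p.+2) => [->//|r2]; apply: e.
Qed.

Lemma rot_out p g f r : r != p -> r != p.+1 -> rot p g f r = f r.
Proof. by rewrite /rot => /negPf -> /negPf ->. Qed.

(** A QR factorization of the 3 by 3 product. Its first column is (m1, m2, m3); [u] annihilates m3
    and turns m2 into [rho], and the rotation built from m1 and [rho] reduces the column to the
    first unit vector. The remaining 2 by 2 block is read off the last column, of which [w] is the
    middle entry after [u]. One square root is needed, the one in [mkrotf]. *)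
Definition turnf (g1 g2 g3 : C * C) : (C * C) * (C * C) * (C * C) :=
  let m1 := g1.1 * g3.1 - g1.2 * g2.1 * g3.2^* in
  let m2 := - g1.2^* * g3.1 - g1.1^* * g2.1 * g3.2^* in
  let m3 := g2.2^* * g3.2^* in
  let u := mkrotf m2 m3 in
  let rho := u.1 * m2 + u.2 * m3 in
  let w := u.1 * g1.1^* * g2.2 + u.2 * g2.1^* in
  (ginv u, (m1, - rho^*),
   (u.1 * g2.1 - u.2 * g1.1 * g2.2^*, m1 * w - rho * g1.2 * g2.2)).

Lemma conjNK (x : C) : (- x^*)^* = - x.
Proof. by rewrite rmorphN /= conjCK. Qed.

Lemma rot12K g v : unitg g -> rot12 g (rot12 (ginv g) v) = v.
Proof.
case: g v => c s [[v1 v2] v3] /eqP /= gu; rewrite /rot12 /=.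
rewrite conjCK rmorphN /= opprK; congr (_, _, _).
  by rewrite -[RHS]mul1r -gu; ring.
by rewrite -[RHS]mul1r -gu; ring.
Qed.

Lemma rot23K g v : unitg g -> rot23 g (rot23 (ginv g) v) = v.
Proof.
case: g v => c s [[v1 v2] v3] /eqP /= gu; rewrite /rot23 /=.
rewrite conjCK rmorphN /= opprK; congr (_, _, _).
  by rewrite -[RHS]mul1r -gu; ring.
by rewrite -[RHS]mul1r -gu; ring.
Qed.

Definition dot3 (v e : C * C * C) : C := v.1.1^* * e.1.1 + v.1.2^* * e.1.2 + v.2^* * e.2.

Lemma dot3_rot12 g v e : unitg g -> dot3 (rot12 g v) (rot12 g e) = dot3 v e.
Proof.
case: g v e => c s [[v1 v2] v3] [[e1 e2] e3] /eqP /= gu; rewrite /dot3 /=.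
rewrite !(rmorphD, rmorphN, rmorphM) /= !conjCK; congr (_ + _).
rewrite -[RHS]mul1r -gu; ring.
Qed.

Lemma dot3_rot23 g v e : unitg g -> dot3 (rot23 g v) (rot23 g e) = dot3 v e.
Proof.
case: g v e => c s [[v1 v2] v3] [[e1 e2] e3] /eqP /= gu; rewrite /dot3 /=.
rewrite !(rmorphD, rmorphN, rmorphM) /= !conjCK -!addrA; congr (_ + _).
rewrite -[RHS]mul1r -gu; ring.
Qed.

Lemma turnfP g1 g2 g3 (t := turnf g1 g2 g3) : unitg g1 -> unitg g2 -> unitg g3 ->
  [/\ unitg t.1.1, unitg t.1.2, unitg t.2
    & forall p f, rot p g1 (rot p.+1 g2 (rot p g3 f)) =
                  rot p.+1 t.1.1 (rot p t.1.2 (rot p.+1 t.2 f))].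
Proof.
move=> u1 u2 u3; rewrite {}/t.
pose M v := rot12 g1 (rot23 g2 (rot12 g3 v)).
pose e1 : C * C * C := (1, 0, 0); pose e2 : C * C * C := (0, 1, 0).
pose e3 : C * C * C := (0, 0, 1).
rewrite /turnf.
set m1 := g1.1 * g3.1 - _; set m2 := - g1.2^* * g3.1 - _; set m3 := g2.2^* * g3.2^*.
have M1 : M e1 = (m1, m2, m3).
  by rewrite /M /rot12 /rot23 /= /m1 /m2 /m3; congr (_, _, _); ring.
have [uu um _] := mkrotfP m2 m3; move: (mkrotf m2 m3) uu um => u uu um.
set rho := u.1 * m2 + _; set w := u.1 * g1.1^* * g2.2 + _; cbv zeta.
have R1 : rot23 u (M e1) = (m1, rho, 0) by rewrite M1 /rot23 /= um.
(* Lengths and orthogonality of the columns come from the invariance of [dot3]; the product is never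
   expanded for them. *)
have nrm v e : dot3 (rot23 u (M v)) (rot23 u (M e)) = dot3 v e.
  by rewrite /M !(dot3_rot12, dot3_rot23).
have gu : unitg (m1, - rho^*).
  have := nrm e1 e1; rewrite R1 /dot3 /= => n1; apply/eqP; rewrite /= conjNK.
  move: n1; rewrite rmorph1 rmorph0 !mulr0 !addr0 mulr1 => <-; ring.
pose N v := rot12 (ginv (m1, - rho^*)) (rot23 u (M v)).
have N1 : N e1 = e1.
  move/eqP: gu => /=; rewrite conjNK => gu.
  rewrite /N R1 /rot12 /= opprK !conjCK.
  congr (_, _, _); rewrite -?gu; ring.
(* The vanishing first entry is the orthogonality of the first and the last column. *)
have N3 : N e3 = (0, m1 * w - rho * g1.2 * g2.2, (u.1 * g2.1 - u.2 * g1.1 * g2.2^*)^*).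
  have := nrm e1 e3; rewrite R1 /N /M /rot12 /rot23 /dot3 /= => n3.
  rewrite opprK !conjCK; congr (_, _, _).
  - move: n3; rewrite !rmorph0 !mulr0 !mul0r !mulr1 !add0r !addr0 => n3.
    by rewrite -[RHS]n3 /w; ring.
  - by rewrite /w; ring.
  - by rewrite rmorphB !rmorphM /= !conjCK; ring.
(* The middle column is determined by the other two as their conjugated cross product. This is where
   determinant one is used: the remaining block is a rotation, without a phase. *)
have N2 : N e2 = (0, u.1 * g2.1 - u.2 * g1.1 * g2.2^*,
                  - (m1 * w - rho * g1.2 * g2.2)^*).
  have : cross (N e3) (N e1) (N e2).
    apply/cross_rot12/cross_rot23/cross_rot12/cross_rot23/cross_rot12 => //.
      exact: unitg_inv.
    by split; rewrite /= ?mulr0 ?mul0r ?mulr1 ?subr0 ?subrr ?rmorph0 ?rmorph1.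
  rewrite N1 N3; case: (N e2) => [[b1 b2] b3] [/= -> -> ->].
  rewrite !mulr0 !mulr1 !subr0 sub0r conjCK; congr (_, _, _); first exact: conjC0.
  exact: rmorphN.
have gt : unitg (u.1 * g2.1 - u.2 * g1.1 * g2.2^*, m1 * w - rho * g1.2 * g2.2).
  have: dot3 (N e3) (N e3) = dot3 e3 e3.
    by rewrite /N dot3_rot12 ?nrm //; apply: unitg_inv.
  rewrite N3 /dot3 /= rmorph0 rmorph1 !mulr0 !add0r mulr1 conjCK => gt.
  by apply/eqP; rewrite /= -gt; ring.
split=> [|//|//|p f]; first exact: unitg_inv.
apply: (@tri_ext p); last first.
  by move=> r r0 r1 r2; rewrite !rot_out.
rewrite !(tri_rot12, tri_rot23).
set v := tri p f.
have Nv : N v = rot23 (u.1 * g2.1 - u.2 * g1.1 * g2.2^*, m1 * w - rho * g1.2 * g2.2) v.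
  have lin : N v = (v.1.1 * (N e1).1.1 + v.1.2 * (N e2).1.1 + v.2 * (N e3).1.1,
     v.1.1 * (N e1).1.2 + v.1.2 * (N e2).1.2 + v.2 * (N e3).1.2,
     v.1.1 * (N e1).2 + v.1.2 * (N e2).2 + v.2 * (N e3).2).
    by rewrite /N /M /rot12 /rot23 /=; congr (_, _, _); ring.
  by rewrite lin N1 N2 N3 /rot23 /=; congr (_, _, _); ring.
rewrite -Nv /N rot12K // -/(M v).
by have := rot23K (M v) (unitg_inv uu); rewrite ginvK => ->.
Qed.
End Rotations.

(** * Chains of rotations *)

Section Products.
Variable C : numClosedFieldType.
Implicit Types (f h : nat -> C) (g : C * C) (p q r n : nat).

(* A rotation that does not fit into the first n coordinates is required to be
   the identity. *)
Definition good n p g := unitg g /\ ((n <= p.+1)%N -> g = gid C).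
Definition supp b f := forall r, (b <= r)%N -> f r = 0.

Lemma good_id n p : good n p (gid C).
Proof. by split=> //; exact: unitg_id. Qed.

Lemma good_inv n p g : good n p g -> good n p (ginv g).
Proof. by case=> u e; split=> [|/e ->]; [exact: unitg_inv | exact: ginv_id]. Qed.

Lemma good_mkrot n p (a b : C) : ((n <= p.+1)%N -> b = 0) -> good n p (mkrotf a b).
Proof. by move=> b0; have [u _ e] := mkrotfP a b; split=> // /b0 /e. Qed.

(** If [p + 1] is the last coordinate, the middle rotation is the identity. Then m3 = 0, so [mkrotf]
    returns the identity, and both results at [p + 1] are identities again. *)
Lemma good_turn n p g1 g2 (g3 : C * C) (t := turnf g1 g2 g3) : (p.+1 < n)%N ->
  good n p g1 -> good n p.+1 g2 -> good n p g3 ->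
  [/\ good n p.+1 t.1.1, good n p t.1.2, good n p.+1 t.2
    & forall f, rot p g1 (rot p.+1 g2 (rot p g3 f)) =
                  rot p.+1 t.1.1 (rot p t.1.2 (rot p.+1 t.2 f))].
Proof.
rewrite {}/t => pn [u1 _] [u2 e2] [u3 _]; have [v1 v2 v3 E] := turnfP u1 u2 u3.
split; [split=> // | split=> // | split=> // |exact: E].
- move/e2 => -> /=; rewrite rmorph0 mul0r /mkrotf eqxx; exact: ginv_id.
- by move=> ?; lia.
move/e2 => -> /=; rewrite rmorph0 mul0r /mkrotf eqxx /= rmorph1 !mulr0.
rewrite !mul0r !mul1r !add0r !subr0 !mulr0; congr pair.
Qed.

Lemma supp_le a b f : (a <= b)%N -> supp a f -> supp b f.
Proof. by move=> ab fa r br; apply: fa; lia. Qed.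

Lemma supp_rot b p g f : (p.+1 < b)%N -> supp b f -> supp b (rot p g f).
Proof. by move=> pb fb r br; rewrite rot_out ?fb //; lia. Qed.

Lemma supp_good n p g f : good n p g -> supp n f -> supp n (rot p g f).
Proof.
move=> [_ e]; case: (ltnP p.+1 n) => [|/e ->]; first exact: supp_rot.
by rewrite rot_id.
Qed.

Lemma rot_fix b p g f : (b <= p)%N -> supp b f -> rot p g f = f.
Proof. by move=> bp fb; apply: rot_supp; apply: fb; lia. Qed.

(** The head of the list is the leftmost factor, applied last. *)
Definition act (l : seq (nat * (C * C))) f := foldr (fun x => rot x.1 x.2) f l.

Lemma act_cat l1 l2 f : act (l1 ++ l2) f = act l1 (act l2 f).
Proof. by rewrite /act foldr_cat. Qed.

Lemma actD l f h : act l (fun r => f r + h r) = fun r => act l f r + act l h r.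
Proof. by elim: l => //= x l ->; rewrite rotD. Qed.

Lemma actZ l f (a : C) : act l (fun r => f r * a) = fun r => act l f r * a.
Proof. by elim: l => //= x l ->; rewrite rotZ. Qed.

Lemma act0 l : act l (fun=> 0) = fun=> 0.
Proof. by elim: l => //= x l ->; rewrite rot0. Qed.

Lemma act_sum l k (F : nat -> nat -> C) :
  act l (fun r => \sum_(j < k) F j r) = fun r => \sum_(j < k) act l (F j) r.
Proof.
elim: k => [|k IH].
  have -> : (fun r => \sum_(j < 0) F j r) = (fun=> 0).
    by apply: functional_extensionality => r; rewrite big_ord0.
  by rewrite act0; apply: functional_extensionality => r; rewrite big_ord0.
have -> : (fun r => \sum_(j < k.+1) F j r) = (fun r => \sum_(j < k) F j r + F k r).
  by apply: functional_extensionality => r; rewrite big_ord_recr.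
rewrite actD IH; apply: functional_extensionality => r; by rewrite [RHS]big_ord_recr.
Qed.

Definition above lo (l : seq (nat * (C * C))) := all (fun x => lo <= x.1)%N l.
(** Both coordinates of every rotation lie below [hi], so that the product commutes with all
    rotations at position [hi] or later. *)
Definition below hi (l : seq (nat * (C * C))) := all (fun x => x.1.+1 < hi)%N l.
Definition goods n (l : seq (nat * (C * C))) := forall x, x \in l -> good n x.1 x.2.

Lemma goods_cat n l1 l2 : goods n l1 -> goods n l2 -> goods n (l1 ++ l2).
Proof. by move=> g1 g2 x; rewrite mem_cat => /orP[/g1|/g2]. Qed.

Lemma act_fix lo l f : above lo l -> supp lo f -> act l f = f.
Proof.
by elim: l => //= x l IH /andP[lx al] sf; rewrite IH // (rot_fix (b := lo)).
Qed.

Lemma act_comm q l g f : below q l -> act l (rot q g f) = rot q g (act l f).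
Proof. by elim: l => //= x l IH /andP[lx al]; rewrite IH // rot_comm. Qed.

Lemma supp_act b l f : below b l -> supp b f -> supp b (act l f).
Proof. by elim: l => //= x l IH /andP[lx al] sf; apply: supp_rot (IH al sf). Qed.

Lemma supp_goods n l f : goods n l -> supp n f -> supp n (act l f).
Proof.
elim: l => //= x l IH gl sf; apply: supp_good; first by apply: gl; rewrite inE eqxx.
by apply: IH => // y yl; apply: gl; rewrite inE yl orbT.
Qed.

Definition ip n f h := \sum_(r < n) (f r)^* * h r.

(** Truncating the sum at n cuts no rotation in half: either both coordinates are below n, or the
    rotation is the identity. *)
Lemma ip_rot n p g f h : good n p g -> ip n (rot p g f) (rot p g h) = ip n f h.
Proof.
case=> /eqP u e; case: (ltnP p.+1 n) => [pn|/e ->]; last by rewrite !rot_id.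
have p0 : (p < n)%N by lia.
rewrite /ip (bigD1 (Ordinal p0)) // (bigD1 (Ordinal pn)) /=; last first.
  by apply/eqP => /(congr1 val) /=; lia.
rewrite [RHS](bigD1 (Ordinal p0)) // [in RHS](bigD1 (Ordinal pn)) /=; last first.
  by apply/eqP => /(congr1 val) /=; lia.
rewrite !addrA; congr (_ + _); last first.
  apply: eq_bigr => r /andP[/eqP r1 /eqP r2].
  have r1' : (r : nat) != p by apply/eqP => rp; apply: r1; apply: val_inj.
  have r2' : (r : nat) != p.+1 by apply/eqP => rp; apply: r2; apply: val_inj.
  by rewrite !rot_out.
rewrite /rot !eqxx; have -> : (p.+1 == p) = false by lia.
rewrite !(rmorphD, rmorphM, rmorphN) /= !conjCK.
rewrite -[RHS]mul1r -u; ring.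
Qed.

Lemma ip_act n l f h : goods n l -> ip n (act l f) (act l h) = ip n f h.
Proof.
elim: l => //= x l IH gl; rewrite ip_rot; last by apply: gl; rewrite inE eqxx.
by apply: IH => // y yl; apply: gl; rewrite inE yl orbT.
Qed.

(** * Single chains: commutation, turnover, insertion of a head, and growth of the support *)

Definition chain (G : nat -> C * C) m l f := foldr (fun p => rot p (G p)) f (iota m l).

Lemma chain_ext (G G' : nat -> C * C) m l f :
  (forall p, (m <= p < m + l)%N -> G p = G' p) -> chain G m l f = chain G' m l f.
Proof.
elim: l m => //= l IH m E; rewrite /chain /= E; last lia.
congr rot; apply: IH => p pl; apply: E; lia.
Qed.

Lemma chain_cat G m l1 l2 f :
  chain G m (l1 + l2) f = chain G m l1 (chain G (m + l1) l2 f).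
Proof. by rewrite /chain iotaD foldr_cat. Qed.

Lemma chain_id G m l f : (forall p, (m <= p < m + l)%N -> G p = gid C) -> chain G m l f = f.
Proof.
elim: l m => //= l IH m E; rewrite /chain /= E; last lia.
by rewrite rot_id; apply: IH => p pl; apply: E; lia.
Qed.

Lemma chain_comm_hi G m l q g f : (q.+1 < m)%N ->
  chain G m l (rot q g f) = rot q g (chain G m l f).
Proof.
elim: l m => //= l IH m qm; rewrite /chain /= -!/(chain _ _ _ _) IH; last lia.
by rewrite -rot_comm.
Qed.

Lemma chain_comm_lo G m l q g f : (m + l < q)%N ->
  chain G m l (rot q g f) = rot q g (chain G m l f).
Proof.
elim: l m => //= l IH m qm; rewrite /chain /= -!/(chain _ _ _ _) IH; last lia.
by rewrite rot_comm; last lia.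
Qed.

Lemma chain_comm G n q g f : (forall p, (p <= q.+1)%N -> G p = gid C) ->
  chain G 0 n (rot q g f) = rot q g (chain G 0 n f).
Proof.
move=> E; case: (leqP n q.+2) => nq.
  by rewrite !chain_id // => p /andP[_ pn]; apply: E; lia.
have -> : n = (q.+2 + (n - q.+2))%N by lia.
rewrite !chain_cat !(@chain_id _ _ q.+2) => [|p pq|p pq]; try by apply: E; lia.
by rewrite chain_comm_hi //; lia.
Qed.

(** Coming from the right, the rotation commutes with the factors after [p + 1], is turned over with
    those at [p] and [p + 1], and leaves at [p + 1], where it commutes with the factors before
    [p]. *)
Lemma chain_turn (G G' : nat -> C * C) n p g g' f : (p.+1 < n)%N ->
  (forall r, r != p -> r != p.+1 -> G' r = G r) ->
  (forall f, rot p (G p) (rot p.+1 (G p.+1) (rot p g f)) =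
     rot p.+1 g' (rot p (G' p) (rot p.+1 (G' p.+1) f))) ->
  chain G 0 n (rot p g f) = rot p.+1 g' (chain G' 0 n f).
Proof.
move=> pn E T; have -> : n = (p + (2 + (n - p.+2)))%N by lia.
rewrite !chain_cat chain_comm_hi; last lia.
rewrite {2}/chain /= add0n T chain_comm_lo; last lia.
congr rot; rewrite (@chain_ext G' G 0 p); last by move=> r rp; apply: E; lia.
by rewrite (@chain_ext G' G _ (n - p.+2)) // => r rp; apply: E; lia.
Qed.

Lemma chain_insert (G G' : nat -> C * C) n q g f : (q < n)%N ->
  (forall p, (p <= q)%N -> G p = gid C) -> G' q = g ->
  (forall p, p != q -> G' p = G p) ->
  chain G' 0 n f = rot q g (chain G 0 n f).
Proof.
move=> qn E Gq E'; have -> : n = (q + (1 + (n - q.+1)))%N by lia.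
rewrite !chain_cat.
rewrite [LHS](@chain_id G' 0 q); last by move=> p pq; rewrite E' ?E //; lia.
rewrite [chain G 0 q _](@chain_id G 0 q); last by move=> p pq; rewrite E //; lia.
rewrite {1}/chain {2}/chain /= add0n Gq E // rot_id; congr rot.
by apply: chain_ext => p pq; apply: E'; lia.
Qed.

Lemma chain_fix G m l b f : (b <= m)%N -> supp b f -> chain G m l f = f.
Proof.
elim: l m => //= l IH m bm sf; rewrite /chain /= -/(chain _ _ _ _) IH //; last lia.
exact: (rot_fix (b := b)).
Qed.

(** Read from the right, the factors at [b] and later act on zeros, and the factor at [b - 1] is the
    only one that can fill a new coordinate, namely [b]. *)
Lemma supp_chain G m l b f : supp b f -> supp b.+1 (chain G m l f).
Proof.
move=> sf; elim: l m => [|l IH] m; first exact: (@supp_le b).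
rewrite /chain /= -/(chain _ _ _ _).
case: (ltnP m.+1 b) => mb; first by apply: supp_rot; first lia; apply: IH.
rewrite (@chain_fix _ _ _ b) //; case: (leqP b m) => bm.
  by rewrite (rot_fix (b := b)) //; exact: (@supp_le b).
by apply: supp_rot; [lia | exact: (@supp_le b)].
Qed.

(** * Products of k chains *)

Definition lam n k (G : nat -> nat -> C * C) f :=
  foldr (fun i => chain (G i) 0 n) f (iota 0 k).

Lemma lam_ext n k (G G' : nat -> nat -> C * C) f :
  (forall i p, (i < k)%N -> (p < n)%N -> G i p = G' i p) -> lam n k G f = lam n k G' f.
Proof.
rewrite /lam => E; have: all (fun i => i < k)%N (iota 0 k).
  by apply/allP => i; rewrite mem_iota.
elim: (iota 0 k) => //= i s IH /andP[ik sk]; rewrite IH //.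
by apply: chain_ext => p pn; apply: E.
Qed.

Lemma lam_id n k (G : nat -> nat -> C * C) f :
  (forall i p, (i < k)%N -> (p < n)%N -> G i p = gid C) -> lam n k G f = f.
Proof.
rewrite /lam => E; have: all (fun i => i < k)%N (iota 0 k).
  by apply/allP => i; rewrite mem_iota.
elim: (iota 0 k) => //= i s IH /andP[ik sk]; rewrite IH // chain_id //.
by move=> p pn; apply: E.
Qed.

Lemma supp_lam n k G b f : supp b f -> supp (b + k) (lam n k G f).
Proof.
move=> sf; rewrite /lam -{1}(size_iota 0 k); elim: (iota 0 k) => [|i s IH] /=.
  by rewrite addn0.
by rewrite addnS; apply: supp_chain.
Qed.

Lemma supp_lam_good n k (G : nat -> nat -> C * C) f :
  (forall i p, (i < k)%N -> (p < n)%N -> good n p (G i p)) ->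
  supp n f -> supp n (lam n k G f).
Proof.
move=> E sf; rewrite /lam; have: all (fun i => i < k)%N (iota 0 k).
  by apply/allP => i; rewrite mem_iota.
elim: (iota 0 k) => //= i s IH /andP[ik sk]; move: (IH sk); move: (foldr _ _ s) => h sh.
rewrite /chain; have: all (fun p => p < n)%N (iota 0 n).
  by apply/allP => p; rewrite mem_iota.
by elim: (iota 0 n) => //= p s' IH' /andP[pn sn]; apply: supp_good (E i p ik pn) (IH' sn).
Qed.

(** The new head of chain [i] has to leave through the chains to its left. It commutes with them
    because they are trivial up to position [q + 1]. *)
Lemma lam_insert n k (G G' : nat -> nat -> C * C) i q g f :
  (i < k)%N -> good n q g ->
  (forall i' p, (i' < i)%N -> (p <= q.+1)%N -> G i' p = gid C) ->
  (forall p, (p <= q)%N -> G i p = gid C) -> G' i q = g ->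
  (forall i' p, (i' != i) || (p != q) -> G' i' p = G i' p) ->
  lam n k G' f = rot q g (lam n k G f).
Proof.
move=> ik gg Elt Ei Eq E'; case: (ltnP q n) => qn; last first.
  case: gg => _ ->; last lia.
  rewrite rot_id; apply: lam_ext => i' p _ pn; apply: E'; lia.
have Ek : k = (i + (1 + (k - i.+1)))%N by lia.
rewrite /lam Ek !iotaD !foldr_cat /= !add0n.
set h := foldr _ f _; set h' := foldr _ f _.
have -> : h = h'.
  rewrite /h /h'; have: all (fun i' => i' != i) (iota (i + 1) (k - i.+1)).
    by apply/allP => i'; rewrite mem_iota; lia.
  elim: (iota _ _) => //= i' s IH /andP[ii si]; rewrite IH //.
  by apply: chain_ext => p _; apply: E'; rewrite ii.
rewrite (@chain_insert (G i) (G' i) n q g) //; last first.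
  by move=> p pq; apply: E'; rewrite pq orbT.
have: all (fun i' => i' < i)%N (iota 0 i) by apply/allP => i'; rewrite mem_iota; lia.
elim: (iota 0 i) => //= i' s IH /andP[ii si]; rewrite IH // chain_comm.
  congr rot; apply: chain_ext => p _; apply: E'; lia.
move=> p pq; rewrite E'; first exact: Elt; lia.
Qed.

(** * Passing through the unitary diagonal *)

Definition diag (d : nat -> C) f := fun r => d r * f r.

(** The phases that conjugation by the diagonal puts on the two off-diagonal entries are conjugate
    to each other, so the result has again the form of a rotation and the diagonal is unchanged. *)
Lemma diag_rot n (d : nat -> C) p g f : good n p g ->
  (forall r, (r < n)%N -> d r * (d r)^* = 1) ->
  diag d (rot p g f) = rot p (g.1, d p * g.2 * (d p.+1)^*) (diag d f).
Proof.
case=> _ e d1; case: (ltnP p.+1 n) => [pn|/e ->]; last first.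
  by rewrite /= mulr0 mul0r !rot_id.
have dp1 := d1 _ pn; have dp := d1 _ (ltnW pn).
apply: functional_extensionality => r; rewrite /diag /rot /=.
case: (eqVneq r p) => [->|_].
  transitivity (g.1 * (d p * f p) + d p * g.2 * f p.+1 * (d p.+1 * (d p.+1)^*)).
    by rewrite dp1; ring.
  by ring.
case: (eqVneq r p.+1) => [->|//].
rewrite !rmorphM /= conjCK.
transitivity (- (d p * (d p)^*) * d p.+1 * g.2^* * f p + g.1^* * (d p.+1 * f p.+1)).
  by rewrite dp; ring.
by ring.
Qed.

Lemma good_diag n (d : nat -> C) p g : good n p g ->
  (forall r, (r < n)%N -> d r * (d r)^* = 1) ->
  good n p (g.1, d p * g.2 * (d p.+1)^*).
Proof.
case=> /eqP u e d1; case: (ltnP p.+1 n) => [pn|np].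
  split=> [|]; last lia.
  have dp1 := d1 _ pn; have dp := d1 _ (ltnW pn).
  rewrite /unitg /= !rmorphM /= conjCK -u; apply/eqP; congr (_ + _).
  transitivity (g.2 * g.2^* * (d p * (d p)^*) * (d p.+1 * (d p.+1)^*)); first by ring.
  by rewrite dp dp1; ring.
by rewrite (e np) /= mulr0 mul0r; exact: good_id.
Qed.
End Products.

(** * Program analysis and the arithmetic kernels *)

(** These predicates over-approximate what a program may change. They compute, so each frame
    condition is settled by evaluation. *)
Fixpoint cwrites (a : nat) (p : prog) : bool :=
  match p with
  | Seq p1 p2 | IfLe _ _ p1 p2 | IfEq _ _ p1 p2 => cwrites a p1 || cwrites a p2
  | CSet (Ref b _ _) _ => a == b
  | For _ _ p1 => cwrites a p1
  | _ => false
  end.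

(** All registers share the complex array 13, so they are told apart by row; a row that is not a
    constant counts as every row. *)
Fixpoint rwrites (i : nat) (p : prog) : bool :=
  match p with
  | Seq p1 p2 | IfLe _ _ p1 p2 | IfEq _ _ p1 p2 => rwrites i p1 || rwrites i p2
  | CSet (Ref b e _) _ => (b == 13%N) && (if e is ICst m then i == m else true)
  | For _ _ p1 => rwrites i p1
  | _ => false
  end.

Fixpoint iwrites (a : nat) (p : prog) : bool :=
  match p with
  | Seq p1 p2 | IfLe _ _ p1 p2 | IfEq _ _ p1 p2 => iwrites a p1 || iwrites a p2
  | ISet b _ _ => a == b
  | For b _ p1 => (a == b) || iwrites a p1
  | _ => false
  end.

Fixpoint qwrites (p : prog) : bool :=
  match p with
  | Seq p1 p2 | IfLe _ _ p1 p2 | IfEq _ _ p1 p2 => qwrites p1 || qwrites p2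
  | For _ _ p1 => qwrites p1
  | OutRot _ _ _ _ | OutRefl _ _ _ => true
  | _ => false
  end.

Fixpoint hwrites (p : prog) : bool :=
  match p with
  | Seq p1 p2 | IfLe _ _ p1 p2 | IfEq _ _ p1 p2 => hwrites p1 || hwrites p2
  | For _ _ p1 => hwrites p1
  | OutRep _ _ _ _ => true
  | _ => false
  end.

Fixpoint ival (n k : nat) (e : iexp) : nat :=
  match e with
  | ICst m => m
  | IGet a _ => if a == 0%N then n else k
  | IAdd e1 e2 => ival n k e1 + ival n k e2
  | ISub e1 e2 => ival n k e1 - ival n k e2
  | IMul e1 e2 => ival n k e1 * ival n k e2
  | IDiv e1 e2 => ival n k e1 %/ ival n k e2
  | IMod e1 e2 => ival n k e1 %% ival n k e2
  end%N.

Fixpoint size_iexp (e : iexp) : bool :=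
  match e with
  | ICst _ => true
  | IGet a (ICst 0) => (a == 0%N) || (a == 1%N)
  | IGet _ _ => false
  | IAdd e1 e2 | ISub e1 e2 | IMul e1 e2 | IDiv e1 e2 | IMod e1 e2 =>
      size_iexp e1 && size_iexp e2
  end.

(** Loop bounds are expressions in n and k. [OutRefl] is excluded because its cost is the value of
    an integer expression at run time. *)
Fixpoint size_loops (p : prog) : bool :=
  match p with
  | Seq p1 p2 | IfLe _ _ p1 p2 | IfEq _ _ p1 p2 => size_loops p1 && size_loops p2
  | For _ e p1 => size_iexp e && size_loops p1
  | OutRefl _ _ _ => false
  | _ => true
  end.

(** Both branches of a test are charged, so that the bound depends on n and k only. *)
Fixpoint cost (n k : nat) (p : prog) : nat :=
  match p with
  | Seq p1 p2 | IfLe _ _ p1 p2 => cost n k p1 + cost n k p2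
  | IfEq _ _ p1 p2 => (cost n k p1 + cost n k p2).+1
  | CSet _ _ => 1
  | For _ e p1 => ival n k e * cost n k p1
  | OutRot _ _ _ _ | OutRep _ _ _ _ => 2
  | _ => 0
  end%N.

Section Frames.
Variable C : numClosedFieldType.
Implicit Types (s : state C) (p : prog) (a i n k : nat) (e : iexp).

Lemma exec_for a e p s : exec (For a e p) s =
  iteri (ieval s e) (fun i s' => exec p (iset s' a 0 i)) s.
Proof. by []. Qed.

(** [For] evaluates its bound once, on entry, so the number of passes is fixed even if the body
    changes the integers in the bound. *)
Lemma for_inv (I : nat -> state C -> Prop) a e p s : I 0%N s ->
  (forall i s', (i < ieval s e)%N -> I i s' -> I i.+1 (exec p (iset s' a 0 i))) ->
  I (ieval s e) (exec (For a e p) s).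
Proof.
move=> I0; rewrite exec_for; elim: (ieval s e) => //= m IH IS.
by apply: (IS m) => //; apply: IH => i s' im; apply: IS; lia.
Qed.

Lemma cframe a p s : ~~ cwrites a p -> cmem (exec p s) a = cmem s a.
Proof.
elim: p s => //=.
- by move=> p1 IH1 p2 IH2 s /norP[w1 w2]; rewrite IH2 // IH1.
- move=> [b e1 e2] e s ab; do 2!apply: functional_extensionality => ? /=.
  by rewrite (negPf ab).
- by move=> e1 e2 p1 IH1 p2 IH2 s /norP[w1 w2]; case: ifP => _; rewrite ?IH1 ?IH2.
- by move=> e1 e2 p1 IH1 p2 IH2 s /norP[w1 w2]; case: ifP => _; rewrite ?IH1 ?IH2.
- by move=> b e p IH s w; elim: (ieval s e) => //= m IHm; rewrite IH.
Qed.

Lemma rframe i p s : ~~ rwrites i p -> cmem (exec p s) 13 i = cmem s 13 i.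
Proof.
elim: p s => //=.
- by move=> p1 IH1 p2 IH2 s /norP[w1 w2]; rewrite IH2 // IH1.
- move=> [b e1 e2] e s ab; apply: functional_extensionality => ? /=.
  by rewrite (eq_sym 13%N b); case: (b == 13%N) ab => //=; case: e1 => //= m /negPf ->.
- by move=> e1 e2 p1 IH1 p2 IH2 s /norP[w1 w2]; case: ifP => _; rewrite ?IH1 ?IH2.
- by move=> e1 e2 p1 IH1 p2 IH2 s /norP[w1 w2]; case: ifP => _; rewrite ?IH1 ?IH2.
- by move=> b e p IH s w; elim: (ieval s e) => //= m IHm; rewrite IH.
Qed.

Lemma iframe a p s : ~~ iwrites a p -> imem (exec p s) a = imem s a.
Proof.
elim: p s => //=.
- by move=> p1 IH1 p2 IH2 s /norP[w1 w2]; rewrite IH2 // IH1.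
- move=> b e1 e2 s ab; apply: functional_extensionality => ? /=.
  by rewrite (negPf ab).
- by move=> [].
- by move=> e1 e2 p1 IH1 p2 IH2 s /norP[w1 w2]; case: ifP => _; rewrite ?IH1 ?IH2.
- by move=> e1 e2 p1 IH1 p2 IH2 s /norP[w1 w2]; case: ifP => _; rewrite ?IH1 ?IH2.
- move=> b e p IH s /norP[ab w]; elim: (ieval s e) => //= m IHm.
  rewrite IH //=; apply: functional_extensionality => ?.
  by rewrite (negPf ab) /= IHm.
Qed.

Lemma qframe p s : ~~ qwrites p -> qout (exec p s) = qout s.
Proof.
elim: p s => //=.
- by move=> p1 IH1 p2 IH2 s /norP[w1 w2]; rewrite IH2 // IH1.
- by move=> [].
- by move=> e1 e2 p1 IH1 p2 IH2 s /norP[w1 w2]; case: ifP => _; rewrite ?IH1 ?IH2.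
- by move=> e1 e2 p1 IH1 p2 IH2 s /norP[w1 w2]; case: ifP => _; rewrite ?IH1 ?IH2.
- by move=> b e p IH s w; elim: (ieval s e) => //= m IHm; rewrite IH.
Qed.

Lemma hframe p s : ~~ hwrites p -> hout (exec p s) = hout s.
Proof.
elim: p s => //=.
- by move=> p1 IH1 p2 IH2 s /norP[w1 w2]; rewrite IH2 // IH1.
- by move=> [].
- by move=> e1 e2 p1 IH1 p2 IH2 s /norP[w1 w2]; case: ifP => _; rewrite ?IH1 ?IH2.
- by move=> e1 e2 p1 IH1 p2 IH2 s /norP[w1 w2]; case: ifP => _; rewrite ?IH1 ?IH2.
- by move=> b e p IH s w; elim: (ieval s e) => //= m IHm; rewrite IH.
Qed.

Lemma ieval_size n k e s : imem s 0 0 = n -> imem s 1 0 = k -> size_iexp e ->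
  ieval s e = ival n k e.
Proof.
move=> n0 k0; elim: e => //=; try by move=> e1 IH1 e2 IH2 /andP[/IH1 -> /IH2 ->].
by move=> a [] //= [] // _ /orP[] /eqP ->.
Qed.

(** As the program never writes the integer arrays 0 and 1, every loop bound keeps the value that n
    and k give it at the start. *)
Lemma cost_le n k p s : ~~ iwrites 0 p -> ~~ iwrites 1 p -> size_loops p ->
  imem s 0 0 = n -> imem s 1 0 = k -> (ops (exec p s) <= ops s + cost n k p)%N.
Proof.
elim: p s => //=; try by move=> *; lia.
- move=> p1 IH1 p2 IH2 s /norP[a1 a2] /norP[b1 b2] /andP[c1 c2] n0 k0.
  have := IH1 s a1 b1 c1 n0 k0.
  by have := IH2 (exec p1 s) a2 b2 c2; rewrite !iframe // => /(_ n0 k0); lia.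
- by move=> [? ? ?] /= *; lia.
- move=> e1 e2 p1 IH1 p2 IH2 s /norP[a1 a2] /norP[b1 b2] /andP[c1 c2] n0 k0.
  have := IH1 s a1 b1 c1 n0 k0; have := IH2 s a2 b2 c2 n0 k0.
  by case: ifP => _; lia.
- move=> e1 e2 p1 IH1 p2 IH2 s /norP[a1 a2] /norP[b1 b2] /andP[c1 c2] n0 k0.
  have := IH1 (tick 1 s) a1 b1 c1 n0 k0; have := IH2 (tick 1 s) a2 b2 c2 n0 k0.
  by case: ifP => _ /=; lia.
- move=> b e p IH s /norP[a1 a2] /norP[b1 b2] /andP[c1 c2] n0 k0.
  rewrite -(ieval_size n0 k0 c1); elim: (ieval s e) => [|m IHm] /=; first by lia.
  set t := iteri _ _ _ in IHm *.
  have tn : imem t 0 = imem s 0.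
    rewrite /t; elim: (m) => //= m' IHm'; rewrite iframe //=.
    by apply: functional_extensionality => ?; rewrite (negPf a1) IHm'.
  have tk : imem t 1 = imem s 1.
    rewrite /t; elim: (m) => //= m' IHm'; rewrite iframe //=.
    by apply: functional_extensionality => ?; rewrite (negPf b1) IHm'.
  have := IH (iset t b 0 m) a2 b2 c2; rewrite /= (negPf a1) (negPf b1) /= tn tk.
  by move=> /(_ n0 k0); lia.
Qed.
End Frames.

(* Memory of the program.
   Integers: 0 = n; 1 = k; 2 = rank of the result; 8 = position of the current
   rotation; 9 = positions of the rotations being chased; 10 = current chain;
   11 = positions of the rotations of S; 3 to 7 = loop counters.
   Complex numbers: 3, 4, 5 = d, X, Y; 6, 7 = cosines and sines of the chains,
   entry (i, p) for the rotation at p of chain i; 8, 9 = the rotations being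
   chased; 10, 11 = the rotations of S; 12 = a column of H; 13 = registers, of
   which 0 and 1 hold the current rotation. *)
Definition block (ps : seq prog) : prog := foldr Seq Skip ps.
Definition var (a : nat) : iexp := IGet a (ICst 0).
Definition Reg (i : nat) : ref := Ref 13 (ICst i) (ICst 0).

Definition mkrot : prog := block
  [:: CSet (Reg 4) (CNat 0);
      IfEq (Reg 3) (Reg 4)
        (block [:: CSet (Reg 0) (CNat 1); CSet (Reg 1) (CNat 0)])
        (block [:: CSet (Reg 4) (CConj (Reg 2)); CSet (Reg 5) (CMul (Reg 2) (Reg 4));
                   CSet (Reg 6) (CConj (Reg 3)); CSet (Reg 7) (CMul (Reg 3) (Reg 6));
                   CSet (Reg 5) (CAdd (Reg 5) (Reg 7)); CSet (Reg 5) (CSqrt (Reg 5));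
                   CSet (Reg 0) (CDiv (Reg 4) (Reg 5)); CSet (Reg 1) (CDiv (Reg 6) (Reg 5))])].

Definition invrot : prog := block [:: CSet (Reg 0) (CConj (Reg 0)); CSet (Reg 1) (COpp (Reg 1))].

(** Straight-line evaluation of [turnf], with the two chain entries in registers 10 to 13 and the
    incoming rotation in 0 and 1. The first column goes to registers 14, 2 and 3, the last two being
    the inputs of [mkrot]. *)
Definition turn_pre : prog := block
  [:: CSet (Reg 14) (CMul (Reg 10) (Reg 0)); CSet (Reg 15) (CConj (Reg 1));
      CSet (Reg 16) (CMul (Reg 12) (Reg 15)); CSet (Reg 17) (CMul (Reg 11) (Reg 16));
      CSet (Reg 14) (CSub (Reg 14) (Reg 17));
      CSet (Reg 17) (CConj (Reg 11)); CSet (Reg 17) (CMul (Reg 17) (Reg 0));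
      CSet (Reg 2) (CConj (Reg 10)); CSet (Reg 2) (CMul (Reg 2) (Reg 16));
      CSet (Reg 2) (CAdd (Reg 17) (Reg 2)); CSet (Reg 2) (COpp (Reg 2));
      CSet (Reg 3) (CConj (Reg 13)); CSet (Reg 3) (CMul (Reg 3) (Reg 15))].

Definition turn_post : prog := block
  [:: CSet (Reg 4) (CMul (Reg 0) (Reg 2)); CSet (Reg 5) (CMul (Reg 1) (Reg 3));
      CSet (Reg 4) (CAdd (Reg 4) (Reg 5));
      CSet (Reg 5) (CConj (Reg 10)); CSet (Reg 5) (CMul (Reg 0) (Reg 5));
      CSet (Reg 5) (CMul (Reg 5) (Reg 13)); CSet (Reg 6) (CConj (Reg 12));
      CSet (Reg 6) (CMul (Reg 1) (Reg 6)); CSet (Reg 5) (CAdd (Reg 5) (Reg 6));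
      CSet (Reg 6) (CMul (Reg 0) (Reg 12)); CSet (Reg 7) (CConj (Reg 13));
      CSet (Reg 7) (CMul (Reg 10) (Reg 7)); CSet (Reg 7) (CMul (Reg 1) (Reg 7));
      CSet (Reg 12) (CSub (Reg 6) (Reg 7));
      CSet (Reg 7) (CMul (Reg 14) (Reg 5)); CSet (Reg 8) (CMul (Reg 4) (Reg 11));
      CSet (Reg 8) (CMul (Reg 8) (Reg 13)); CSet (Reg 13) (CSub (Reg 7) (Reg 8));
      CSet (Reg 10) (CCopy (Reg 14)); CSet (Reg 4) (CConj (Reg 4)); CSet (Reg 11) (COpp (Reg 4));
      invrot].

Definition rotarr (a : nat) (e : iexp) : prog :=
  let x := Ref a (var 8) (var 7) in
  let y := Ref a (IAdd (var 8) (ICst 1)) (var 7) in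
  For 7 e (block
    [:: CSet (Reg 4) (CMul (Reg 0) x); CSet (Reg 5) (CMul (Reg 1) y);
        CSet (Reg 4) (CAdd (Reg 4) (Reg 5));
        CSet (Reg 5) (CConj (Reg 1)); CSet (Reg 5) (CMul (Reg 5) x);
        CSet (Reg 6) (CConj (Reg 0)); CSet (Reg 6) (CMul (Reg 6) y);
        CSet x (CCopy (Reg 4)); CSet y (CSub (Reg 6) (Reg 5))]).

(** A rotation that is suppressed here is the identity by [good]. *)
Definition emit : prog :=
  IfLe (IAdd (var 8) (ICst 2)) (var 0)
    (OutRot (var 8) (IAdd (var 8) (ICst 1)) (Reg 0) (Reg 1)) Skip.

Section Registers.
Variable C : numClosedFieldType.
Implicit Types (s : state C) (p : prog).

Definition reg s i : C := cmem s 13 i 0.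
Definition rr s : C * C := (reg s 0, reg s 1).
Definition col s a j : nat -> C := fun r => cmem s a r j.

Lemma exec_block ps s : exec (block ps) s = foldl (fun s' p => exec p s') s ps.
Proof. by elim: ps s => //= p ps IH s; rewrite IH. Qed.

Lemma reg_frame p s i : ~~ rwrites i p -> reg (exec p s) i = reg s i.
Proof. by rewrite /reg => /rframe ->. Qed.

Lemma mkrotE s : rr (exec mkrot s) = mkrotf (reg s 2) (reg s 3).
Proof. by rewrite /rr /reg /mkrotf /=; case: ifP => _ /=. Qed.

Lemma invrotE s : rr (exec invrot s) = ginv (rr s).
Proof. by []. Qed.

Lemma turn_preE s (s' := exec turn_pre s) : 
  [/\ reg s' 14 = reg s 10 * reg s 0 - reg s 11 * reg s 12 * (reg s 1)^*,
      reg s' 2 = - (reg s 11)^* * reg s 0 - (reg s 10)^* * reg s 12 * (reg s 1)^*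
    & reg s' 3 = (reg s 13)^* * (reg s 1)^*].
Proof. by split; rewrite /reg /=; ring. Qed.

Lemma turn_postE s (s' := exec turn_post s) (u := rr s)
    (rho := u.1 * reg s 2 + u.2 * reg s 3)
    (w := u.1 * (reg s 10)^* * reg s 13 + u.2 * (reg s 12)^*) :
  [/\ rr s' = ginv u, (reg s' 10, reg s' 11) = (reg s 14, - rho^*)
    & (reg s' 12, reg s' 13) =
      (u.1 * reg s 12 - u.2 * reg s 10 * (reg s 13)^*,
       reg s 14 * w - rho * reg s 11 * reg s 13)].
Proof.
rewrite {}/s' {}/rho {}/w {}/u; split; rewrite /rr /reg /=; congr pair; ring.
Qed.

Definition turnk : prog := block [:: turn_pre; mkrot; turn_post].

Lemma turnkE s (s' := exec turnk s) :
  (rr s', (reg s' 10, reg s' 11), (reg s' 12, reg s' 13)) =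
  turnf (reg s 10, reg s 11) (reg s 12, reg s 13) (rr s).
Proof.
rewrite {}/s' /turnk exec_block; cbv [foldl].
have [m1 m2 m3] := turn_preE s.
have E i (w : ~~ rwrites i turn_pre) := reg_frame s w.
move: (exec turn_pre s) m1 m2 m3 E => s1 m1 m2 m3 E.
have u := mkrotE s1; have E2 i (w : ~~ rwrites i mkrot) := reg_frame s1 w.
move: (exec mkrot s1) u E2 => s2 u E2.
have [] := turn_postE s2; move: (exec turn_post s2) => s3 r1 r2 r3. rewrite r1 r2 r3 u.
by rewrite (E2 2) // (E2 3) // (E2 10) // (E2 11) // (E2 12) // (E2 13) // (E2 14) //
  m1 m2 m3 (E 10) // (E 11) // (E 12) // (E 13).
Qed.

Lemma rotarrE a e s (p : nat) (s' := exec (rotarr a e) s) : a != 13%N -> imem s 8 0 = p ->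
  [/\ forall j, (j < ieval s e)%N -> col s' a j = rot p (rr s) (col s a j),
      forall j, (ieval s e <= j)%N -> col s' a j = col s a j
    & rr s' = rr s].
Proof.
move=> /negPf na p0; have na' : (13%N == a) = false by rewrite eq_sym.
pose I (i : nat) t := [/\ imem t 8 0 = p, rr t = rr s,
  forall j, (j < i)%N -> col t a j = rot p (rr s) (col s a j)
  & forall j, (i <= j)%N -> col t a j = col s a j].
have: I (ieval s e) s'.
  apply: for_inv => [|i t ie [p1 r1 c1 d1]]; first by split.
  have pp : (p.+1 == p) = false by lia.
  set t' := exec _ _.
  have E j : col t' a j = if j == i then rot p (rr t) (col t a j) else col t a j.
    apply: functional_extensionality => r.
    rewrite {}/t' /col /rot /rr /reg /= ?na ?na' /= ?p1 ?addn1 eqxx /=.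
    case: (eqVneq j i) => [->|_]; last by rewrite !andbF.
    rewrite !andbT; case: (eqVneq r p.+1) => [->|_]; last by case: ifP.
    by rewrite pp; ring.
  split.
  - exact: p1.
  - by rewrite -r1 /t' /rr /reg /= !na !na'.
  - move=> j ji; rewrite E; case: eqP => [->|ne].
      by rewrite r1 d1.
    by apply: c1; lia.
  by move=> j ij; rewrite E d1; [case: eqP => //; lia | lia].
by case=> _ r c d; split.
Qed.
End Registers.

(** * Passing a rotation through the chains *)

Definition apply_rot : prog := block [:: rotarr 4 (var 1); rotarr 5 (var 1); emit].

Definition turn_load : prog :=
  let p1 := IAdd (var 8) (ICst 1) in block
  [:: CSet (Reg 10) (CCopy (Ref 6 (var 10) (var 8)));
      CSet (Reg 11) (CCopy (Ref 7 (var 10) (var 8)));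
      CSet (Reg 12) (CCopy (Ref 6 (var 10) p1));
      CSet (Reg 13) (CCopy (Ref 7 (var 10) p1))].

Definition turn_store : prog :=
  let p1 := IAdd (var 8) (ICst 1) in block
  [:: CSet (Ref 6 (var 10) (var 8)) (CCopy (Reg 10));
      CSet (Ref 7 (var 10) (var 8)) (CCopy (Reg 11));
      CSet (Ref 6 (var 10) p1) (CCopy (Reg 12));
      CSet (Ref 7 (var 10) p1) (CCopy (Reg 13))].

(** Beyond the bottom there is nothing to turn over, but the position still advances, so that every
    pass has the same number of steps. *)
Definition turn : prog := block
  [:: IfLe (IAdd (var 8) (ICst 2)) (var 0) (block [:: turn_load; turnk; turn_store]) Skip;
      ISet 8 (ICst 0) (IAdd (var 8) (ICst 1))].

(** The sine is multiplied by the two phases of [diag_rot]: the rotation has then passed D. *)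
Definition pass_load : prog := block
  [:: CSet (Reg 0) (CCopy (Ref 8 (var 4) (ICst 0)));
      CSet (Reg 1) (CCopy (Ref 9 (var 4) (ICst 0)));
      ISet 8 (ICst 0) (IGet 9 (var 4));
      CSet (Reg 2) (CCopy (Ref 3 (var 8) (ICst 0)));
      CSet (Reg 1) (CMul (Reg 2) (Reg 1));
      CSet (Reg 2) (CConj (Ref 3 (IAdd (var 8) (ICst 1)) (ICst 0)));
      CSet (Reg 1) (CMul (Reg 1) (Reg 2))].

Definition store_slot : prog := block
  [:: CSet (Ref 8 (var 4) (ICst 0)) (CCopy (Reg 0));
      CSet (Ref 9 (var 4) (ICst 0)) (CCopy (Reg 1));
      ISet 9 (var 4) (var 8)].

(** The chain index counts down because a rotation coming from the right meets the last chain
    first. *)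
Definition turns : prog :=
  For 6 (var 1) (block
    [:: ISet 10 (ICst 0) (ISub (ISub (var 1) (ICst 1)) (var 6)); turn]).

Definition pass : prog := block [:: pass_load; turns; store_slot].
(** [pass] keeps in the slot the rotation that comes out on the left. X, Y and Q are multiplied by
    its inverse; this conjugation cancels it on the left and puts it back on the right, hence the
    slot is not inverted. *)
Definition round : prog := For 4 (var 1) (block [:: pass; invrot; apply_rot]).
(** Each round moves every slot down by k, and n / k + 1 rounds exceed n positions. With k^2
    turnovers per round, the batch costs O(nk) for k at most n. *)
Definition rounds : prog := For 5 (IAdd (IDiv (var 0) (var 1)) (ICst 1)) round.

Section Chase.
Variables (C : numClosedFieldType) (n k : nat).
Implicit Types (s : state C) (g : C * C) (f : nat -> C).

(** Reflections get a dummy meaning here; [okq] excludes them and also makes all coordinates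
    adjacent. *)
Definition actq (es : seq (elementary C)) f := foldl
  (fun h e => if e is Rotation g then rot (gi g) (gc g, gs g) h else h) f es.

Definition okq (e : elementary C) : bool :=
  if e is Rotation g then [&& gj g == (gi g).+1, (gj g < n)%N & unitg (gc g, gs g)]
  else false.

Definition dims s := imem s 0 0 = n /\ imem s 1 0 = k.
Definition GG s i p : C * C := (cmem s 6 i p, cmem s 7 i p).
Definition slot s t : C * C := (cmem s 8 t 0, cmem s 9 t 0).
Definition pos s t : nat := imem s 9 t.

Lemma dims_frame p s : ~~ iwrites 0 p -> ~~ iwrites 1 p -> dims s -> dims (exec p s).
Proof. by move=> w0 w1; rewrite /dims !iframe. Qed.

Lemma emitE p s f : dims s -> imem s 8 0 = p -> good n p (rr s) ->
  actq (qout (exec emit s)) f = rot p (rr s) (actq (qout s) f).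
Proof.
move=> [n0 _] p0 [_ e] /=; rewrite n0 p0; case: ifP => [_|pn] /=.
  by rewrite /actq foldl_rcons /= p0.
by rewrite e ?rot_id //; lia.
Qed.

Lemma emit_ok p s : dims s -> imem s 8 0 = p -> good n p (rr s) ->
  all okq (qout s) -> all okq (qout (exec emit s)).
Proof.
move=> [n0 _] p0 [u _] q /=; rewrite n0 p0; case: ifP => [pn|//] /=.
rewrite all_rcons q andbT /= p0 addn1 eqxx /=; apply/andP; split=> //; lia.
Qed.

Lemma apply_rotE p s (s' := exec apply_rot s) :
    dims s -> imem s 8 0 = p -> good n p (rr s) ->
  [/\ forall j, (j < k)%N -> col s' 4 j = rot p (rr s) (col s 4 j),
      forall j, (j < k)%N -> col s' 5 j = rot p (rr s) (col s 5 j),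
      forall f, actq (qout s') f = rot p (rr s) (actq (qout s) f),
      all okq (qout s) -> all okq (qout s')
    & rr s' = rr s].
Proof.
move=> ds p0 gp; rewrite {}/s' /apply_rot exec_block; cbv [foldl].
have [X _ r1] := rotarrE (a := 4) (var 1) (s := s) isT p0.
have Y1 : cmem (exec (rotarr 4 (var 1)) s) 5 = cmem s 5 by exact: cframe.
have q1 : qout (exec (rotarr 4 (var 1)) s) = qout s by exact: qframe.
have p1 : imem (exec (rotarr 4 (var 1)) s) 8 0 = p by rewrite iframe.
have d1 : dims (exec (rotarr 4 (var 1)) s) by exact: dims_frame.
have e1 : ieval s (var 1) = k by case: ds.
have e2 : ieval (exec (rotarr 4 (var 1)) s) (var 1) = k by case: d1.
move: (exec (rotarr 4 (var 1)) s) X r1 Y1 q1 p1 d1 e2 => s1 X r1 Y1 q1 p1 d1 e2.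
have [Y _ r2] := rotarrE (a := 5) (var 1) (s := s1) isT p1.
have X2 : cmem (exec (rotarr 5 (var 1)) s1) 4 = cmem s1 4 by exact: cframe.
have q2 : qout (exec (rotarr 5 (var 1)) s1) = qout s1 by exact: qframe.
have p2 : imem (exec (rotarr 5 (var 1)) s1) 8 0 = p by rewrite iframe.
have d2 : dims (exec (rotarr 5 (var 1)) s1) by exact: dims_frame.
move: (exec (rotarr 5 (var 1)) s1) Y r2 X2 q2 p2 d2 => s2 Y r2 X2 q2 p2 d2.
rewrite r1 in r2 Y; rewrite -r2 in gp.
split.
- by move=> j jk; rewrite /col cframe // X2; apply: X; rewrite e1.
- move=> j jk; rewrite /col cframe // -/(col _ _ _) Y ?e2 //.
  by rewrite /col Y1.
- by move=> f; rewrite (emitE _ d2 p2 gp) r2 q2 q1.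
- by move=> q; apply: (emit_ok d2 p2 gp); rewrite q2 q1.
by rewrite /rr !reg_frame.
Qed.

Lemma turn_loadE i p s (s' := exec turn_load s) :
  imem s 10 0 = i -> imem s 8 0 = p ->
  [/\ (reg s' 10, reg s' 11) = GG s i p, (reg s' 12, reg s' 13) = GG s i p.+1
    & rr s' = rr s].
Proof. by move=> i0 p0; rewrite {}/s' /rr /reg /GG /= i0 p0 addn1. Qed.

Lemma turn_storeE i p s (s' := exec turn_store s) :
  imem s 10 0 = i -> imem s 8 0 = p ->
  (forall i' q, GG s' i' q = if (i' == i) && (q == p.+1) then (reg s 12, reg s 13)
     else if (i' == i) && (q == p) then (reg s 10, reg s 11) else GG s i' q)
  /\ rr s' = rr s.
Proof.
move=> i0 p0; rewrite {}/s'; split=> // i' q; rewrite /GG /reg /= i0 p0 addn1.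
by case: (eqVneq i' i) => [->|] //=; case: (eqVneq q p.+1) => //= _; case: ifP.
Qed.

Lemma turnE i p s (s' := exec turn s) :
    dims s -> imem s 10 0 = i -> imem s 8 0 = p -> (i < k)%N ->
    (forall q, (q < n)%N -> good n q (GG s i q)) -> good n p (rr s) ->
  [/\ imem s' 8 0 = p.+1, good n p.+1 (rr s'),
      forall f, chain (GG s i) 0 n (rot p (rr s) f) =
                rot p.+1 (rr s') (chain (GG s' i) 0 n f),
      forall q, (q < n)%N -> good n q (GG s' i q)
    & forall i' q, (i' != i) || (q < p)%N -> GG s' i' q = GG s i' q].
Proof.
move=> ds i0 p0 ik gG gp; rewrite {}/s' /turn.
pose body := block [:: turn_load; turnk; turn_store].
have -> : exec (block [:: IfLe (IAdd (var 8) (ICst 2)) (var 0) body Skip;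
      ISet 8 (ICst 0) (IAdd (var 8) (ICst 1))]) s =
    iset (if (p + 2 <= n)%N then exec body s else s) 8 0 p.+1.
  rewrite exec_block; cbv [foldl]; case: ds => n0 k0.
  rewrite [exec (IfLe _ _ _ _) _]/exec -/exec.
  rewrite [ieval s (var 0)]/= [ieval s (IAdd _ _)]/= n0 p0.
  have: imem (if (p + 2 <= n)%N then exec body s else s) 8 0 = p.
    by case: ifP => _ //; rewrite iframe.
  by move: (if _ then _ else _) => t t0; rewrite /= t0 addn1.
suff: let s' := if (p + 2 <= n)%N then exec body s else s in
   [/\ good n p.+1 (rr s'),
      forall f, chain (GG s i) 0 n (rot p (rr s) f) =
                rot p.+1 (rr s') (chain (GG s' i) 0 n f),
      forall q, (q < n)%N -> good n q (GG s' i q)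
    & forall i' q, (i' != i) || (q < p)%N -> GG s' i' q = GG s i' q].
  by cbv zeta; move: (if _ then _ else _) => t [].
cbv zeta; case: ifP => pn; last first.
  (* The skipped turnover is correct because the rotation is the identity here. *)
  have rid : rr s = gid C by case: gp => _; apply; lia.
  split=> //; first by rewrite rid; exact: good_id.
  by move=> f; rewrite rid !rot_id.
rewrite {}/body exec_block; cbv [foldl].
have [l1 l2 l0] := turn_loadE i0 p0.
have i1 : imem (exec turn_load s) 10 0 = i by rewrite iframe.
have p1 : imem (exec turn_load s) 8 0 = p by rewrite iframe.
have G1 i' q : GG (exec turn_load s) i' q = GG s i' q by rewrite /GG !cframe.
move: (exec turn_load s) l1 l2 l0 i1 p1 G1 => s1 l1 l2 l0 i1 p1 G1.
have := turnkE s1; cbv zeta; rewrite l1 l2 l0.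
have i2 : imem (exec turnk s1) 10 0 = i by rewrite iframe.
have p2 : imem (exec turnk s1) 8 0 = p by rewrite iframe.
have G2 i' q : GG (exec turnk s1) i' q = GG s i' q by rewrite -G1 /GG !cframe.
move: (exec turnk s1) i2 p2 G2 => s2 i2 p2 G2 E.
have := turn_storeE i2 p2; cbv zeta.
move: (exec turn_store s2) => s3 [G3 r3].
have pn1 : (p.+1 < n)%N by lia.
have := good_turn pn1 (gG _ (ltnW pn1)) (gG _ pn1) gp.
rewrite -E /= -r3 => -[t1 t2 t3 T].
have Gp : GG s3 i p = (reg s2 10, reg s2 11).
  by rewrite G3 !eqxx /=; case: eqP => //; lia.
have Gp1 : GG s3 i p.+1 = (reg s2 12, reg s2 13) by rewrite G3 !eqxx.
split=> // [f|q qn|i' q iq].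
- apply: chain_turn => // [q qp qp1|h]; first by rewrite G3 (negPf qp) (negPf qp1) !andbF G2.
  by rewrite T Gp Gp1.
- case: (eqVneq q p) => [->|qp]; first by rewrite Gp.
  case: (eqVneq q p.+1) => [->|qp1]; first by rewrite Gp1.
  by rewrite G3 (negPf qp) (negPf qp1) !andbF G2; apply: gG.
rewrite G3 -G2; case: eqP iq => //= _ qp.
by do 2![case: eqP; first by lia].
Qed.

(** A segment of [lam], for the moments when a rotation is in the middle of the product. *)
Definition lamr (G : nat -> nat -> C * C) m l f :=
  foldr (fun i => chain (G i) 0 n) f (iota m l).

Lemma lamr_ext (G G' : nat -> nat -> C * C) m l f :
  (forall i q, (m <= i < m + l)%N -> G i q = G' i q) -> lamr G m l f = lamr G' m l f.
Proof.
elim: l m => //= l IH m E; rewrite /lamr /= -!/(lamr _ _ _ _) IH; last first.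
  by move=> i q im; apply: E; lia.
by apply: chain_ext => q _; apply: E; lia.
Qed.

Definition Ggood s := forall i q, (i < k)%N -> (q < n)%N -> good n q (GG s i q).

(** One position is gained per chain, so the rotation enters chain [i] at [p + (k - 1 - i)] and
    changes nothing before. The last claim records this; it is what preserves the staggered
    heads. *)
Lemma turnsE p s (s' := exec turns s) :
    dims s -> imem s 8 0 = p -> Ggood s -> good n p (rr s) ->
  [/\ imem s' 8 0 = (p + k)%N, good n (p + k) (rr s'),
      forall f, lam n k (GG s) (rot p (rr s) f) =
                rot (p + k) (rr s') (lam n k (GG s') f),
      Ggood s'
    & forall i q, (i < k)%N -> (q < p + (k.-1 - i))%N -> GG s' i q = GG s i q].
Proof.
move=> ds p0 gG gp.
(* After [l] turns the chains from [k - l] on are updated and the rotation stands to their left; the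
   other chains are still the old ones. *)
pose I l t := (l <= k)%N ->
  [/\ dims t, imem t 8 0 = (p + l)%N, good n (p + l) (rr t), Ggood t &
  [/\ forall f, lamr (GG s) (k - l) l (rot p (rr s) f) =
                rot (p + l) (rr t) (lamr (GG t) (k - l) l f),
      forall i q, (i < k - l)%N -> GG t i q = GG s i q
    & forall i q, (i < k)%N -> (q < p + (k.-1 - i))%N -> GG t i q = GG s i q]].
have e1 : ieval s (var 1) = k by case: ds.
suff: I k s' by move=> /(_ (leqnn k)) [_ p1 r1 G1 [E _ B]]; rewrite subnn in E; split.
rewrite -{1}e1; apply: for_inv => [|l t lk It lk1].
  by split=> //; rewrite ?addn0.
have {It} [d1 p1 r1 G1 [E K B]] := It (ltnW lk1).
rewrite exec_block; cbv [foldl].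
set t0 := exec (ISet _ _ _) _; pose i := (k.-1 - l)%N.
have d0 : dims t0 by [].
have i0 : imem t0 10 0 = i by rewrite /t0 /= (proj2 d1) subn1.
have p0' : imem t0 8 0 = (p + l)%N by [].
have GGt : GG t0 = GG t by [].
have r0 : rr t0 = rr t by [].
have ik : (i < k)%N by rewrite /i; lia.
have d2 : dims (exec turn t0) by exact: dims_frame.
have [] := turnE d0 i0 p0' ik (fun q => G1 i q ik) r1.
move: (exec turn t0) d2 => t' d2; rewrite GGt r0 => p2 g2 T G2 K2.
have ki : (k - l.+1)%N = i by rewrite /i; lia.
split=> //; rewrite ?addnS //.
  move=> j q jk qn; case: (eqVneq j i) => [->|ji]; first exact: G2.
  by rewrite K2 ?ji //; apply: G1.
split.
- move=> f; rewrite ki; have := E f.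
  have -> : (k - l)%N = i.+1 by rewrite /i; lia.
  rewrite /lamr /= -!/(lamr _ _ _ _) => ->.
  have -> : chain (GG s i) 0 n (rot (p + l) (rr t) (lamr (GG t) i.+1 l f)) =
            chain (GG t i) 0 n (rot (p + l) (rr t) (lamr (GG t) i.+1 l f)).
    by apply: chain_ext => q _; rewrite K //; rewrite /i; lia.
  rewrite T; congr (rot _ _ (chain _ _ _ _)).
  by apply: lamr_ext => j q jl; rewrite K2 //; apply/orP; left; lia.
- by move=> j q jk; rewrite K2; [apply: K; lia | apply/orP; left; lia].
move=> j q jk qp; case: (ltnP q (p + l)) => ql.
  by rewrite K2 ?ql ?orbT //; apply: B.
by rewrite K2; [apply: B | apply/orP; left; rewrite /i; lia].
Qed.

Definition dd s := col s 3 0.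
Definition dgood s := forall r, (r < n)%N -> dd s r * (dd s r)^* = 1.

Lemma pass_loadE t p s (s' := exec pass_load s) :
  imem s 4 0 = t -> imem s 9 t = p ->
  [/\ imem s' 8 0 = p, rr s' = ((slot s t).1, dd s p * (slot s t).2 * (dd s p.+1)^*),
      GG s' = GG s & imem s' 4 0 = t].
Proof. by move=> t0 p0; rewrite {}/s' /rr /reg /= t0 p0 addn1. Qed.

Lemma store_slotE t s (s' := exec store_slot s) : imem s 4 0 = t ->
  [/\ rr s' = rr s, forall u, slot s' u = if u == t then rr s else slot s u,
      forall u, pos s' u = if u == t then imem s 8 0 else pos s u
    & imem s' 8 0 = imem s 8 0].
Proof.
move=> t0; rewrite {}/s'; split=> // u; rewrite /slot /pos /= t0; last by [].
by rewrite !andbT; case: ifP.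
Qed.

Lemma passE t s (p := pos s t) (s' := exec pass s) :
    dims s -> imem s 4 0 = t -> (t < k)%N -> Ggood s -> dgood s ->
    good n p (slot s t) ->
  [/\ [/\ imem s' 8 0 = (p + k)%N, pos s' t = (p + k)%N, rr s' = slot s' t,
      good n (p + k) (slot s' t) & Ggood s'],
      forall f, lam n k (GG s) (diag (dd s) (rot p (slot s t) f)) =
                rot (p + k) (slot s' t) (lam n k (GG s') (diag (dd s) f)),
      forall i q, (i < k)%N -> (q < p + (k.-1 - i))%N -> GG s' i q = GG s i q,
      forall u, u != t -> slot s' u = slot s u
    & forall u, u != t -> pos s' u = pos s u].
Proof.
move=> ds t0 tk gG gd gp.
rewrite {}/s' /pass exec_block; cbv [foldl].
have d1 : dims (exec pass_load s) by exact: dims_frame.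
have [] := pass_loadE t0 (erefl p).
have S1 u : slot (exec pass_load s) u = slot s u by rewrite /slot !cframe.
have P1 u : pos (exec pass_load s) u = pos s u by rewrite /pos !iframe.
move: (exec pass_load s) d1 S1 P1 => s1 d1 S1 P1 p1 r1 G1 t1.
have gr : good n p (rr s1) by rewrite r1; apply: good_diag.
have gG1 : Ggood s1 by rewrite /Ggood G1.
have [] := turnsE d1 p1 gG1 gr.
have S2 u : slot (exec turns s1) u = slot s1 u by rewrite /slot !cframe.
have P2 u : pos (exec turns s1) u = pos s1 u by rewrite /pos !iframe.
have t2 : imem (exec turns s1) 4 0 = t by rewrite iframe.
move: (exec turns s1) t2 S2 P2 => s2 t2 S2 P2 p2 r2 T G2 K2.
have [] := store_slotE t2.
have G3 : GG (exec store_slot s2) = GG s2.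
  by do 2!apply: functional_extensionality => ?; rewrite /GG !cframe.
move: (exec store_slot s2) G3 => s3 G3 r3 S3 P3 p3.
split.
- by split; rewrite ?p3 ?P3 ?S3 ?eqxx //; rewrite /Ggood G3.
- by move=> f; rewrite (diag_rot _ gp gd) -r1 -G1 T S3 eqxx G3.
- by move=> i q ik qp; rewrite G3 K2 // G1.
- by move=> u ut; rewrite S3 (negPf ut) S2 S1.
by move=> u ut; rewrite P3 (negPf ut) P2 P1.
Qed.
End Chase.

(** * Chasing a batch of rotations *)

Section Rounds.
Variables (C : numClosedFieldType) (n k : nat).
Implicit Types (s : state C) (g : C * C) (f : nat -> C) (S Q R : seq (nat * (C * C))).

(* S is the list of rotations to the left of the chains, and Q the queue of
   rotations still to be chased, to the right of D. *)
Definition wop s S Q f := act S (lam n k (GG s) (diag (dd s) (act Q f))).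

(** One product [R] describes a stretch of the program: W, X, Y and Q all change by it, and W also
    on the right by its inverse. The coordinates below [lo] are untouched, which preserves zeros
    obtained earlier. *)
Record conj_by lo s S Q s' S' Q' R : Prop := ConjBy {
  conj_above : above lo R;
  conj_goods : goods n R;
  conj_wop : forall f, wop s' S' Q' (act R f) = act R (wop s S Q f);
  conj_X : forall j, (j < k)%N -> col s' 4 j = act R (col s 4 j);
  conj_Y : forall j, (j < k)%N -> col s' 5 j = act R (col s 5 j);
  conj_q : forall f, actq (qout s') f = act R (actq (qout s) f);
  conj_ok : all (okq n) (qout s) -> all (okq n) (qout s') }.

Lemma conj_refl lo s S Q : conj_by lo s S Q s S Q [::].
Proof. by split. Qed.

Lemma conj_trans lo s1 S1 Q1 s2 S2 Q2 s3 S3 Q3 R1 R2 :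
  conj_by lo s1 S1 Q1 s2 S2 Q2 R1 -> conj_by lo s2 S2 Q2 s3 S3 Q3 R2 ->
  conj_by lo s1 S1 Q1 s3 S3 Q3 (R2 ++ R1).
Proof.
move=> [a1 g1 w1 x1 y1 q1 o1] [a2 g2 w2 x2 y2 q2 o2]; split.
- by rewrite /above all_cat; apply/andP.
- exact: goods_cat.
- by move=> f; rewrite !act_cat w2 w1.
- by move=> j jk; rewrite act_cat x2 // x1.
- by move=> j jk; rewrite act_cat y2 // y1.
- by move=> f; rewrite act_cat q2 q1.
- by move=> /o1 /o2.
Qed.

Lemma conj_le lo lo' s S Q s' S' Q' R : (lo' <= lo)%N ->
  conj_by lo s S Q s' S' Q' R -> conj_by lo' s S Q s' S' Q' R.
Proof.
move=> ll [a ? ? ? ? ? ?]; split=> //.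
by apply: sub_all a => x; apply: leq_trans.
Qed.

Lemma conj_iset lo s a i m S Q s' S' Q' R :
  conj_by lo (iset s a i m) S Q s' S' Q' R -> conj_by lo s S Q s' S' Q' R.
Proof. by case. Qed.

(** The head is the factor next to D, hence the next one to pass. *)
Definition queue s (ts : seq nat) := [seq (pos s u, slot s u) | u <- ts].

Definition Sgood s := forall u, (u < k)%N -> good n (pos s u) (slot s u).
Definition core s := [/\ dims n k s, Ggood n k s, dgood n s & Sgood s].

Definition roundstep : prog := block [:: pass; invrot; apply_rot].

(** The head of the queue comes out to the left of the chains, commutes with [S], and is conjugated
    to the right end. The queue is thus shifted cyclically and the order of its factors is kept. *)
Lemma roundstepE lo t ts s S (s' := exec roundstep s) :
    core s -> imem s 4 0 = t -> (t < k)%N -> t \notin ts ->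
    below lo S -> (lo <= pos s t + k)%N ->
  [/\ exists R, conj_by lo s S (queue s (t :: ts)) s' S (queue s' (rcons ts t)) R,
      core s',
      forall u, pos s' u = if u == t then (pos s t + k)%N else pos s u,
      forall i q, (i < k)%N -> (q < pos s t + (k.-1 - i))%N -> GG s' i q = GG s i q
    & dd s' = dd s].
Proof.
move=> [ds gG gd gS] t0 tk tts bS lop; rewrite {}/s' /roundstep exec_block; cbv [foldl].
have [] := passE ds t0 tk gG gd (gS t tk).
have d1 : dims n k (exec pass s) by exact: dims_frame.
have D1 : dd (exec pass s) = dd s by rewrite /dd /col !cframe.
have X1 : cmem (exec pass s) 4 = cmem s 4 by exact: cframe.
have Y1 : cmem (exec pass s) 5 = cmem s 5 by exact: cframe.
have q1 : qout (exec pass s) = qout s by exact: qframe.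
move: (exec pass s) d1 D1 X1 Y1 q1 => s1 d1 D1 X1 Y1 q1 [p1 P1 r1 g1 G1] W1 K1 S1 P1'.
have r2 := invrotE s1.
have d2 : dims n k (exec invrot s1) by exact: dims_frame.
have p2 : imem (exec invrot s1) 8 0 = (pos s t + k)%N by rewrite iframe.
have D2 : dd (exec invrot s1) = dd s1 by rewrite /dd /col !cframe.
have X2 : cmem (exec invrot s1) 4 = cmem s1 4 by exact: cframe.
have Y2 : cmem (exec invrot s1) 5 = cmem s1 5 by exact: cframe.
have q2 : qout (exec invrot s1) = qout s1 by exact: qframe.
have G2 : GG (exec invrot s1) = GG s1.
  by do 2!apply: functional_extensionality => ?; rewrite /GG !cframe.
have S2 : slot (exec invrot s1) = slot s1.
  by apply: functional_extensionality => ?; rewrite /slot !cframe.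
have P2 : pos (exec invrot s1) = pos s1.
  by apply: functional_extensionality => ?; rewrite /pos !iframe.
move: (exec invrot s1) r2 d2 p2 D2 X2 Y2 q2 G2 S2 P2.
move=> s2 r2 d2 p2 D2 X2 Y2 q2 G2 S2 P2.
have gr : good n (pos s t + k) (rr s2) by rewrite r2 r1; apply: good_inv.
have [] := apply_rotE d2 p2 gr.
have d3 : dims n k (exec apply_rot s2) by exact: dims_frame.
have D3 : dd (exec apply_rot s2) = dd s2 by rewrite /dd /col !cframe.
have G3 : GG (exec apply_rot s2) = GG s2.
  by do 2!apply: functional_extensionality => ?; rewrite /GG !cframe.
have S3 : slot (exec apply_rot s2) = slot s2.
  by apply: functional_extensionality => ?; rewrite /slot !cframe.
have P3 : pos (exec apply_rot s2) = pos s2.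
  by apply: functional_extensionality => ?; rewrite /pos !iframe.
move: (exec apply_rot s2) d3 D3 G3 S3 P3 => s3 d3 D3 G3 S3 P3 X Y qE qok r3.
have Ppos u : pos s3 u = if u == t then (pos s t + k)%N else pos s u.
  by rewrite P3 P2; case: eqP => [->//|/eqP ut]; rewrite P1'.
have Qts f : act (queue s3 ts) f = act (queue s ts) f.
  congr act; apply/eq_in_map => u uts.
  have ut : u != t by apply: contraNneq tts => <-.
  by rewrite Ppos (negPf ut) S3 S2 S1.
split=> //.
- exists [:: ((pos s t + k)%N, rr s2)]; split.
  + by rewrite /above /= lop.
  + by move=> x; rewrite inE => /eqP ->.
  + move=> f; rewrite /wop /queue -cats1 map_cat -!/(queue _ _) act_cat Qts /=.
    rewrite Ppos eqxx S3 S2 r2 r1 rotKV; last by case: g1.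
    rewrite W1 act_comm; last first.
      by apply: sub_all bS => x; move/leq_trans; apply.
    by rewrite rotK ?G3 ?G2 ?D3 ?D2 ?D1 //; case: g1.
  + by move=> j jk; rewrite X // /col X2 X1.
  + by move=> j jk; rewrite Y // /col Y2 Y1.
  + by move=> f; rewrite qE q2 q1.
  + by rewrite -q1 -q2.
- split=> //; rewrite /Ggood ?G3 ?G2 //.
    by rewrite /dgood D3 D2 D1.
  move=> u uk; rewrite Ppos S3 S2; case: (eqVneq u t) => [->//|ut].
  by rewrite S1 //; apply: gS.
- by move=> i q ik qp; rewrite G3 G2 K1.
by rewrite D3 D2 D1.
Qed.

Lemma roundE lo b s S (s' := exec round s) :
    core s -> below lo S -> (forall u, (u < k)%N -> lo <= pos s u + k)%N ->
    (forall u, (u < k)%N -> b <= pos s u)%N ->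
  [/\ exists R, conj_by lo s S (queue s (iota 0 k)) s' S (queue s' (iota 0 k)) R,
      core s',
      forall u, (u < k)%N -> pos s' u = (pos s u + k)%N,
      forall i q, (i < k)%N -> (q < b + (k.-1 - i))%N -> GG s' i q = GG s i q
    & dd s' = dd s].
Proof.
move=> cs bS lop bp.
(* The queue is shifted by [t]; after k steps it is in its original order. *)
pose I t s1 := (t <= k)%N ->
  [/\ exists R, conj_by lo s S (queue s (iota 0 k)) s1 S
        (queue s1 (iota t (k - t) ++ iota 0 t)) R,
      core s1,
      forall u, (u < k)%N -> pos s1 u = if (u < t)%N then (pos s u + k)%N else pos s u,
      forall i q, (i < k)%N -> (q < b + (k.-1 - i))%N -> GG s1 i q = GG s i q
    & dd s1 = dd s].
suff: I k s'.
  move=> /(_ (leqnn k)) []; rewrite subnn /= => E c P G D; split=> //.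
  by move=> u uk; rewrite P // uk.
have e1 : ieval s (var 1) = k by case: cs => -[].
rewrite -[X in I X]e1; apply: for_inv => [|t s1 tk It tk1].
  by split=> //; exists [::]; rewrite subn0 cats0; apply: conj_refl.
rewrite e1 in tk; have {It} [[R1 E1] c1 P1 G1 D1] := It (ltnW tk).
set s2 := iset s1 4 0 t.
have P12 : pos s2 = pos s1 by [].
have G12 : GG s2 = GG s1 by [].
have q2 ts : queue s2 ts = queue s1 ts by [].
have tts : t \notin iota t.+1 (k - t.+1) ++ iota 0 t.
  by rewrite mem_cat !mem_iota; lia.
have lo2 : (lo <= pos s2 t + k)%N by rewrite P12 P1 // ltnn lop.
have c2 : core s2 by [].
have [[R2 E2] c3 P3 G3 D3] := roundstepE c2 (erefl t) tk tts bS lo2.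
split=> //.
- exists (R2 ++ R1); apply: conj_trans E1 (conj_iset (a := 4) (i := 0) (m := t) _); move: E2.
  have -> : (k - t)%N = (k - t.+1).+1 by lia.
  have -> : iota 0 t.+1 = iota 0 t ++ [:: t] by rewrite -addn1 iotaD.
  by rewrite -cats1 -catA.
- move=> u uk; rewrite P3 P12 !P1 // ltnn.
  case: (eqVneq u t) => [->|ut]; first by rewrite ltnSn.
  by have -> : (u < t.+1)%N = (u < t)%N by lia.
- move=> i q ik qb; rewrite G3 // ?G12 ?G1 //.
  by rewrite P12 P1 // ltnn; have := bp t tk; lia.
by rewrite D3.
Qed.

Lemma queue_dead s ts f :
  (forall u, u \in ts -> good n (pos s u) (slot s u) /\ (n <= pos s u)%N) ->
  act (queue s ts) f = f.
Proof.
elim: ts => //= u ts IH E; rewrite IH => [|v vts]; last by apply: E; rewrite inE vts orbT.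
have [[_ e] np] := E u (mem_head _ _).
by rewrite e ?rot_id //; lia.
Qed.

Lemma roundsE lo b s S (s' := exec rounds s) :
    core s -> (0 < k)%N -> below lo S -> (forall u, (u < k)%N -> lo <= pos s u + k)%N ->
    (forall u, (u < k)%N -> b <= pos s u)%N ->
  [/\ exists R, conj_by lo s S (queue s (iota 0 k)) s' S [::] R,
      core s',
      forall u, (u < k)%N -> (n <= pos s' u)%N,
      forall i q, (i < k)%N -> (q < b + (k.-1 - i))%N -> GG s' i q = GG s i q
    & dd s' = dd s].
Proof.
move=> cs k0 bS lop bp.
pose I r s1 :=
  [/\ exists R, conj_by lo s S (queue s (iota 0 k)) s1 S (queue s1 (iota 0 k)) R,
      core s1,
      forall u, (u < k)%N -> pos s1 u = (pos s u + r * k)%N,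
      forall i q, (i < k)%N -> (q < b + (k.-1 - i))%N -> GG s1 i q = GG s i q
    & dd s1 = dd s].
have e1 : ieval s (IAdd (IDiv (var 0) (var 1)) (ICst 1)) = (n %/ k + 1)%N.
  by case: cs => -[/= -> ->].
suff: I (n %/ k + 1)%N s'.
  have nk : (n <= (n %/ k + 1) * k)%N by rewrite addn1 ltnW // ltn_ceil.
  case=> [[R [a g w x y q o]] c P G D].
  have P' u : (u < k)%N -> (n <= pos s' u)%N by move=> uk; rewrite P //; lia.
  split=> //; exists R; split=> // f; rewrite -w /wop queue_dead // => u.
  rewrite mem_iota => uk; split; last exact: P'.
  by case: c => _ _ _; apply.
rewrite -e1; apply: for_inv => [|r s1 _ [[R1 E1] c1 P1 G1 D1]].
  by split=> // [|u uk]; [exists [::]; apply: conj_refl | rewrite mul0n addn0].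
set s2 := iset s1 5 0 r.
have P12 : pos s2 = pos s1 by [].
have G12 : GG s2 = GG s1 by [].
have c2 : core s2 by [].
have [u uk|u uk|[R2 E2] c3 P3 G3 D3] := @roundE lo b s2 S c2 bS.
- by rewrite P12 P1 //; have := lop u uk; lia.
- by rewrite P12 P1 //; have := bp u uk; lia.
split=> //.
- by exists (R2 ++ R1); apply: conj_trans E1 (conj_iset E2).
- by move=> u uk; rewrite P3 // P12 P1 // mulSn; lia.
- by move=> i q ik qb; rewrite G3 // G12 G1.
by rewrite D3.
Qed.
End Rounds.

(** * Reduction of U to upper triangular form *)

Definition ins_load : prog := block
  [:: ISet 8 (ICst 0) (IAdd (ISub (ISub (var 0) (ICst 1)) (var 3)) (var 4));
      CSet (Reg 2) (CCopy (Ref 4 (var 8) (var 4)));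
      CSet (Reg 3) (CCopy (Ref 4 (IAdd (var 8) (ICst 1)) (var 4)))].
(** A later rotation is multiplied further to the left and acts one coordinate lower; chain
    [k - 1 - t] therefore takes the rotation for column [t]. *)
Definition ins_store : prog := block
  [:: ISet 10 (ICst 0) (ISub (ISub (var 1) (ICst 1)) (var 4));
      CSet (Ref 6 (var 10) (var 8)) (CCopy (Reg 0));
      CSet (Ref 7 (var 10) (var 8)) (CCopy (Reg 1))].
Definition ins : prog := block [:: ins_load; mkrot; apply_rot; ins_store; invrot; store_slot].
Definition insert : prog := block [:: For 4 (var 1) ins; rounds].
Definition phase1 : prog := For 3 (var 0) insert.

Section Phase1.
Variables (C : numClosedFieldType) (n k : nat).
Implicit Types (s : state C) (g : C * C) (f : nat -> C) (S Q R : seq (nat * (C * C))).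

Lemma GG_frame p s : ~~ cwrites 6 p -> ~~ cwrites 7 p -> GG (exec p s) = GG s.
Proof.
by move=> w6 w7; do 2!apply: functional_extensionality => ?; rewrite /GG !cframe.
Qed.

Lemma slot_frame p s : ~~ cwrites 8 p -> ~~ cwrites 9 p -> slot (exec p s) = slot s.
Proof.
by move=> w8 w9; apply: functional_extensionality => ?; rewrite /slot !cframe.
Qed.

Lemma pos_frame p s : ~~ iwrites 9 p -> pos (exec p s) = pos s.
Proof. by move=> w; apply: functional_extensionality => ?; rewrite /pos iframe. Qed.

Lemma dd_frame p s : ~~ cwrites 3 p -> dd (exec p s) = dd s.
Proof. by move=> w; rewrite /dd /col cframe. Qed.

Lemma insE c t s (p := (c + t)%N) (s' := exec ins s) :
    dims n k s -> imem s 3 0 = (n.-1 - c)%N -> (c < n)%N -> imem s 4 0 = t ->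
    (t < k)%N -> supp n (col s 4 t) ->
  exists g, [/\ [/\ good n p g, rot p g (col s 4 t) p.+1 = 0, dims n k s' & dd s' = dd s],
      [/\ forall j, (j < k)%N -> col s' 4 j = rot p g (col s 4 j),
      forall j, (j < k)%N -> col s' 5 j = rot p g (col s 5 j),
      forall f, actq (qout s') f = rot p g (actq (qout s) f)
      & all (okq n) (qout s) -> all (okq n) (qout s')],
      forall i q, GG s' i q = if (i == k.-1 - t)%N && (q == p) then g else GG s i q,
      forall u, slot s' u = if u == t then ginv g else slot s u
    & forall u, pos s' u = if u == t then p else pos s u].
Proof.
move=> ds v0 cn t0 tk sX; rewrite {}/s' /ins exec_block; cbv [foldl].
have [p1 a1 b1] : [/\ imem (exec ins_load s) 8 0 = p,
    reg (exec ins_load s) 2 = col s 4 t p & reg (exec ins_load s) 3 = col s 4 t p.+1].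
  have e : (n - 1 - (n.-1 - c) + t)%N = p by rewrite /p; lia.
  by rewrite /reg /col /= (proj1 ds) v0 t0 e addn1.
have t1 : imem (exec ins_load s) 4 0 = t by rewrite iframe.
have d1 : dims n k (exec ins_load s) by exact: dims_frame.
have D1 : dd (exec ins_load s) = dd s by exact: dd_frame.
have X1 : cmem (exec ins_load s) 4 = cmem s 4 by exact: cframe.
have Y1 : cmem (exec ins_load s) 5 = cmem s 5 by exact: cframe.
have q1 : qout (exec ins_load s) = qout s by exact: qframe.
have G1 : GG (exec ins_load s) = GG s by exact: GG_frame.
have S1 : slot (exec ins_load s) = slot s by exact: slot_frame.
have P1 : pos (exec ins_load s) = pos s by exact: pos_frame.
move: (exec ins_load s) p1 a1 b1 t1 d1 D1 X1 Y1 q1 G1 S1 P1.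
move=> s1 p1 a1 b1 t1 d1 D1 X1 Y1 q1 G1 S1 P1.
pose g := mkrotf (col s 4 t p) (col s 4 t p.+1).
have r2 : rr (exec mkrot s1) = g by rewrite mkrotE a1 b1.
have t2 : imem (exec mkrot s1) 4 0 = t by rewrite iframe.
have p2 : imem (exec mkrot s1) 8 0 = p by rewrite iframe.
have d2 : dims n k (exec mkrot s1) by exact: dims_frame.
have D2 : dd (exec mkrot s1) = dd s by rewrite dd_frame.
have X2 : cmem (exec mkrot s1) 4 = cmem s 4 by rewrite cframe.
have Y2 : cmem (exec mkrot s1) 5 = cmem s 5 by rewrite cframe.
have q2 : qout (exec mkrot s1) = qout s by rewrite qframe.
have G2 : GG (exec mkrot s1) = GG s by rewrite GG_frame.
have S2 : slot (exec mkrot s1) = slot s by rewrite slot_frame.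
have P2 : pos (exec mkrot s1) = pos s by rewrite pos_frame.
move: (exec mkrot s1) r2 t2 p2 d2 D2 X2 Y2 q2 G2 S2 P2.
move=> {p1 a1 b1 t1 d1 D1 X1 Y1 q1 G1 S1 P1} s2 r2 t2 p2 d2 D2 X2 Y2 q2 G2 S2 P2.
have gg : good n p g by apply: good_mkrot => np; apply: sX.
have gr : good n p (rr s2) by rewrite r2.
have [] := apply_rotE d2 p2 gr.
have t3 : imem (exec apply_rot s2) 4 0 = t by rewrite iframe.
have p3 : imem (exec apply_rot s2) 8 0 = p by rewrite iframe.
have d3 : dims n k (exec apply_rot s2) by exact: dims_frame.
have D3 : dd (exec apply_rot s2) = dd s by rewrite dd_frame.
have G3 : GG (exec apply_rot s2) = GG s by rewrite GG_frame.
have S3 : slot (exec apply_rot s2) = slot s by rewrite slot_frame.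
have P3 : pos (exec apply_rot s2) = pos s by rewrite pos_frame.
move: (exec apply_rot s2) t3 p3 d3 D3 G3 S3 P3 => s3 t3 p3 d3 D3 G3 S3 P3 X3 Y3 q3 o3 r3.
have G4 i q : GG (exec ins_store s3) i q =
    if (i == k.-1 - t)%N && (q == p) then g else GG s i q.
  rewrite -G3 -r2 -r3 /GG /rr /reg /= t3 p3 (proj2 d3) subn1.
  by case: ifP.
have r4 : rr (exec ins_store s3) = g by rewrite /rr !reg_frame // -r2 -r3.
have t4 : imem (exec ins_store s3) 4 0 = t by rewrite iframe.
have p4 : imem (exec ins_store s3) 8 0 = p by rewrite iframe.
have d4 : dims n k (exec ins_store s3) by exact: dims_frame.
have D4 : dd (exec ins_store s3) = dd s by rewrite dd_frame.
have X4 : cmem (exec ins_store s3) 4 = cmem s3 4 by rewrite cframe.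
have Y4 : cmem (exec ins_store s3) 5 = cmem s3 5 by rewrite cframe.
have q4 : qout (exec ins_store s3) = qout s3 by rewrite qframe.
have S4 : slot (exec ins_store s3) = slot s by rewrite slot_frame.
have P4 : pos (exec ins_store s3) = pos s by rewrite pos_frame.
move: (exec ins_store s3) r4 t4 p4 d4 D4 X4 Y4 q4 G4 S4 P4.
move=> s4 r4 t4 p4 d4 D4 X4 Y4 q4 G4 S4 P4.
have r5 : rr (exec invrot s4) = ginv g by rewrite invrotE r4.
have t5 : imem (exec invrot s4) 4 0 = t by rewrite iframe.
have p5 : imem (exec invrot s4) 8 0 = p by rewrite iframe.
have [_] := store_slotE t5.
have d6 : dims n k (exec store_slot (exec invrot s4)) by apply: dims_frame => //; apply: dims_frame.
have D6 : dd (exec store_slot (exec invrot s4)) = dd s by rewrite !dd_frame.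
have X6 : cmem (exec store_slot (exec invrot s4)) 4 = cmem s3 4 by rewrite !cframe.
have Y6 : cmem (exec store_slot (exec invrot s4)) 5 = cmem s3 5 by rewrite !cframe.
have q6 : qout (exec store_slot (exec invrot s4)) = qout s3 by rewrite !qframe.
have G6 : GG (exec store_slot (exec invrot s4)) = GG s4 by rewrite !GG_frame.
have S5 : slot (exec invrot s4) = slot s by rewrite slot_frame.
have P5 : pos (exec invrot s4) = pos s by rewrite pos_frame.
move: (exec store_slot _) d6 D6 X6 Y6 q6 G6 => s6 d6 D6 X6 Y6 q6 G6 S6 P6 p6.
exists g; split; first split=> //.
- have [_ e _] := mkrotfP (col s 4 t p) (col s 4 t p.+1).
  by rewrite /rot eqxx; have -> : (p.+1 == p) = false by lia.
- split.
  + by move=> j jk; rewrite /col X6 -/(col _ _ _) X3 // r2 /col X2.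
  + by move=> j jk; rewrite /col Y6 -/(col _ _ _) Y3 // r2 /col Y2.
  + by move=> f; rewrite q6 q3 r2 q2.
  + by rewrite q6 -q2.
- by move=> i q; rewrite G6 G4.
- by move=> u; rewrite S6 r5 S5.
by move=> u; rewrite P6 p5 P5.
Qed.

Lemma conj_supp lo s S Q s' S' Q' R a j : conj_by n k lo s S Q s' S' Q' R ->
  (j < k)%N -> (a <= lo)%N -> supp a (col s 4 j) -> supp a (col s' 4 j).
Proof.
move=> E jk al sa; rewrite (conj_X E jk) (act_fix (conj_above E)) //.
exact: supp_le sa.
Qed.

Lemma conj_suppn lo s S Q s' S' Q' R j : conj_by n k lo s S Q s' S' Q' R ->
  (j < k)%N -> supp n (col s 4 j) -> supp n (col s' 4 j).
Proof. by move=> E jk sa; rewrite (conj_X E jk); apply: supp_goods (conj_goods E) sa. Qed.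

Lemma conj_single lo s S Q s' S' Q' p g :
    (lo <= p)%N -> good n p g ->
    (forall f, wop n k s' S' Q' (rot p g f) = rot p g (wop n k s S Q f)) ->
    (forall j, (j < k)%N -> col s' 4 j = rot p g (col s 4 j)) ->
    (forall j, (j < k)%N -> col s' 5 j = rot p g (col s 5 j)) ->
    (forall f, actq (qout s') f = rot p g (actq (qout s) f)) ->
    (all (okq n) (qout s) -> all (okq n) (qout s')) ->
  conj_by n k lo s S Q s' S' Q' [:: (p, g)].
Proof.
move=> lp gp W X Y q o; split=> //; first by rewrite /above /= lp.
by move=> x; rewrite inE => /eqP ->.
Qed.

(* Chain i starts at position b + k - 1 - i. *)
Definition stair b s := forall i q, (i < k)%N -> (q < b + (k.-1 - i))%N -> GG s i q = gid C.

(** The rotation at [c + t] clears entry [c + t + 1] of column [t] of X. The columns before [t]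
    vanish from [c + t] on and are not affected; the later ones already reach past [c + t + 1]. *)
Lemma insertE c s (s' := exec insert s) :
    dims n k s -> Ggood n k s -> dgood n s -> imem s 3 0 = (n.-1 - c)%N -> (c < n)%N ->
    (0 < k)%N -> stair c.+1 s ->
    (forall j, (j < k)%N -> supp n (col s 4 j) /\ supp (c + j).+2 (col s 4 j)) ->
  [/\ exists R, conj_by n k 0 s [::] [::] s' [::] [::] R,
      core n k s', stair c s' /\ dd s' = dd s,
      (forall j, (j < k)%N -> supp n (col s' 4 j) /\ supp (c + j).+1 (col s' 4 j))
    & forall u, (u < k)%N -> (n <= pos s' u)%N].
Proof.
move=> ds gG gd v0 cn k0 st sX; rewrite {}/s' /insert exec_block; cbv [foldl].
(* The booleans count as 0 or 1: a column not treated yet reaches one row further, and a chain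
   without its new head starts one position later. *)
pose I t s1 := (t <= k)%N ->
  [/\ exists R, conj_by n k 0 s [::] [::] s1 [::] (queue s1 (iota 0 t)) R,
      [/\ dims n k s1, Ggood n k s1, dd s1 = dd s & imem s1 3 0 = (n.-1 - c)%N],
      forall i q, (i < k)%N -> (q < c + (k.-1 - i) + (i < k - t))%N -> GG s1 i q = gid C,
      forall j, (j < k)%N -> supp n (col s1 4 j) /\ supp (c + j + (t <= j)).+1 (col s1 4 j)
    & forall u, (u < t)%N -> pos s1 u = (c + u)%N /\ good n (pos s1 u) (slot s1 u)].
have: I k (exec (For 4 (var 1) ins) s).
  have e1 : ieval s (var 1) = k by case: ds.
  rewrite -[X in I X]e1; apply: for_inv => [|t s1 tk It tk1].
    split=> //; first by exists [::]; apply: conj_refl.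
      by move=> i q ik; rewrite subn0 ik => qc; apply: st => //; lia.
    by move=> j jk; have [a b] := sX j jk; rewrite leq0n addn1.
  rewrite e1 in tk; have {It} [[R1 E1] [d1 g1 D1 v1] B1 X1 P1] := It (ltnW tk).
  set s2 := iset s1 4 0 t.
  have d2 : dims n k s2 by [].
  have v2 : imem s2 3 0 = (n.-1 - c)%N by [].
  have G2 : GG s2 = GG s1 by [].
  have q2 ts : queue s2 ts = queue s1 ts by [].
  have c2 j : col s2 4 j = col s1 4 j by [].
  have p2 : pos s2 = pos s1 by [].
  have l2 : slot s2 = slot s1 by [].
  have s2n : supp n (col s2 4 t) by case: (X1 t tk).
  have [g []] := insE d2 v2 cn (erefl t) tk s2n.
  have v3 : imem (exec ins s2) 3 0 = (n.-1 - c)%N by rewrite iframe.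
  move: (exec ins s2) v3 => s3 v3 [gg zg d3 D3] [X3 Y3 q3 o3] G3 S3 P3.
  have D32 : dd s3 = dd s1 by rewrite D3.
  have Qt : queue s3 (iota 0 t.+1) = queue s1 (iota 0 t) ++ [:: ((c + t)%N, ginv g)].
    rewrite -addn1 iotaD /queue map_cat /= P3 S3 eqxx; congr (_ ++ _).
    apply/eq_in_map => u; rewrite mem_iota => ut.
    by have /negPf tu : u != t by [lia]; rewrite P3 S3 tu.
  have gG3 : Ggood n k s3.
    move=> i q ik qn; rewrite G3; case: ifP => [/andP[_ /eqP ->] //|_].
    by rewrite G2; apply: g1.
  have E3 : conj_by n k 0 s2 [::] (queue s1 (iota 0 t)) s3 [::]
      (queue s3 (iota 0 t.+1)) [:: ((c + t)%N, g)].
    apply: conj_single => // f; rewrite /wop Qt act_cat /= rotK; last by case: gg.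
    rewrite D32; apply: (@lam_insert _ _ _ _ _ (k.-1 - t)%N) => //.
    - lia.
    - by move=> i q it qc; rewrite G2 B1 //; lia.
    - by move=> q qc; rewrite G2 B1 //; lia.
    - by rewrite G3 !eqxx.
    by move=> i q iq; rewrite G3; move: iq; rewrite -negb_and => /negPf ->.
  split=> //.
  - by exists ([:: ((c + t)%N, g)] ++ R1); apply: conj_trans E1 (conj_iset E3).
  - by split=> //; rewrite D32.
  - move=> i q ik qc; rewrite G3; case: ifP => [/andP[/eqP i0 /eqP q0]|_]; first lia.
    by rewrite G2; apply: B1 => //; lia.
  - move=> j jk; have [a b] := X1 j jk; rewrite X3 // c2.
    split; first exact: supp_good gg a.
    case: (ltngtP t j) => tj.
    + move: b; rewrite (ltnW tj) => b; rewrite addn1 in b *.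
      by apply: supp_rot => //; lia.
    + move: b; have -> : (t <= j)%N = false by lia.
      by rewrite !addn0 => b; rewrite (rot_fix (b := (c + j).+1)) //; lia.
    move: zg b; rewrite c2 -tj leqnn addn0 addn1 => zg b r.
    rewrite leq_eqVlt => /predU1P[<- //|cr]; apply: supp_rot b _ cr; lia.
  - move=> u ut; rewrite P3 S3; case: (eqVneq u t) => [->|ne].
      by split=> //; apply: good_inv.
    by rewrite p2 l2; apply: P1; lia.
move=> /(_ (leqnn k)) [].
move: (exec (For _ _ _) s) => s1 [R1 E1] [d1 g1 D1 v1] B1 X1 P1.
have c1 : core n k s1.
  by split=> //; [rewrite /dgood D1 | move=> u uk; case: (P1 u uk)].
(* The chased rotations come out at [c + k] or later, where all columns of X vanish by now, and they
   start at [c] or later, so they meet no chain before its head. *)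
have [|u uk|u uk|[R2 E2] c2 P2 G2 D2] := @roundsE _ n k (c + k) c s1 [::] c1 k0.
- by [].
- by have [-> _] := P1 u uk; lia.
- by have [-> _] := P1 u uk; lia.
split=> //.
- exists (R2 ++ R1); apply: conj_trans E1 _; apply: conj_le E2; lia.
- split; last by rewrite D2.
  by move=> i q ik qc; rewrite G2 // B1 //; lia.
move=> j jk; have [a b] := X1 j jk.
split; first exact: conj_suppn E2 jk a.
have al : ((c + j).+1 <= c + k)%N by lia.
apply: (conj_supp E2 jk al).
move: b; rewrite leqNgt jk addn0 //.
Qed.

Lemma phase1E s (s' := exec phase1 s) :
    dims n k s -> Ggood n k s -> dgood n s -> (0 < k)%N -> (0 < n)%N ->
    (forall i q, (i < k)%N -> (q < n + k)%N -> GG s i q = gid C) ->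
    (forall j, (j < k)%N -> supp n (col s 4 j)) ->
  [/\ exists R, conj_by n k 0 s [::] [::] s' [::] [::] R,
      core n k s', dd s' = dd s,
      (forall j, (j < k)%N -> supp n (col s' 4 j) /\ supp j.+1 (col s' 4 j))
    & forall u, (u < k)%N -> (n <= pos s' u)%N].
Proof.
move=> ds gG gd k0 n0 G0 X0.
(* At the start the slots contain zeros, which are not rotations, so [core] is only claimed after
   the first batch. The shape of X asks nothing at [v = 0], since X has n rows. *)
pose I v s1 := (v <= n)%N ->
  [/\ exists R, conj_by n k 0 s [::] [::] s1 [::] [::] R,
      [/\ dims n k s1, Ggood n k s1 & dd s1 = dd s], stair (n - v) s1,
      (forall j, (j < k)%N -> supp n (col s1 4 j) /\ supp (n - v + j).+1 (col s1 4 j))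
    & (0 < v)%N -> core n k s1 /\ forall u, (u < k)%N -> (n <= pos s1 u)%N].
suff: I n s'.
  by move=> /(_ (leqnn n)) []; rewrite subnn => E [d g D] _ X /(_ n0) [c P]; split.
have e1 : ieval s (var 0) = n by case: ds.
rewrite -[X in I X]e1; apply: for_inv => [|v s1 vn Iv vn1].
  split=> //; first by exists [::]; apply: conj_refl.
    by move=> i q ik qb; apply: G0 => //; lia.
  move=> j jk; split; first exact: X0.
  by apply: supp_le (X0 j jk); lia.
rewrite e1 in vn; have {Iv} [[R1 E1] [d1 g1 D1] B1 X1 _] := Iv (ltnW vn).
set s2 := iset s1 3 0 v.
have d2 : dims n k s2 by [].
have gd2 : dgood n s2 by rewrite /dgood -[dd s2]/(dd s1) D1.
have cn : (n - v.+1 < n)%N by lia.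
have v2 : imem s2 3 0 = (n.-1 - (n - v.+1))%N by rewrite /s2 /=; lia.
have st2 : stair (n - v.+1).+1 s2.
  by move=> i q ik qb; rewrite -[GG s2]/(GG s1) B1 //; lia.
have [|[R2 E2] c3 [B3 D3] X3 P3] := insertE d2 g1 gd2 v2 cn k0 st2.
  move=> j jk; have [a b] := X1 j jk; split=> //.
  by apply: supp_le b; lia.
split=> //.
- by exists (R2 ++ R1); apply: conj_trans E1 (conj_iset E2).
- by case: c3 => *; split=> //; rewrite D3.
Qed.
End Phase1.

(** * Columns of the current matrix *)

Definition Wref (e : iexp) : ref := Ref 12 e (ICst 0).

Definition column_init : prog := block
  [:: For 7 (var 0) (CSet (Wref (var 7)) (CNat 0));
      CSet (Wref (var 3)) (CCopy (Ref 3 (var 3) (ICst 0)))].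

Definition column_G : prog := block
  [:: ISet 10 (ICst 0) (ISub (ISub (var 1) (ICst 1)) (var 5));
      ISet 8 (ICst 0) (ISub (ISub (var 0) (ICst 1)) (var 6));
      CSet (Reg 0) (CCopy (Ref 6 (var 10) (var 8)));
      CSet (Reg 1) (CCopy (Ref 7 (var 10) (var 8)));
      rotarr 12 (ICst 1)].
Definition column_lam : prog := For 5 (var 1) (For 6 (var 0) column_G).

Definition column_S1 : prog := block
  [:: ISet 8 (ICst 0) (IGet 11 (var 5));
      CSet (Reg 0) (CCopy (Ref 10 (var 5) (ICst 0)));
      CSet (Reg 1) (CCopy (Ref 11 (var 5) (ICst 0)));
      rotarr 12 (ICst 1)].
(** All n k places of S are applied, however many are occupied; the free ones hold the identity. *)
Definition column_S : prog := For 5 (IMul (var 0) (var 1)) column_S1.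

Definition column_XY1 : prog := block
  [:: CSet (Reg 2) (CConj (Ref 5 (var 3) (var 6)));
      CSet (Reg 2) (CMul (Ref 4 (var 5) (var 6)) (Reg 2));
      CSet (Wref (var 5)) (CAdd (Wref (var 5)) (Reg 2))].
Definition column_XY : prog := For 5 (var 0) (For 6 (var 1) column_XY1).

Definition column : prog := block [:: column_init; column_lam; column_S; column_XY].

Section Column.
Variables (C : numClosedFieldType) (n k : nat).
Implicit Types (s : state C) (g : C * C) (f : nat -> C) (S Q R : seq (nat * (C * C))).

Definition delta (c : nat) : nat -> C := fun r => (r == c)%:R.

Definition sentry s m := (imem s 11 m, (cmem s 10 m 0, cmem s 11 m 0)).
(** Reversed, because the oldest rotation is the innermost factor. *)
Definition slist s := rev [seq sentry s m | m <- iota 0 (n * k)].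

(* The matrix H of the current state. *)
Definition hop s S Q f := fun r =>
  wop n k s S Q f r + \sum_(j < k) col s 4 j r * ip n (col s 5 j) f.

Lemma column_initE c s (s' := exec column_init s) :
  dims n k s -> imem s 3 0 = c -> (c < n)%N -> supp n (col s 12 0) ->
  col s' 12 0 = diag (dd s) (delta c).
Proof.
move=> ds c0 cn sw; rewrite {}/s' /column_init exec_block; cbv [foldl].
pose I m t := [/\ imem t 3 0 = c, cmem t 3 = cmem s 3 &
  forall r, col t 12 0 r = if (r < m)%N then 0 else col s 12 0 r].
have : I n (exec (For 7 (var 0) (CSet (Wref (var 7)) (CNat 0))) s).
  have e1 : ieval s (var 0) = n by case: ds.
  rewrite -[X in I X]e1; apply: for_inv => [|m t mn [c1 d1 w1]]; first by split.
  split=> // r; rewrite /col /= andbT; case: eqP => [->|rm]; first by rewrite ltnSn.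
  by rewrite -/(col _ _ _ _) w1; have -> : (r < m.+1)%N = (r < m)%N by lia.
move: (exec (For _ _ _) s) => t [c1 d1 w1].
apply: functional_extensionality => r.
rewrite /col /= c1 andbT -/(col _ _ _ _) /diag /delta /dd /col d1.
case: eqP => [->|rc]; first by rewrite mulr1.
by rewrite mulr0 -/(col t 12 0 r) w1; case: ltnP => // nr; apply: sw.
Qed.

Lemma column_lamE s (s' := exec column_lam s) : dims n k s ->
  col s' 12 0 = lam n k (GG s) (col s 12 0).
Proof.
move=> ds; have e1 : ieval s (var 1) = k by case: ds.
pose I m t := (m <= k)%N -> [/\ dims n k t, GG t = GG s &
  col t 12 0 = lamr n (GG s) (k - m) m (col s 12 0)].
suff: I k s' by move=> /(_ (leqnn k)) []; rewrite subnn.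
rewrite -[X in I X]e1; apply: for_inv => [|m t mk It mk1]; first by split.
rewrite e1 in mk; have {It} [d1 G1 w1] := It (ltnW mk).
set t1 := iset t 5 0 m.
have d2 : dims n k t1 by [].
have e2 : ieval t1 (var 0) = n by case: d2.
pose i := (k.-1 - m)%N.
pose J l t2 := (l <= n)%N -> [/\ dims n k t2, imem t2 5 0 = m, GG t2 = GG s &
  col t2 12 0 = chain (GG s i) (n - l) l (col t 12 0)].
suff: J n (exec (For 6 (var 0) column_G) t1).
  move=> /(_ (leqnn n)) [d3 _ G3 w3]; split=> //; rewrite w3 subnn w1.
  have -> : (k - m = i.+1)%N by rewrite /i; lia.
  by have -> : (k - m.+1 = i)%N by rewrite /i; lia.
rewrite -[X in J X]e2; apply: for_inv => [|l t2 ln Jt ln1]; first by split.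
rewrite e2 in ln; have {Jt} [d3 m3 G3 w3] := Jt (ltnW ln).
rewrite /column_G exec_block; cbv [foldl].
set t3 := iset t2 6 0 l; set p := (n.-1 - l)%N.
set t4 := exec (CSet (Reg 1) _) _.
have p4 : imem t4 8 0 = p by rewrite /t4 /= (proj1 d3) subn1.
have r4 : rr t4 = GG s i p.
  by rewrite -G3 /rr /reg /t4 /t3 /= (proj1 d3) (proj2 d3) m3 !subn1.
have d4 : dims n k t4 by [].
have m4 : imem t4 5 0 = m by [].
have G4 : GG t4 = GG s by [].
have w4 : col t4 12 0 = col t2 12 0 by [].
have [X _ _] := rotarrE (a := 12) (ICst 1) (s := t4) isT p4.
have d5 : dims n k (exec (rotarr 12 (ICst 1)) t4) by exact: dims_frame.
have m5 : imem (exec (rotarr 12 (ICst 1)) t4) 5 0 = m by rewrite iframe.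
have G5 : GG (exec (rotarr 12 (ICst 1)) t4) = GG s by rewrite GG_frame.
split=> //; rewrite X // r4 w4 w3.
have -> : (n - l.+1 = p)%N by rewrite /p; lia.
by have -> : (n - l = p.+1)%N by rewrite /p; lia.
Qed.

Lemma column_SE s (s' := exec column_S s) : dims n k s ->
  col s' 12 0 = act (slist s) (col s 12 0).
Proof.
move=> [n0 k0]; have e1 : ieval s (IMul (var 0) (var 1)) = (n * k)%N by rewrite /= n0 k0.
pose I m t := [/\ forall m', sentry t m' = sentry s m' &
  col t 12 0 = act (rev [seq sentry s m' | m' <- iota 0 m]) (col s 12 0)].
suff: I (n * k)%N s' by case.
rewrite -e1; apply: for_inv => [|m t mk [E w1]]; first by split.
rewrite /column_S1 exec_block; cbv [foldl].
set t4 := exec (CSet (Reg 1) _) _.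
have p4 : imem t4 8 0 = (sentry s m).1 by rewrite -E.
have r4 : rr t4 = (sentry s m).2 by rewrite -E.
have E4 m' : sentry t4 m' = sentry s m' by exact: E.
have w4 : col t4 12 0 = col t 12 0 by [].
have [X _ _] := rotarrE (a := 12) (ICst 1) (s := t4) isT p4.
have E5 m' : sentry (exec (rotarr 12 (ICst 1)) t4) m' = sentry s m'.
  by rewrite -E4 /sentry !cframe // iframe.
split=> //; have -> : iota 0 m.+1 = iota 0 m ++ [:: m] by rewrite -addn1 iotaD.
by rewrite X // r4 w4 w1 map_cat rev_cat.
Qed.

Lemma column_XYE c s (s' := exec column_XY s) : dims n k s -> imem s 3 0 = c ->
  (forall j, (j < k)%N -> supp n (col s 4 j)) ->
  col s' 12 0 = fun r => col s 12 0 r + \sum_(j < k) col s 4 j r * (col s 5 j c)^*.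
Proof.
move=> ds c0 sX; have e1 : ieval s (var 0) = n by case: ds.
pose F r := col s 12 0 r + \sum_(j < k) col s 4 j r * (col s 5 j c)^*.
pose I m t := [/\ dims n k t /\ imem t 3 0 = c, cmem t 4 = cmem s 4, cmem t 5 = cmem s 5 &
  forall r, col t 12 0 r = if (r < m)%N then F r else col s 12 0 r].
suff: I n s'.
  case=> _ _ _ w1; apply: functional_extensionality => r; rewrite w1.
  case: ltnP => // nr; rewrite big1 ?addr0 // => j _.
  by rewrite (sX j (ltn_ord j)) ?mul0r.
rewrite -e1; apply: for_inv => [|m t mn [[d1 c1] X1 Y1 w1]]; first by split.
set t1 := iset t 5 0 m.
have e2 : ieval t1 (var 1) = k by case: d1.
pose J l t2 := [/\ dims n k t2 /\ imem t2 3 0 = c, imem t2 5 0 = m,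
  cmem t2 4 = cmem s 4, cmem t2 5 = cmem s 5 &
  forall r, col t2 12 0 r = if r == m then
     col s 12 0 r + \sum_(j < l) col s 4 j r * (col s 5 j c)^* else col t 12 0 r].
suff: J k (exec (For 6 (var 1) column_XY1) t1).
  case=> d2 m2 X2 Y2 w2; split=> // r; rewrite w2 w1.
  case: eqP => [->|rm]; first by rewrite ltnSn.
  by have -> : (r < m.+1)%N = (r < m)%N by lia.
rewrite -[X in J X]e2; apply: for_inv => [|l t2 ln [[d2 c2] m2 X2 Y2 w2]].
  split=> // r; rewrite big_ord0 addr0; case: eqP => [->|_] //.
  by rewrite [LHS]w1 ltnn.
split=> // r; rewrite /col /= c2 m2 X2 Y2 andbT -/(col _ _ _ _).
case: eqP => [->|rm]; first by rewrite big_ord_recr /= addrA; congr (_ + _); rewrite -[LHS]/(col t2 12 0 m) w2 eqxx.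
by rewrite -[LHS]/(col t2 12 0 r) w2; case: eqP.
Qed.

Lemma ip_delta f c : (c < n)%N -> ip n f (delta c) = (f c)^*.
Proof.
move=> cn; rewrite /ip (bigD1 (Ordinal cn)) //= /delta eqxx mulr1 big1 ?addr0 // => r rc.
by have /negPf -> : (r : nat) != c; [apply: contraNneq rc => rc; apply/eqP/val_inj | rewrite mulr0].
Qed.

Lemma columnE c s (s' := exec column s) : dims n k s -> imem s 3 0 = c -> (c < n)%N ->
  supp n (col s 12 0) -> (forall j, (j < k)%N -> supp n (col s 4 j)) ->
  col s' 12 0 = hop s (slist s) [::] (delta c).
Proof.
move=> ds c0 cn sw sX; rewrite {}/s' /column exec_block; cbv [foldl].
have w1 := column_initE ds c0 cn sw.
have d1 : dims n k (exec column_init s) by exact: dims_frame.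
have c1 : imem (exec column_init s) 3 0 = c by rewrite iframe.
have G1 : GG (exec column_init s) = GG s by rewrite GG_frame.
have E1 m : sentry (exec column_init s) m = sentry s m by rewrite /sentry !cframe ?iframe.
have X1 j : col (exec column_init s) 4 j = col s 4 j by rewrite /col cframe.
have Y1 j : col (exec column_init s) 5 j = col s 5 j by rewrite /col cframe.
move: (exec column_init s) w1 d1 c1 G1 E1 X1 Y1 => s1 w1 d1 c1 G1 E1 X1 Y1.
have w2 := column_lamE d1.
have d2 : dims n k (exec column_lam s1) by exact: dims_frame.
have c2 : imem (exec column_lam s1) 3 0 = c by rewrite iframe.
have E2 m : sentry (exec column_lam s1) m = sentry s m.
  by rewrite -E1 /sentry !cframe ?iframe.
have X2 j : col (exec column_lam s1) 4 j = col s 4 j by rewrite -X1 /col cframe.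
have Y2 j : col (exec column_lam s1) 5 j = col s 5 j by rewrite -Y1 /col cframe.
move: (exec column_lam s1) w2 d2 c2 E2 X2 Y2 => s2 w2 d2 c2 E2 X2 Y2.
have w3 := column_SE d2.
have d3 : dims n k (exec column_S s2) by exact: dims_frame.
have c3 : imem (exec column_S s2) 3 0 = c by rewrite iframe.
have X3 j : col (exec column_S s2) 4 j = col s 4 j by rewrite -X2 /col cframe.
have Y3 j : col (exec column_S s2) 5 j = col s 5 j by rewrite -Y2 /col cframe.
move: (exec column_S s2) w3 d3 c3 X3 Y3 => s3 w3 d3 c3 X3 Y3.
rewrite (column_XYE d3 c3); last by move=> j jk; rewrite X3; apply: sX.
apply: functional_extensionality => r; rewrite /hop /wop w3 w2 w1 G1.
have -> : slist s2 = slist s by congr rev; apply: eq_map => m; apply: E2.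
congr (_ + _); apply: eq_bigr => j _.
by rewrite X3 Y3 ip_delta.
Qed.
End Column.

(** * Reduction to Hessenberg form *)

(** The elimination goes upwards: step [t] clears row [c + k - t], from [c + k] to [c + 2]. *)
Definition elim_load : prog := block
  [:: ISet 8 (ICst 0) (ISub (ISub (IAdd (var 3) (var 1)) (ICst 1)) (var 4));
      CSet (Reg 2) (CCopy (Wref (var 8)));
      CSet (Reg 3) (CCopy (Wref (IAdd (var 8) (ICst 1))))].
(** Each column owns k consecutive places of S, of which it fills k - 1. *)
Definition elim_store : prog :=
  let m := IAdd (IMul (var 3) (var 1)) (var 4) in block
  [:: CSet (Ref 10 m (ICst 0)) (CCopy (Reg 0)); CSet (Ref 11 m (ICst 0)) (CCopy (Reg 1));
      ISet 11 m (var 8)].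
Definition elim : prog := block
  [:: elim_load; mkrot; rotarr 12 (ICst 1); apply_rot; elim_store; invrot; store_slot].
Definition eliminate : prog := For 4 (ISub (var 1) (ICst 1)) elim.
Definition phase2 : prog := For 3 (var 0) (block [:: column; eliminate; rounds]).

Section Phase2.
Variables (C : numClosedFieldType) (n k : nat).
Implicit Types (s : state C) (g : C * C) (f : nat -> C) (S Q R : seq (nat * (C * C))).

Lemma sentry_frame p s : ~~ iwrites 11 p -> ~~ cwrites 10 p -> ~~ cwrites 11 p ->
  sentry (exec p s) = sentry s.
Proof.
by move=> i c d; apply: functional_extensionality => m; rewrite /sentry !cframe // iframe.
Qed.

Lemma elimE c t s (p := (c + k.-1 - t)%N) (s' := exec elim s) :
    dims n k s -> imem s 3 0 = c -> imem s 4 0 = t -> (t < k)%N ->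
    supp n (col s 12 0) ->
  exists g, [/\ [/\ good n p g, dims n k s' /\ GG s' = GG s, dd s' = dd s,
        col s' 12 0 = rot p g (col s 12 0) & col s' 12 0 p.+1 = 0],
      [/\ forall j, (j < k)%N -> col s' 4 j = rot p g (col s 4 j),
      forall j, (j < k)%N -> col s' 5 j = rot p g (col s 5 j),
      forall f, actq (qout s') f = rot p g (actq (qout s) f)
      & all (okq n) (qout s) -> all (okq n) (qout s')],
      forall m, sentry s' m = if m == (c * k + t)%N then (p, g) else sentry s m,
      forall u, slot s' u = if u == t then ginv g else slot s u
    & forall u, pos s' u = if u == t then p else pos s u].
Proof.
move=> ds c0 t0 tk sX; rewrite {}/s' /elim exec_block; cbv [foldl].
have [p1 a1 b1] : [/\ imem (exec elim_load s) 8 0 = p,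
    reg (exec elim_load s) 2 = col s 12 0 p & reg (exec elim_load s) 3 = col s 12 0 p.+1].
  have e : (c + k - 1 - t)%N = p by rewrite /p; lia.
  by rewrite /reg /col /= (proj2 ds) c0 t0 e addn1.
have t1 : imem (exec elim_load s) 4 0 = t by rewrite iframe.
have c1 : imem (exec elim_load s) 3 0 = c by rewrite iframe.
have d1 : dims n k (exec elim_load s) by exact: dims_frame.
have D1 : dd (exec elim_load s) = dd s by exact: dd_frame.
have X1 : cmem (exec elim_load s) 4 = cmem s 4 by exact: cframe.
have Y1 : cmem (exec elim_load s) 5 = cmem s 5 by exact: cframe.
have w1 : cmem (exec elim_load s) 12 = cmem s 12 by exact: cframe.
have q1 : qout (exec elim_load s) = qout s by exact: qframe.
have G1 : GG (exec elim_load s) = GG s by exact: GG_frame.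
have S1 : slot (exec elim_load s) = slot s by exact: slot_frame.
have P1 : pos (exec elim_load s) = pos s by exact: pos_frame.
have E1 : sentry (exec elim_load s) = sentry s by exact: sentry_frame.
move: (exec elim_load s) p1 a1 b1 t1 c1 d1 D1 X1 Y1 w1 q1 G1 S1 P1 E1.
move=> s1 p1 a1 b1 t1 c1 d1 D1 X1 Y1 w1 q1 G1 S1 P1 E1.
pose g := mkrotf (col s 12 0 p) (col s 12 0 p.+1).
have r2 : rr (exec mkrot s1) = g by rewrite mkrotE a1 b1.
have t2 : imem (exec mkrot s1) 4 0 = t by rewrite iframe.
have c2 : imem (exec mkrot s1) 3 0 = c by rewrite iframe.
have p2 : imem (exec mkrot s1) 8 0 = p by rewrite iframe.
have d2 : dims n k (exec mkrot s1) by exact: dims_frame.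
have D2 : dd (exec mkrot s1) = dd s by rewrite dd_frame.
have X2 : cmem (exec mkrot s1) 4 = cmem s 4 by rewrite cframe.
have Y2 : cmem (exec mkrot s1) 5 = cmem s 5 by rewrite cframe.
have w2 : cmem (exec mkrot s1) 12 = cmem s 12 by rewrite cframe.
have q2 : qout (exec mkrot s1) = qout s by rewrite qframe.
have G2 : GG (exec mkrot s1) = GG s by rewrite GG_frame.
have S2 : slot (exec mkrot s1) = slot s by rewrite slot_frame.
have P2 : pos (exec mkrot s1) = pos s by rewrite pos_frame.
have E2 : sentry (exec mkrot s1) = sentry s by rewrite sentry_frame.
move: (exec mkrot s1) r2 t2 c2 p2 d2 D2 X2 Y2 w2 q2 G2 S2 P2 E2.
move=> {p1 a1 b1 t1 c1 d1 D1 X1 Y1 w1 q1 G1 S1 P1 E1}.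
move=> s2 r2 t2 c2 p2 d2 D2 X2 Y2 w2 q2 G2 S2 P2 E2.
have gg : good n p g by apply: good_mkrot => np; apply: sX.
have [W3 _ r3] := rotarrE (a := 12) (ICst 1) (s := s2) isT p2.
have {W3} W3 := W3 0%N isT.
have t3 : imem (exec (rotarr 12 (ICst 1)) s2) 4 0 = t by rewrite iframe.
have c3 : imem (exec (rotarr 12 (ICst 1)) s2) 3 0 = c by rewrite iframe.
have p3 : imem (exec (rotarr 12 (ICst 1)) s2) 8 0 = p by rewrite iframe.
have d3 : dims n k (exec (rotarr 12 (ICst 1)) s2) by exact: dims_frame.
have D3 : dd (exec (rotarr 12 (ICst 1)) s2) = dd s by rewrite dd_frame.
have X3 : cmem (exec (rotarr 12 (ICst 1)) s2) 4 = cmem s 4 by rewrite cframe.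
have Y3 : cmem (exec (rotarr 12 (ICst 1)) s2) 5 = cmem s 5 by rewrite cframe.
have q3 : qout (exec (rotarr 12 (ICst 1)) s2) = qout s by rewrite qframe.
have G3 : GG (exec (rotarr 12 (ICst 1)) s2) = GG s by rewrite GG_frame.
have S3 : slot (exec (rotarr 12 (ICst 1)) s2) = slot s by rewrite slot_frame.
have P3 : pos (exec (rotarr 12 (ICst 1)) s2) = pos s by rewrite pos_frame.
have E3 : sentry (exec (rotarr 12 (ICst 1)) s2) = sentry s by rewrite sentry_frame.
move: (exec (rotarr 12 (ICst 1)) s2) W3 r3 t3 c3 p3 d3 D3 X3 Y3 q3 G3 S3 P3 E3.
move=> s3 W3 r3 t3 c3 p3 d3 D3 X3 Y3 q3 G3 S3 P3 E3.
rewrite r2 in r3 W3.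
have gr : good n p (rr s3) by rewrite r3.
have [] := apply_rotE d3 p3 gr.
have t4 : imem (exec apply_rot s3) 4 0 = t by rewrite iframe.
have c4 : imem (exec apply_rot s3) 3 0 = c by rewrite iframe.
have p4 : imem (exec apply_rot s3) 8 0 = p by rewrite iframe.
have d4 : dims n k (exec apply_rot s3) by exact: dims_frame.
have D4 : dd (exec apply_rot s3) = dd s by rewrite dd_frame.
have w4 : cmem (exec apply_rot s3) 12 = cmem s3 12 by rewrite cframe.
have G4 : GG (exec apply_rot s3) = GG s by rewrite GG_frame.
have S4 : slot (exec apply_rot s3) = slot s by rewrite slot_frame.
have P4 : pos (exec apply_rot s3) = pos s by rewrite pos_frame.
have E4 : sentry (exec apply_rot s3) = sentry s by rewrite sentry_frame.
move: (exec apply_rot s3) t4 c4 p4 d4 D4 w4 G4 S4 P4 E4.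
move=> s4 t4 c4 p4 d4 D4 w4 G4 S4 P4 E4 X4 Y4 q4 o4 r4.
have E5 m : sentry (exec elim_store s4) m =
    if m == (c * k + t)%N then (p, g) else sentry s m.
  rewrite -E4 -r3 -r4 /sentry /rr /reg /= t4 p4 c4 (proj2 d4) !andbT.
  by case: ifP.
have r5 : rr (exec elim_store s4) = g by rewrite /rr !reg_frame // -r3 -r4.
have t5 : imem (exec elim_store s4) 4 0 = t by rewrite iframe.
have p5 : imem (exec elim_store s4) 8 0 = p by rewrite iframe.
have d5 : dims n k (exec elim_store s4) by exact: dims_frame.
have D5 : dd (exec elim_store s4) = dd s by rewrite dd_frame.
have X5 : cmem (exec elim_store s4) 4 = cmem s4 4 by rewrite cframe.
have Y5 : cmem (exec elim_store s4) 5 = cmem s4 5 by rewrite cframe.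
have w5 : cmem (exec elim_store s4) 12 = cmem s3 12 by rewrite cframe.
have q5 : qout (exec elim_store s4) = qout s4 by rewrite qframe.
have G5 : GG (exec elim_store s4) = GG s by rewrite GG_frame.
have S5 : slot (exec elim_store s4) = slot s by rewrite slot_frame.
have P5 : pos (exec elim_store s4) = pos s by rewrite pos_frame.
move: (exec elim_store s4) r5 t5 p5 d5 D5 X5 Y5 w5 q5 G5 S5 P5 E5.
move=> s5 r5 t5 p5 d5 D5 X5 Y5 w5 q5 G5 S5 P5 E5.
have r6 : rr (exec invrot s5) = ginv g by rewrite invrotE r5.
have t6 : imem (exec invrot s5) 4 0 = t by rewrite iframe.
have p6 : imem (exec invrot s5) 8 0 = p by rewrite iframe.
have S6 : slot (exec invrot s5) = slot s by rewrite slot_frame.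
have P6 : pos (exec invrot s5) = pos s by rewrite pos_frame.
have [_] := store_slotE t6.
have d7 : dims n k (exec store_slot (exec invrot s5)).
  by apply: dims_frame => //; apply: dims_frame.
have D7 : dd (exec store_slot (exec invrot s5)) = dd s by rewrite !dd_frame.
have X7 : cmem (exec store_slot (exec invrot s5)) 4 = cmem s4 4 by rewrite !cframe.
have Y7 : cmem (exec store_slot (exec invrot s5)) 5 = cmem s4 5 by rewrite !cframe.
have w7 : cmem (exec store_slot (exec invrot s5)) 12 = cmem s3 12 by rewrite !cframe.
have q7 : qout (exec store_slot (exec invrot s5)) = qout s4 by rewrite !qframe.
have G7 : GG (exec store_slot (exec invrot s5)) = GG s by rewrite !GG_frame.
have E7 : sentry (exec store_slot (exec invrot s5)) = sentry s5 by rewrite !sentry_frame.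
move: (exec store_slot _) d7 D7 X7 Y7 w7 q7 G7 E7.
move=> s7 d7 D7 X7 Y7 w7 q7 G7 E7 S7 P7 p7.
have W7 : col s7 12 0 = rot p g (col s 12 0) by rewrite /col w7 -/(col _ _ _) W3 /col w2.
exists g; split; first split=> //.
- rewrite W7; have [_ e _] := mkrotfP (col s 12 0 p) (col s 12 0 p.+1).
  by rewrite /rot eqxx; have -> : (p.+1 == p) = false by lia.
- split.
  + by move=> j jk; rewrite /col X7 -/(col _ _ _) X4 // r3 /col X3.
  + by move=> j jk; rewrite /col Y7 -/(col _ _ _) Y4 // r3 /col Y3.
  + by move=> f; rewrite q7 q4 r3 q3.
  + by rewrite q7 -q3.
- by move=> m; rewrite E7 E5.
- by move=> u; rewrite S7 r6 S6.
by move=> u; rewrite P7 p6 P6.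
Qed.

Lemma act_gid (l : seq (nat * (C * C))) f : (forall x, x \in l -> x.2 = gid C) -> act l f = f.
Proof.
elim: l => //= x l IH E; rewrite IH ?E ?rot_id ?mem_head // => y yl.
by apply: E; rewrite inE yl orbT.
Qed.

(** Later places are further to the left. Filling place [m0] therefore is a multiplication from the
    left only because all later places still hold the identity. *)
Lemma slist_set s s' m0 p g f : (m0 < n * k)%N ->
  (forall m, sentry s' m = if m == m0 then (p, g) else sentry s m) ->
  (forall m, (m0 <= m)%N -> (m < n * k)%N -> (sentry s m).2 = gid C) ->
  act (slist n k s') f = rot p g (act (slist n k s) f).
Proof.
move=> mk E I; rewrite /slist; have -> : (n * k)%N = (m0 + (1 + (n * k - m0.+1)))%N by lia.
have e1 s1 : [seq sentry s1 i | i <- iota (0 + m0) 1] = [:: sentry s1 m0] by [].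
rewrite !iotaD !map_cat !rev_cat !act_cat !e1 E eqxx !add0n.
have e2 x h : act (rev [:: x]) h = rot x.1 x.2 h by [].
rewrite !e2.
have gs m1 : (forall m, sentry m1 m = sentry s m \/ m = m0) ->
    forall h, act (rev [seq sentry m1 i | i <- iota (m0 + 1) (n * k - m0.+1)]) h = h.
  move=> e h; apply: act_gid => x; rewrite mem_rev => /mapP[m]; rewrite mem_iota => mm ->.
  by have [->|] := e m; [apply: I; lia | lia].
rewrite !gs; [|by left|by move=> m; rewrite E; case: eqP; [right|left]].
rewrite (I m0) // rot_id; congr (rot _ _ (act (rev _) _)).
by apply/eq_in_map => m; rewrite mem_iota E; case: eqP => //; lia.
Qed.

(** The low-rank part follows because [R] preserves inner products: R X (R Y)^H R = R X Y^H. *)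
Lemma hop_conj lo s S Q s' S' Q' R f : conj_by n k lo s S Q s' S' Q' R ->
  hop n k s' S' Q' (act R f) = act R (hop n k s S Q f).
Proof.
move=> E; rewrite /hop actD (conj_wop E).
rewrite (act_sum R k (fun j r => col s 4 j r * ip n (col s 5 j) f)).
apply: functional_extensionality => r; congr (_ + _); apply: eq_bigr => j _.
by rewrite actZ (conj_X E) // (conj_Y E) // ip_act //; exact: conj_goods E.
Qed.

Lemma supp_delta c : supp c.+1 (delta C c).
Proof. by move=> r cr; rewrite /delta; case: eqP => // rc; lia. Qed.

(** [R] fixes the unit vector of index [c] and also column [c] itself, whose entries end at [c + 1],
    before the first coordinate that [R] touches. *)
Lemma hop_persist lo s S s' S' R c : conj_by n k lo s S [::] s' S' [::] R ->
  (c.+1 < lo)%N -> supp c.+2 (hop n k s S [::] (delta C c)) ->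
  supp c.+2 (hop n k s' S' [::] (delta C c)).
Proof.
move=> E cl sH; have a := conj_above E.
have <- : act R (delta C c) = delta C c.
  by apply: act_fix a _; apply: supp_le (@supp_delta c); lia.
rewrite (hop_conj _ E) (act_fix a) //; exact: supp_le sH.
Qed.

(** [b] bounds the rows on which S acts, as needed for commuting with chased rotations, and [m0] is
    the first place that is certainly free. *)
Definition stored b m0 s := forall m, (m < n * k)%N ->
  [/\ good n (sentry s m).1 (sentry s m).2, ((sentry s m).1.+1 < b)%N
    & (m0 <= m)%N -> (sentry s m).2 = gid C].

Lemma stored_below b m0 s : stored b m0 s -> below b (slist n k s).
Proof.
move=> E; apply/allP => x; rewrite mem_rev => /mapP[m]; rewrite mem_iota => mm ->.
by case: (E m).
Qed.

Lemma stored_goods b m0 s : stored b m0 s -> goods n (slist n k s).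
Proof.
move=> E x; rewrite mem_rev => /mapP[m]; rewrite mem_iota => mm ->.
by case: (E m).
Qed.

Lemma eliminateE c s (s' := exec eliminate s) :
    core n k s -> (0 < k)%N -> imem s 3 0 = c -> (c < n)%N ->
    (forall u, (u < k)%N -> (n <= pos s u)%N) ->
    supp n (col s 12 0) -> supp (c + k).+1 (col s 12 0) ->
    (forall j, (j < k)%N -> supp n (col s 4 j) /\ supp (c + k) (col s 4 j)) ->
    stored (c + k).+1 (c * k) s ->
  [/\ exists2 R, conj_by n k c.+1 s (slist n k s) [::]
          s' (slist n k s') (queue s' (iota 0 k)) R
        & col s' 12 0 = act R (col s 12 0),
      core n k s' /\ (dd s' = dd s /\ forall u, (u < k)%N -> (c < pos s' u)%N),
      supp n (col s' 12 0) /\ supp c.+2 (col s' 12 0),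
      forall j, (j < k)%N -> supp n (col s' 4 j) /\ supp (c + k).+1 (col s' 4 j)
    & stored (c + k).+1 (c.+1 * k) s'].
Proof.
move=> [ds gG gd gS] k0 c0 cn posn wn wk sX sS.
(* Slots from [t] on still contain the finished rotations of the previous chase, at positions beyond
   n. *)
pose I t s1 := (t <= k.-1)%N ->
  [/\ exists2 R, conj_by n k c.+1 s (slist n k s) [::]
          s1 (slist n k s1) (queue s1 (iota 0 t)) R
        & col s1 12 0 = act R (col s 12 0),
      [/\ dims n k s1, GG s1 = GG s, dd s1 = dd s & imem s1 3 0 = c],
      supp n (col s1 12 0) /\ supp (c + k - t).+1 (col s1 12 0),
      (forall j, (j < k)%N -> supp n (col s1 4 j) /\ supp (c + k).+1 (col s1 4 j)) /\
      stored (c + k).+1 (c * k + t) s1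
    & forall u, good n (pos s1 u) (slot s1 u) \/ (k <= u)%N] /\
  forall u, (u < k)%N -> if (u < t)%N then pos s1 u = (c + k.-1 - u)%N else
     (n <= pos s1 u)%N.
have: I k.-1 s'.
  have e1 : ieval s (ISub (var 1) (ICst 1)) = k.-1 by case: ds => _ /= ->; rewrite subn1.
  rewrite -[X in I X]e1; apply: for_inv => [|t s1 tk It tk1].
    split=> //; split=> //.
    - by exists [::]; first exact: conj_refl.
    - by rewrite subn0.
    - rewrite addn0; split=> // j jk; have [a b] := sX j jk; split=> //.
      exact: supp_le b.
    by move=> u; case: (ltnP u k) => uk; [left; apply: gS | right].
  rewrite e1 in tk.
  have {It} [[[R1 E1 W1] [d1 G1 D1 c1] [w1 w1'] [X1 S1] L1] P1] := It (ltnW tk).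
  have {}tk1 : (t < k)%N by lia.
  have tm : (c * k + t < n * k)%N by nia.
  set s2 := iset s1 4 0 t.
  have d2 : dims n k s2 by [].
  have [g []] := elimE d2 c1 (erefl t) tk1 w1.
  have c3 : imem (exec elim s2) 3 0 = c by rewrite iframe.
  rewrite -[col s2]/(col s1) -[GG s2]/(GG s1) -[dd s2]/(dd s1) -[slot s2]/(slot s1).
  rewrite -[pos s2]/(pos s1) -[sentry s2]/(sentry s1) -[qout s2]/(qout s1).
  move: (exec elim s2) c3 => s3 c3 [gg [d3 G3] D3 W3 z3] [X3 Y3 q3 o3] E3 S3 P3.
  set p := (c + k.-1 - t)%N in gg W3 z3 X3 Y3 q3 E3 P3 *.
  have pc : (c < p)%N by rewrite /p; lia.
  have pk : (p < c + k)%N by rewrite /p; lia.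
  have Qt f : act (queue s3 (iota 0 t.+1)) f = act (queue s1 (iota 0 t)) (rot p (ginv g) f).
    rewrite /queue -addn1 iotaD map_cat act_cat /= P3 S3 eqxx; congr act.
    apply/eq_in_map => u; rewrite mem_iota => ut.
    by have /negPf tu : u != t by [lia]; rewrite P3 S3 tu.
  have E31 : conj_by n k c.+1 s1 (slist n k s1) (queue s1 (iota 0 t))
      s3 (slist n k s3) (queue s3 (iota 0 t.+1)) [:: (p, g)].
    apply: conj_single => // f; rewrite /wop Qt rotK; last by case: gg.
    rewrite D3 G3; apply: (slist_set _ tm E3) => m m1 m2.
    by case: (S1 m m2) => _ _; apply.
  split; last first.
    move=> u uk; rewrite P3; case: (eqVneq u t) => [->|ut]; first by rewrite ltnSn.
    by have := P1 u uk; have -> : (u < t.+1)%N = (u < t)%N by lia.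
  split=> //.
  - exists ([:: (p, g)] ++ R1); first exact: conj_trans E1 E31.
    by rewrite W3 W1.
  - by split=> //; rewrite ?G3 ?D3.
  - rewrite W3; split; first exact: supp_good gg w1.
    have e : (c + k - t.+1)%N = p by rewrite /p; lia.
    rewrite e -W3 => r; rewrite leq_eqVlt => /predU1P[<- //|pr].
    rewrite W3 rot_out; [|lia|lia]; apply: w1'; rewrite /p in pr; lia.
  - split=> [j jk|m mk].
      have [a b] := X1 j jk; rewrite X3 //; split; first exact: supp_good gg a.
      by apply: supp_rot => //; lia.
    rewrite E3; case: eqP => [->|mt] /=; first by split=> //; lia.
    have [a b e] := S1 m mk; split=> // tm'; apply: e; lia.
  move=> u; rewrite P3 S3; case: (eqVneq u t) => [_|ut]; last exact: L1.
  by left; apply: good_inv.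
move=> /(_ (leqnn _)) []; move: {I} s' => s' [[R E W] [d1 G1 D1 c1] [w1 w1'] [X1 S1] L1] P1.
have gS' u : (u < k)%N -> good n (pos s' u) (slot s' u).
  by move=> uk; case: (L1 u) => // ku; lia.
split=> //.
- exists R => //; case: E => a g W' X Y q o; split=> // f; rewrite -W' /wop.
  (* Only k - 1 rotations are new, but [rounds] treats k slots. The last slot is left over from the
     previous chase and is the identity, so it may be appended to the queue. *)
  have Ek : iota 0 k = iota 0 k.-1 ++ [:: k.-1].
    by have {1}-> : k = (k.-1 + 1)%N by [lia]; rewrite iotaD.
  rewrite /queue Ek map_cat act_cat /=.
  have := P1 k.-1 _; rewrite ltnn => /(_ _) P2.
  have {}P2 : (n <= pos s' k.-1)%N by apply: P2; lia.
  have -> : slot s' k.-1 = gid C.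
    by case: (gS' k.-1) => [|_ ->] //; lia.
  by rewrite rot_id.
- split; first by split=> //; [rewrite /Ggood G1 | rewrite /dgood D1].
  split=> // u uk; have := P1 u uk; case: ifP => uk' pu; lia.
- split=> //; apply: supp_le w1'; lia.
move=> m mk; have [a b e] := S1 m mk; split=> // mm; apply: e; nia.
Qed.

Lemma conj_same lo s s' S : GG s' = GG s -> dd s' = dd s -> cmem s' 4 = cmem s 4 ->
  cmem s' 5 = cmem s 5 -> qout s' = qout s -> conj_by n k lo s S [::] s' S [::] [::].
Proof. by move=> G D X Y q; split=> //=; rewrite /wop /col ?G ?D ?X ?Y ?q. Qed.

Lemma phase2E s (s' := exec phase2 s) :
    core n k s -> (0 < k)%N -> (forall u, (u < k)%N -> (n <= pos s u)%N) ->
    supp n (col s 12 0) ->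
    (forall j, (j < k)%N -> supp n (col s 4 j) /\ supp j.+1 (col s 4 j)) ->
    (forall m, (m < n * k)%N -> sentry s m = (0%N, gid C)) ->
  [/\ exists R, conj_by n k 0 s [::] [::] s' (slist n k s') [::] R,
      core n k s', dd s' = dd s, stored (n + k).+1 (n * k) s'
    & forall c, (c < n)%N -> supp c.+2 (hop n k s' (slist n k s') [::] (delta C c))].
Proof.
move=> cs k0 posn wn sX sS.
pose I c s1 := (c <= n)%N ->
  [/\ exists R, conj_by n k 0 s [::] [::] s1 (slist n k s1) [::] R,
      [/\ core n k s1, dd s1 = dd s & forall u, (u < k)%N -> (n <= pos s1 u)%N],
      supp n (col s1 12 0) /\
      (forall j, (j < k)%N -> supp n (col s1 4 j) /\ supp (c + k) (col s1 4 j)),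
      stored (c + k).+1 (c * k) s1
    & forall c', (c' < c)%N -> supp c'.+2 (hop n k s1 (slist n k s1) [::] (delta C c'))].
suff: I n s' by move=> /(_ (leqnn n)) [E [c D _] _ S H]; split.
have e1 : ieval s (var 0) = n by case: cs => -[].
have S0 : stored (0 + k).+1 (0 * k) s.
  by move=> m mk; rewrite sS //; split=> //; exact: good_id.
rewrite -[X in I X]e1; apply: for_inv => [|c s1 cn Ic cn1].
  split=> //.
  - exists [::]; split=> // f; rewrite /wop /= act_gid // => x.
    by rewrite mem_rev => /mapP[m]; rewrite mem_iota => mm ->; rewrite sS.
  split=> // j jk; have [a b] := sX j jk; split=> //; apply: supp_le b; lia.
rewrite e1 in cn; have {Ic} [[R1 E1] [c1 D1 P1] [w1 X1] S1 H1] := Ic (ltnW cn).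
rewrite exec_block; cbv [foldl].
set s2 := iset s1 3 0 c.
have c2 : core n k s2 by [].
have d2 : dims n k s2 by case: c2.
have w3 : col (exec column s2) 12 0 = hop n k s1 (slist n k s1) [::] (delta C c).
  by apply: (columnE d2) => // j jk; case: (X1 j jk).
have GG3 : GG (exec column s2) = GG s1 by rewrite GG_frame.
have D3 : dd (exec column s2) = dd s1 by rewrite dd_frame.
have X3 : cmem (exec column s2) 4 = cmem s1 4 by rewrite cframe.
have Y3 : cmem (exec column s2) 5 = cmem s1 5 by rewrite cframe.
have q3 : qout (exec column s2) = qout s1 by rewrite qframe.
have S3 : sentry (exec column s2) = sentry s1 by rewrite sentry_frame.
have L3 : slot (exec column s2) = slot s1 by rewrite slot_frame.
have P3 : pos (exec column s2) = pos s1 by rewrite pos_frame.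
have v3 : imem (exec column s2) 3 0 = c by rewrite iframe.
have d3 : dims n k (exec column s2) by exact: dims_frame.
move: (exec column s2) w3 GG3 D3 X3 Y3 q3 S3 L3 P3 v3 d3.
move=> s3 w3 GG3 D3 X3 Y3 q3 S3 L3 P3 v3 d3.
have c3 : core n k s3.
  by case: c1 => _ a b e; split=> //; rewrite /Ggood /dgood /Sgood ?GG3 ?D3 ?L3 ?P3.
have E3 : conj_by n k 0 s1 (slist n k s1) [::] s3 (slist n k s3) [::] [::].
  by have -> : slist n k s3 = slist n k s1; [rewrite /slist S3 | apply: conj_same].
have Xs j : (j < k)%N -> supp n (col s3 4 j) /\ supp (c + k) (col s3 4 j).
  by move=> jk; rewrite /col X3; apply: X1.
have St3 : stored (c + k).+1 (c * k) s3 by rewrite /stored S3.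
have gS1 := stored_goods S1; have bS1 := stored_below S1.
have hop3 f : hop n k s3 (slist n k s3) [::] f = hop n k s1 (slist n k s1) [::] f.
  exact: (hop_conj f E3).
have wn3 : supp n (col s3 12 0).
  rewrite w3 => r cr; rewrite /hop big1 ?addr0; last first.
    by move=> j _; case: (X1 j (ltn_ord j)) => ->; rewrite ?mul0r.
  apply: (supp_goods gS1) cr; apply: supp_lam_good => [|q nq]; first by case: c1.
  by rewrite /diag /= supp_delta ?mulr0 //; lia.
(* The unit vector ends at row c, the k chains extend it to row [c + k], S acts on rows up to
   [c + k], and X vanishes from row [c + k] on. *)
have wk3 : supp (c + k).+1 (col s3 12 0).
  rewrite w3 => r cr; rewrite /hop big1 ?addr0; last first.
    move=> j _; case: (X1 j (ltn_ord j)) => _ ->; [by rewrite mul0r | lia].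
  apply: (supp_act bS1) cr; rewrite -addSn; apply: supp_lam => q cq.
  by rewrite /diag /= supp_delta // mulr0.
have P3n u : (u < k)%N -> (n <= pos s3 u)%N by rewrite P3; exact: P1.
have [] := eliminateE c3 k0 v3 cn P3n wn3 wk3 Xs St3.
move: (exec eliminate s3) => s4 [R4 E4 W4] [c4 [D4 P4]] [w4 w4'] X4 St4.
(* The new rotations start at [c + 1] or later and come out k positions below, hence after every row
   of S, of X and of the current column. *)
have [u uk|//|[R5 E5] c5 P5 _ D5] :=
  @roundsE _ n k (c + k).+1 0 s4 (slist n k s4) c4 k0 (stored_below St4).
  by have := P4 u uk; lia.
have S5 : sentry (exec rounds s4) = sentry s4 by rewrite sentry_frame.
have w5 : col (exec rounds s4) 12 0 = col s4 12 0 by rewrite /col cframe.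
move: (exec rounds s4) E5 c5 P5 D5 S5 w5 => s5 E5 c5 P5 D5 S5 w5.
have Sl : slist n k s5 = slist n k s4 by rewrite /slist S5.
rewrite -Sl in E5.
have E45 : conj_by n k c.+1 s3 (slist n k s3) [::] s5 (slist n k s5) [::] (R5 ++ R4).
  apply: conj_trans E4 _; rewrite -Sl; apply: conj_le E5; lia.
split=> //.
- exists ((R5 ++ R4) ++ ([::] ++ R1)).
  by apply: conj_trans (conj_le _ E45); first exact: conj_trans E1 E3.
- by split=> //; rewrite D5 D4 D3.
- split; first by rewrite w5.
  move=> j jk; have [a b] := X4 j jk; rewrite addSn.
  split; [exact: conj_suppn E5 jk a | exact: conj_supp E5 jk (leqnn _) b].
- by move=> m mk; rewrite S5 addSn; have [a b e] := St4 m mk; split=> //; lia.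
move=> c'; rewrite ltnS leq_eqVlt => /predU1P[->|cc]; last first.
  by apply: (hop_persist E45); [lia | rewrite hop3; apply: H1].
(* All conjugations of this step act from coordinate [c + 1] on and fix the unit vector of index
   [c]. Hence the new column [c] is the image of the old one: the elimination gives it its zeros,
   and the chase acts on zeros only. *)
have <- : act (R5 ++ R4) (delta C c) = delta C c.
  by apply: act_fix (conj_above E45) _; exact: supp_delta.
rewrite (hop_conj _ E45) hop3 -w3 act_cat -W4 (act_fix (conj_above E5)) //.
by apply: supp_le w4'; lia.
Qed.
End Phase2.

(** * Setup and output of the representation *)

Definition copy_row : prog := block
  [:: CSet (Ref 4 (var 3) (var 7)) (CCopy (Ref 1 (var 3) (var 7)));
      CSet (Ref 5 (var 3) (var 7)) (CCopy (Ref 2 (var 3) (var 7)))].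
Definition setup_in : prog := For 3 (var 0) (block
  [:: CSet (Ref 3 (var 3) (ICst 0)) (CCopy (Ref 0 (var 3) (ICst 0)));
      For 7 (var 1) copy_row]).
(** Memory is zero at the start, so setting the cosines makes every entry an identity. Positions up
    to [n + k - 1] are covered because the staggered starts are counted from n before the first
    batch. *)
Definition setup_G : prog := For 3 (var 1) (For 7 (IAdd (var 0) (var 1))
  (CSet (Ref 6 (var 3) (var 7)) (CNat 1))).
Definition setup_S : prog := For 3 (IMul (var 0) (var 1))
  (CSet (Ref 10 (var 3) (ICst 0)) (CNat 1)).
Definition setup : prog := block
  [:: setup_in; setup_G; setup_S; ISet 2 (ICst 0) (var 1)].

Definition out_rep (r1 r2 : ref) : prog :=
  IfLe (IAdd (var 8) (ICst 2)) (var 0)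
    (OutRep (var 8) (IAdd (var 8) (ICst 1)) r1 r2) Skip.
Definition rep_lam1 : prog := block
  [:: ISet 10 (ICst 0) (ISub (ISub (var 1) (ICst 1)) (var 5));
      ISet 8 (ICst 0) (ISub (ISub (var 0) (ICst 1)) (var 6));
      out_rep (Ref 6 (var 10) (var 8)) (Ref 7 (var 10) (var 8))].
(** The rightmost factor is output first, in the order in which [compose_mx] applies the
    rotations. *)
Definition rep_lam : prog := For 5 (var 1) (For 6 (var 0) rep_lam1).
Definition rep_S1 : prog := block
  [:: ISet 8 (ICst 0) (IGet 11 (var 5));
      out_rep (Ref 10 (var 5) (ICst 0)) (Ref 11 (var 5) (ICst 0))].
Definition rep_S : prog := For 5 (IMul (var 0) (var 1)) rep_S1.

Definition hess : prog := block [:: setup; phase1; phase2; rep_lam; rep_S].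

Section Ends.
Variables (C : numClosedFieldType) (n k : nat).
Implicit Types (s : state C) (g : C * C) (f : nat -> C) (S Q R : seq (nat * (C * C))).

Lemma setup_inE s (s' := exec setup_in s) : dims n k s ->
  (forall r, cmem s' 3 r 0 = if (r < n)%N then cmem s 0 r 0 else cmem s 3 r 0) /\
  (forall r j, (j < k)%N ->
    cmem s' 4 r j = (if (r < n)%N then cmem s 1 r j else cmem s 4 r j) /\
    cmem s' 5 r j = (if (r < n)%N then cmem s 2 r j else cmem s 5 r j)).
Proof.
move=> ds; have e1 : ieval s (var 0) = n by case: ds.
pose I m t := [/\ dims n k t, cmem t 0 = cmem s 0, cmem t 1 = cmem s 1 & cmem t 2 = cmem s 2] /\
  ((forall r, cmem t 3 r 0 = if (r < m)%N then cmem s 0 r 0 else cmem s 3 r 0) /\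
  (forall r j, (j < k)%N ->
    cmem t 4 r j = (if (r < m)%N then cmem s 1 r j else cmem s 4 r j) /\
    cmem t 5 r j = (if (r < m)%N then cmem s 2 r j else cmem s 5 r j))).
suff: I n s' by case.
rewrite -e1; apply: for_inv => [|m t mn [[d1 A1 B1 C1] [D1 E1]]]; first by split.
rewrite exec_block; cbv [foldl].
set t1 := exec (CSet _ _) _.
have d2 : dims n k t1 by [].
have e2 : ieval t1 (var 1) = k by case: d2.
have D2 r : cmem t1 3 r 0 = if (r < m.+1)%N then cmem s 0 r 0 else cmem s 3 r 0.
  rewrite /t1 /= andbT; case: eqP => [->|rm]; first by rewrite ltnSn A1.
  by rewrite D1; have -> : (r < m.+1)%N = (r < m)%N by lia.
pose J l (t2 : state C) := [/\ dims n k t2 /\ imem t2 3 0 = m, cmem t2 0 = cmem s 0,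
   cmem t2 1 = cmem s 1 /\ cmem t2 2 = cmem s 2,
   cmem t2 3 = cmem t1 3 &
   forall r j, (j < k)%N ->
    cmem t2 4 r j = (if (r == m) && (j < l)%N then cmem s 1 r j else cmem t 4 r j) /\
    cmem t2 5 r j = (if (r == m) && (j < l)%N then cmem s 2 r j else cmem t 5 r j)].
suff: J k (exec (For 7 (var 1) copy_row) t1).
  case=> [[d3 m3] A3 [B3 C3] D3 E3]; split=> //; split=> [r|r j jk]; first by rewrite D3.
  have [-> ->] := E3 r j jk; have [-> ->] := E1 r j jk.
  rewrite jk andbT; case: eqP => [->|rm]; first by rewrite ltnSn.
  by have -> : (r < m.+1)%N = (r < m)%N by lia.
rewrite -[X in J X]e2; apply: for_inv => [|l t2 lk [[d3 m3] A3 [B3 C3] D3 E3]].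
  by split=> // r j jk; rewrite andbF.
split=> // r j jk; rewrite /= m3 B3 C3; have [E4 E5] := E3 r j jk.
case: (eqVneq r m) => rm /=; last by rewrite E4 E5 (negPf rm).
case: (eqVneq j l) => jl /=; first by rewrite jl ltnSn rm.
rewrite E4 E5 rm eqxx /=; have -> : (j < l.+1)%N = (j < l)%N by lia.
by [].
Qed.

Lemma setup_GE s (s' := exec setup_G s) : dims n k s ->
  forall i q, (i < k)%N -> (q < n + k)%N -> cmem s' 6 i q = 1.
Proof.
move=> ds; have e1 : ieval s (var 1) = k by case: ds.
pose I m (t : state C) := dims n k t /\ forall i q, (i < m)%N -> (q < n + k)%N -> cmem t 6 i q = 1.
suff: I k s' by case.
rewrite -[X in I X]e1; apply: for_inv => [|m t mn [d1 G1]]; first by split.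
set t1 := iset t 3 0 m.
have e2 : ieval t1 (IAdd (var 0) (var 1)) = (n + k)%N by case: d1 => /= -> ->.
pose J l (t2 : state C) := [/\ dims n k t2, imem t2 3 0 = m &
  forall i q, ((i < m) && (q < n + k) || (i == m) && (q < l))%N -> cmem t2 6 i q = 1].
suff: J (n + k)%N (exec (For 7 (IAdd (var 0) (var 1)) (CSet (Ref 6 (var 3) (var 7)) (CNat 1))) t1).
  case=> d3 m3 G3; split=> // i q im qn; apply: G3; lia.
rewrite -e2; apply: for_inv => [|l t2 lk [d3 m3 G3]].
  by split=> // i q; rewrite andbF orbF => /andP[im qn]; apply: G1.
split=> // i q iq; rewrite /= m3; case: ifP => // H; apply: G3; lia.
Qed.

Lemma setup_SE s (s' := exec setup_S s) : dims n k s ->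
  forall m, (m < n * k)%N -> cmem s' 10 m 0 = 1.
Proof.
move=> [n0 k0]; have e1 : ieval s (IMul (var 0) (var 1)) = (n * k)%N by rewrite /= n0 k0.
pose I m (t : state C) := forall i, (i < m)%N -> cmem t 10 i 0 = 1.
suff: I (n * k)%N s' by [].
rewrite -e1; apply: for_inv => [|m t mn G1] //.
by move=> i im /=; case: ifP => // H; apply: G1; lia.
Qed.

Variables (D : 'M[C]_n) (U V : 'M[C]_(n, k)).

Lemma entry_out (m' k' : nat) (M : 'M[C]_(m', k')) r j : (m' <= r)%N -> entry M r j = 0.
Proof. by move=> nr; rewrite /entry insubF //; lia. Qed.

Lemma setupE (s := exec setup (init D U V)) :
  [/\ [/\ dims n k s, imem s 2 0 = k, qout s = [::] & hout s = [::]],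
      dd s = fun r => entry D r r,
      forall j, (j < k)%N -> col s 4 j = (fun r => entry U r j) /\
                             col s 5 j = (fun r => entry V r j),
      forall i q, (i < k)%N -> (q < n + k)%N -> GG s i q = gid C
    & (forall m, (m < n * k)%N -> sentry s m = (0%N, gid C)) /\ supp n (col s 12 0)].
Proof.
rewrite {}/s; set s0 := init D U V.
have d0 : dims n k s0 by [].
rewrite /setup exec_block; cbv [foldl].
have [D1 X1] := setup_inE d0.
have d1 : dims n k (exec setup_in s0) by exact: dims_frame.
have F7 : cmem (exec setup_in s0) 7 = cmem s0 7 by rewrite cframe.
have F11 : cmem (exec setup_in s0) 11 = cmem s0 11 by rewrite cframe.
have F12 : cmem (exec setup_in s0) 12 = cmem s0 12 by rewrite cframe.
have M11 : imem (exec setup_in s0) 11 = imem s0 11 by rewrite iframe.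
have q1 : qout (exec setup_in s0) = [::] by rewrite qframe.
have h1 : hout (exec setup_in s0) = [::] by rewrite hframe.
move: (exec setup_in s0) D1 X1 d1 F7 F11 F12 M11 q1 h1.
move=> s1 D1 X1 d1 F7 F11 F12 M11 q1 h1.
have G2 := setup_GE d1.
have d2 : dims n k (exec setup_G s1) by exact: dims_frame.
have F2 a : a != 6%N -> cmem (exec setup_G s1) a = cmem s1 a.
  by move=> /negPf a6; rewrite cframe //= a6.
have M2 : imem (exec setup_G s1) 11 = imem s0 11 by rewrite iframe.
have q2 : qout (exec setup_G s1) = [::] by rewrite qframe.
have h2 : hout (exec setup_G s1) = [::] by rewrite hframe.
move: (exec setup_G s1) G2 d2 F2 M2 q2 h2 => s2 G2 d2 F2 M2 q2 h2.
have S3 := setup_SE d2.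
have d3 : dims n k (exec setup_S s2) by exact: dims_frame.
have F3 a : a != 10%N -> cmem (exec setup_S s2) a = cmem s2 a.
  by move=> /negPf a6; rewrite cframe //= a6.
have M3 : imem (exec setup_S s2) 11 = imem s0 11 by rewrite iframe.
have q3 : qout (exec setup_S s2) = [::] by rewrite qframe.
have h3 : hout (exec setup_S s2) = [::] by rewrite hframe.
move: (exec setup_S s2) S3 d3 F3 M3 q3 h3 => s3 S3 d3 F3 M3 q3 h3.
split.
- by split=> //=; case: d3 => _ ->.
- apply: functional_extensionality => r; rewrite /dd /col /= F3 // F2 // D1 /=.
  by case: ltnP => // nr; rewrite entry_out.
- move=> j jk; split; apply: functional_extensionality => r; rewrite /col /= F3 // F2 //.
    by case: (X1 r j jk) => -> _ /=; case: ltnP => // nr; rewrite entry_out.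
  by case: (X1 r j jk) => _ -> /=; case: ltnP => // nr; rewrite entry_out.
- by move=> i q ik qn; rewrite /GG /= !F3 // G2 // F2 // F7.
split=> [m mk|r nr]; last by rewrite /col /= F3 // F2 // F12.
by rewrite /sentry /= S3 // F3 // F2 // F11 M3.
Qed.

Definition acth (hs : seq (givens C)) f := actq [seq Rotation e | e <- hs] f.
Definition okh (e : givens C) := okq n (Rotation e).

Lemma acth_rcons hs (e : givens C) f :
  acth (rcons hs e) f = rot (gi e) (gc e, gs e) (acth hs f).
Proof. by rewrite /acth map_rcons /actq foldl_rcons. Qed.

Lemma out_repE p r1 r2 s : dims n k s -> imem s 8 0 = p ->
  hout (exec (out_rep r1 r2) s) = if (p + 2 <= n)%N
    then rcons (hout s) (Givens p p.+1 (cget s r1) (cget s r2)) else hout s.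
Proof.
by move=> [n0 _] p0; rewrite /= n0 p0; case: ifP => _ //=; rewrite /get_givens /= p0 addn1.
Qed.

Lemma rep_lamE s (s' := exec rep_lam s) : dims n k s -> Ggood n k s ->
  all okh (hout s) ->
  [/\ forall f, acth (hout s') f = lam n k (GG s) (acth (hout s) f),
      all okh (hout s') & (size (hout s') <= size (hout s) + n * k)%N].
Proof.
move=> ds gG ok0; have e1 : ieval s (var 1) = k by case: ds.
pose I m t := (m <= k)%N -> [/\ dims n k t, GG t = GG s,
  forall f, acth (hout t) f = lamr n (GG s) (k - m) m (acth (hout s) f),
  all okh (hout t) & (size (hout t) <= size (hout s) + n * m)%N].
suff: I k s' by move=> /(_ (leqnn k)) []; rewrite subnn.
rewrite -[X in I X]e1; apply: for_inv => [|m t mk It mk1].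
  by split=> //; rewrite muln0 addn0.
rewrite e1 in mk; have {It} [d1 G1 w1 o1 z1] := It (ltnW mk).
set t1 := iset t 5 0 m.
have d2 : dims n k t1 by [].
have e2 : ieval t1 (var 0) = n by case: d2.
pose i := (k.-1 - m)%N; have ik : (i < k)%N by rewrite /i; lia.
pose J l (t2 : state C) := (l <= n)%N -> [/\ dims n k t2 /\ imem t2 5 0 = m, GG t2 = GG s,
  forall f, acth (hout t2) f = chain (GG s i) (n - l) l (acth (hout t) f),
  all okh (hout t2) & (size (hout t2) <= size (hout s) + n * m + l)%N].
suff: J n (exec (For 6 (var 0) rep_lam1) t1).
  move=> /(_ (leqnn n)) [[d3 _] G3 w3 o3 z3]; split=> //; last by rewrite mulnS; lia.
  move=> f; rewrite w3 subnn w1.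
  have -> : (k - m = i.+1)%N by rewrite /i; lia.
  by have -> : (k - m.+1 = i)%N by rewrite /i; lia.
rewrite -[X in J X]e2; apply: for_inv => [|l t2 ln Jt ln1].
  by split=> //; rewrite addn0.
rewrite e2 in ln; have {Jt} [[d3 m3] G3 w3 o3 z3] := Jt (ltnW ln).
rewrite /rep_lam1 exec_block; cbv [foldl].
set t3 := iset t2 6 0 l; set p := (n.-1 - l)%N.
set t4 := exec (ISet 8 _ _) _.
have p4 : imem t4 8 0 = p by rewrite /t4 /= (proj1 d3) subn1.
have i4 : imem t4 10 0 = i by rewrite /t4 /= (proj2 d3) m3 subn1.
have d4 : dims n k t4 by [].
have m4 : imem t4 5 0 = m by [].
have G4 : GG t4 = GG s by [].
have h4 : hout t4 = hout t2 by [].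
have np : (n - l.+1 = p)%N by rewrite /p; lia.
have np1 : (n - l = p.+1)%N by rewrite /p; lia.
have gp : good n p (GG s i p) by apply: gG => //; rewrite /p; lia.
have w4 f : chain (GG s i) (n - l.+1) l.+1 (acth (hout t) f) =
    rot p (GG s i p) (acth (hout t2) f).
  by rewrite w3 np np1.
have h5 := out_repE (Ref 6 (var 10) (var 8)) (Ref 7 (var 10) (var 8)) d4 p4.
have c4 : (cget t4 (Ref 6 (var 10) (var 8)), cget t4 (Ref 7 (var 10) (var 8))) = GG s i p.
  by rewrite -G4 /GG -p4 -i4.
have d5 : dims n k (exec (out_rep (Ref 6 (var 10) (var 8)) (Ref 7 (var 10) (var 8))) t4).
  exact: dims_frame.
have m5 : imem (exec (out_rep (Ref 6 (var 10) (var 8)) (Ref 7 (var 10) (var 8))) t4) 5 0 = m.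
  by rewrite iframe.
have G5 : GG (exec (out_rep (Ref 6 (var 10) (var 8)) (Ref 7 (var 10) (var 8))) t4) = GG s.
  by rewrite GG_frame.
move: (exec (out_rep _ _) t4) h5 d5 m5 G5 => t5; rewrite h4.
case: ifP => pn h5 d5 m5 G5; rewrite h5; last first.
  split=> //; last lia.
  by move=> f; rewrite w4; case: gp => _ ->; [rewrite rot_id | lia].
split=> //.
- by move=> f; rewrite acth_rcons /gi /gc /gs c4 w4.
- rewrite all_rcons o3 andbT /okh /okq /gi /gj /gc /gs c4 eqxx /=; case: gp => -> _.
  by rewrite andbT; lia.
by rewrite size_rcons; lia.
Qed.

Lemma rep_SE b m0 s (s' := exec rep_S s) : dims n k s -> stored n k b m0 s ->
  all okh (hout s) ->
  [/\ forall f, acth (hout s') f = act (slist n k s) (acth (hout s) f),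
      all okh (hout s') & (size (hout s') <= size (hout s) + n * k)%N].
Proof.
move=> ds st ok0.
have e1 : ieval s (IMul (var 0) (var 1)) = (n * k)%N by case: ds => /= -> ->.
pose I m t := (m <= n * k)%N -> [/\ dims n k t, sentry t = sentry s,
  forall f, acth (hout t) f = act (rev [seq sentry s m' | m' <- iota 0 m]) (acth (hout s) f),
  all okh (hout t) & (size (hout t) <= size (hout s) + m)%N].
suff: I (n * k)%N s' by move=> /(_ (leqnn _)) [].
rewrite -{1}e1; apply: for_inv => [|m t mk It mk1].
  by split=> //; rewrite addn0.
rewrite e1 in mk; have {It} [d1 E1 w1 o1 z1] := It (ltnW mk).
rewrite /rep_S1 exec_block; cbv [foldl].
set t4 := exec (ISet 8 _ _) _.
set p := (sentry s m).1; set g := (sentry s m).2.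
have p4 : imem t4 8 0 = p by rewrite /p -E1.
have m4 : imem t4 5 0 = m by [].
have d4 : dims n k t4 by [].
have E4 : sentry t4 = sentry s by rewrite -E1.
have h4 : hout t4 = hout t by [].
have [gp _ _] := st m mk; rewrite -/p -/g in gp.
have w4 f : act (rev [seq sentry s m' | m' <- iota 0 m.+1]) (acth (hout s) f) =
    rot p g (acth (hout t) f).
  have -> : iota 0 m.+1 = iota 0 m ++ [:: m] by rewrite -addn1 iotaD.
  by rewrite w1 map_cat rev_cat.
have h5 := out_repE (Ref 10 (var 5) (ICst 0)) (Ref 11 (var 5) (ICst 0)) d4 p4.
have c4 : (cget t4 (Ref 10 (var 5) (ICst 0)), cget t4 (Ref 11 (var 5) (ICst 0))) = g.
  by rewrite /g -E4 -m4.
have d5 : dims n k (exec (out_rep (Ref 10 (var 5) (ICst 0)) (Ref 11 (var 5) (ICst 0))) t4).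
  exact: dims_frame.
have E5 : sentry (exec (out_rep (Ref 10 (var 5) (ICst 0)) (Ref 11 (var 5) (ICst 0))) t4) =
    sentry s by rewrite sentry_frame.
move: (exec (out_rep _ _) t4) h5 d5 E5 => t5; rewrite h4.
case: ifP => pn h5 d5 E5; rewrite h5; last first.
  split=> //; last lia.
  by move=> f; rewrite w4; case: gp => _ ->; [rewrite rot_id | lia].
split=> //.
- by move=> f; rewrite acth_rcons /gi /gc /gs c4 w4.
- rewrite all_rcons o1 andbT /okh /okq /gi /gj /gc /gs c4 eqxx /=; case: gp => -> _.
  by rewrite andbT; lia.
by rewrite size_rcons; lia.
Qed.
End Ends.

(** * From sequences to matrices *)

Section Bridge.
Variables (C : numClosedFieldType) (n : nat).
Implicit Types (v : 'cV[C]_n).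

(** Extension by zero, the dictionary between column vectors and sequences. *)
Definition vecof v : nat -> C := fun r => if insub r is Some i then v i 0 else 0.

Lemma vecofE v (i : 'I_n) : vecof v i = v i 0.
Proof. by rewrite /vecof valK. Qed.

Lemma vecof_supp v : supp n (vecof v).
Proof. by move=> r nr; rewrite /vecof insubF //; lia. Qed.

Lemma vecof_eq v f : supp n f -> (forall i : 'I_n, f i = v i 0) -> f = vecof v.
Proof.
move=> sf E; apply: functional_extensionality => r; rewrite /vecof.
case: insubP => [i _ <-|]; first exact: E.
by rewrite -leqNgt; apply: sf.
Qed.

Lemma vecof_inj v1 v2 : vecof v1 = vecof v2 -> v1 = v2.
Proof. by move=> E; apply/colP => i; rewrite -!vecofE E. Qed.

Lemma mulmx_ext (A B : 'M[C]_n) : (forall v, vecof (A *m v) = vecof (B *m v)) -> A = B.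
Proof.
move=> E; apply/matrixP => i j.
have /vecof_inj/colP/(_ i) := E (delta_mx j 0).
by rewrite -!colE !mxE.
Qed.

Lemma vecofD v1 v2 : vecof (v1 + v2) = fun r => vecof v1 r + vecof v2 r.
Proof.
apply: functional_extensionality => r; rewrite /vecof.
by case: insub => [i|]; rewrite ?mxE ?addr0.
Qed.

Lemma vecof_rot (e : givens C) v : okh n e ->
  vecof (givens_mx n e *m v) = rot (gi e) (gc e, gs e) (vecof v).
Proof.
case: e => p q c s /and3P[/= /eqP -> pn _]; symmetry; apply: vecof_eq.
  apply: supp_rot => //; exact: vecof_supp.
have p0 : (p < n)%N by lia.
pose ip := Ordinal p0; pose iq := Ordinal pn.
have pq : iq != ip by apply/eqP => /(congr1 val) /=; lia.
move=> i; rewrite !mxE; under eq_bigr do rewrite mxE /=.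
have vp : vecof v p = v ip 0 := vecofE v ip.
have vq : vecof v p.+1 = v iq 0 := vecofE v iq.
rewrite /rot vp vq; case: (eqVneq (i : nat) p) => [ipE|ip'] /=.
  rewrite (bigD1 ip) // (bigD1 iq) //= !eqxx big1 ?addr0.
    have -> : (p.+1 == p) = false by lia.
    by [].
  move=> j /andP[jp jq].
  have /negPf -> : (j : nat) != p by apply: contraNneq jp => jp; apply/eqP/val_inj.
  have /negPf -> : (j : nat) != p.+1 by apply: contraNneq jq => jq; apply/eqP/val_inj.
  have /negPf -> : i != j by apply: contraNneq jp => <-; apply/eqP/val_inj.
  by have -> : (i == p.+1 :> nat) = false; [lia | rewrite mul0r].
case: (eqVneq (i : nat) p.+1) => [iqE|iq'] /=.
  rewrite (bigD1 ip) // (bigD1 iq) //= !eqxx big1 ?addr0.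
    have -> : (p.+1 == p) = false by lia.
    by [].
  move=> j /andP[jp jq].
  have /negPf -> : (j : nat) != p by apply: contraNneq jp => jp; apply/eqP/val_inj.
  have /negPf -> : (j : nat) != p.+1 by apply: contraNneq jq => jq; apply/eqP/val_inj.
  have /negPf -> : i != j by apply: contraNneq jq => <-; apply/eqP/val_inj.
  by rewrite mul0r.
rewrite (bigD1 i) //= eqxx mul1r big1 ?addr0 ?vecofE // => j ji.
by rewrite eq_sym (negPf ji) mul0r.
Qed.

Definition ginve (e : givens C) := Givens (gi e) (gj e) (gc e)^* (- gs e).

Lemma okh_inv (e : givens C) : okh n e -> okh n (ginve e).
Proof.
case/and3P => a b c; apply/and3P; split=> //.
by have := unitg_inv c.
Qed.

Lemma givens_mx_adj (e : givens C) : okh n e -> (givens_mx n e)^t* = givens_mx n (ginve e).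
Proof.
case: e => p q c s /and3P[/= /eqP -> pn _]; apply/matrixP => i j; rewrite !mxE /=.
case: (eqVneq (i : nat) p) => [ip|ip]; case: (eqVneq (j : nat) p) => [jp|jp];
case: (eqVneq (i : nat) p.+1) => [iq|iq]; case: (eqVneq (j : nat) p.+1) => [jq|jq] //=;
  rewrite ?conjNK ?rmorphN /= ?opprK ?conjCK //; try lia;
  by rewrite conjC_nat eq_sym.
Qed.

Lemma givens_unitary (e : givens C) : okh n e -> givens_mx n e \is unitarymx.
Proof.
move=> oe; apply/unitarymxP; rewrite givens_mx_adj //; apply: mulmx_ext => v.
rewrite mul1mx -mulmxA vecof_rot // vecof_rot ?okh_inv //=.
by rewrite -[(_, - _)]/(ginv (gc e, gs e)) rotKV //; case/and3P: oe.
Qed.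

Lemma compose_act (es : seq (elementary C)) v : all (okq n) es ->
  vecof (compose_mx [seq elementary_mx n e | e <- es] *m v) = actq es (vecof v).
Proof.
elim/last_ind: es => [|es e IH]; first by rewrite mul1mx.
rewrite all_rcons => /andP[oe oes]; rewrite map_rcons /compose_mx foldl_rcons -/(compose_mx _).
rewrite -mulmxA /actq foldl_rcons -/(actq _ _) -IH //.
by case: e oe => // g og; rewrite vecof_rot.
Qed.

Lemma compose_unitary (es : seq (elementary C)) : all (okq n) es ->
  compose_mx [seq elementary_mx n e | e <- es] \is unitarymx.
Proof.
elim/last_ind: es => [|es e IH].
  by move=> _; apply/unitarymxP; rewrite mul1mx trmx1 map_mx1.
rewrite all_rcons => /andP[oe /IH u]; rewrite map_rcons /compose_mx foldl_rcons -/(compose_mx _).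
apply: mul_unitarymx u; case: e oe => // g; exact: givens_unitary.
Qed.

Lemma vecof_diag (d : 'rV[C]_n) (f : nat -> C) v : (forall i : 'I_n, f i = d 0 i) ->
  vecof (diag_mx d *m v) = diag f (vecof v).
Proof.
move=> E; symmetry; apply: vecof_eq => [r nr|i].
  by rewrite /diag vecof_supp // mulr0.
by rewrite mul_diag_mx mxE /diag vecofE E.
Qed.

Lemma vecof_lowrank k (X Y : 'M[C]_(n, k)) (x y : nat -> nat -> C) v :
  (forall (i : 'I_n) (j : 'I_k), X i j = x j i) ->
  (forall (i : 'I_n) (j : 'I_k), Y i j = y j i) ->
  (forall j, (j < k)%N -> supp n (x j)) ->
  vecof (X *m Y^t* *m v) = fun r => \sum_(j < k) x j r * ip n (y j) (vecof v).
Proof.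
move=> EX EY sx; symmetry; apply: vecof_eq => [r nr|i].
  by rewrite big1 // => j _; rewrite sx ?mul0r.
rewrite -mulmxA mxE; apply: eq_bigr => j _; rewrite EX; congr (_ * _).
by rewrite mxE; apply: eq_bigr => r _; rewrite !mxE EY vecofE.
Qed.

Lemma vecof_delta (j : 'I_n) : vecof (delta_mx j 0) = delta C j.
Proof.
symmetry; apply: vecof_eq => [r nr|i].
  by rewrite /delta; case: eqP => // rj; have := ltn_ord j; lia.
by rewrite mxE eqxx andbT.
Qed.

Lemma entryE m' (M : 'M[C]_(n, m')) (i : 'I_n) (j : 'I_m') : entry M i j = M i j.
Proof. by rewrite /entry !valK. Qed.
End Bridge.

(** * The operation count *)

Lemma hess_cost : exists c, forall n k, (0 < k)%N -> (k <= n)%N ->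
  (cost n k hess <= c * (n ^ 2 * k))%N.
Proof.
(* A generous bound for the sum of the coefficients of the expanded cost. The quotient n / k comes
   from [rounds] and is controlled by its product with k. *)
exists 1000%N => n k k0 kn.
set q := (n %/ k)%N.
have qk : (q * k <= n)%N by exact: leq_divM.
rewrite /= -/q; set k1 := (k - 1)%N.
have k1k : (k1 <= k)%N by exact: leq_subr.
rewrite expnS expn1; move: q k1 qk k1k => q k1 qk k1k.
(* Each monomial of the cost is dominated by n^2 k because 0 < k and k is at most n; what remains is
   linear in the monomials. *)
have m1 : (n <= n * n * k)%N by rewrite -mulnA leq_pmulr // muln_gt0; lia.
have m2 : (n * k <= n * n * k)%N by rewrite leq_pmul2r // leq_pmulr //; lia.
have m3 : (n * n <= n * n * k)%N by rewrite leq_pmulr.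
have m4 : (n * k * k <= n * n * k)%N by rewrite leq_pmul2r // leq_pmul2l //; lia.
have m5 : (k * k <= n * n * k)%N by apply: leq_trans m3; exact: leq_mul.
have m6 : (n * (q * k) <= n * n * k)%N by apply: leq_trans m3; exact: leq_mul.
have m7 : (n * (q * k) * k <= n * n * k)%N by apply: leq_mul => //; exact: leq_mul.
have m8 : (n * k1 <= n * n * k)%N by apply: leq_trans m2; exact: leq_mul.
have m9 : (n * k1 * k <= n * n * k)%N by apply: leq_trans m4; rewrite leq_mul // leq_mul.
lia.
Qed.

(** * Correctness of the whole program *)

Section Main.
Variables (C : numClosedFieldType) (n k : nat) (D : 'M[C]_n) (U V : 'M[C]_(n, k)).

Lemma hessP (s := exec hess (init D U V)) (A := D + U *m V^t*)
    (Q := result_Q n s) (H := condensed_mx (result_H n s)) :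
  (0 < k)%N -> (k <= n)%N -> is_diag_mx D -> D \is unitarymx ->
  [/\ all (okq n) (qout s), all (okh n) (hout s) /\ (size (hout s) <= 2 * (n * k))%N,
      imem s 2 0 = k, H = Q *m A *m Q^t* & upper_hessenberg H].
Proof.
move=> k0 kn dD uD.
have n0 : (0 < n)%N by lia.
rewrite {}/H {}/Q {}/s /hess exec_block; cbv [foldl].
have [[d0 r0 q0 h0] D0 XY0 G0 [S0 w0]] := setupE D U V.
move: (exec setup (init D U V)) d0 r0 q0 h0 D0 XY0 G0 S0 w0.
move=> s0 d0 r0 q0 h0 D0 XY0 G0 S0 w0.
have gG0 : Ggood n k s0 by move=> i q ik qn; rewrite G0 //; [exact: good_id | lia].
have gd0 : dgood n s0.
  move=> r rn; rewrite D0; pose i := Ordinal rn; rewrite -[r]/(i : nat) entryE.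
  have /unitarymxP/matrixP/(_ i i) := uD; rewrite !mxE eqxx /= (bigD1 i) //= big1 ?addr0 ?mxE //.
  by move=> j ji; rewrite (is_diag_mxP dD) ?mul0r // eq_sym.
have X0 j : (j < k)%N -> supp n (col s0 4 j).
  by move=> jk; case: (XY0 j jk) => -> _ r nr; rewrite entry_out.
have G0' i q : (i < k)%N -> (q < n + k)%N -> GG s0 i q = gid C by exact: G0.
have [] := phase1E d0 gG0 gd0 k0 n0 G0' X0.
have F1 m : (m < n * k)%N -> sentry (exec phase1 s0) m = (0%N, gid C).
  by move=> mk; rewrite sentry_frame // S0.
have w1 : supp n (col (exec phase1 s0) 12 0) by rewrite /col cframe.
have r1 : imem (exec phase1 s0) 2 0 = k by rewrite iframe.
have h1 : hout (exec phase1 s0) = [::] by rewrite hframe.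
move: (exec phase1 s0) F1 w1 r1 h1 => s1 F1 w1 r1 h1 [R1 E1] c1 D1 X1 P1.
have [] := phase2E c1 k0 P1 w1 X1 F1.
have r2 : imem (exec phase2 s1) 2 0 = k by rewrite iframe.
have h2 : hout (exec phase2 s1) = [::] by rewrite hframe.
move: (exec phase2 s1) r2 h2 => s2 r2 h2 [R2 E2] c2 D2 st2 He.
have E := conj_trans E1 E2.
have Xs j : (j < k)%N -> supp n (col s2 4 j) by move=> jk; apply: conj_suppn E jk (X0 j jk).
have [d2 gG2 _ _] := c2.
have [] := rep_lamE d2 gG2 (_ : all (okh n) (hout s2)); first by rewrite h2.
have d3 : dims n k (exec rep_lam s2) by exact: dims_frame.
have S3 : sentry (exec rep_lam s2) = sentry s2 by rewrite sentry_frame.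
have r3 : imem (exec rep_lam s2) 2 0 = k by rewrite iframe.
have q3 : qout (exec rep_lam s2) = qout s2 by rewrite qframe.
have c3 a : cmem (exec rep_lam s2) a = cmem s2 a by rewrite cframe.
move: (exec rep_lam s2) d3 S3 r3 q3 c3 => s3 d3 S3 r3 q3 c3 L3 o3 z3.
have st3 : stored n k (n + k).+1 (n * k) s3 by rewrite /stored S3.
have [] := rep_SE d3 st3 o3.
have r4 : imem (exec rep_S s3) 2 0 = k by rewrite iframe.
have q4 : qout (exec rep_S s3) = qout s2 by rewrite qframe.
have c4 a : cmem (exec rep_S s3) a = cmem s2 a by rewrite cframe.
move: (exec rep_S s3) r4 q4 c4 => s4 r4 q4 c4 L4 o4 z4.
have qok : all (okq n) (qout s4).
  by rewrite q4; apply: (conj_ok E); rewrite q0.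
set Q := result_Q n s4; set H := condensed_mx _.
have HE v : vecof (H *m v) = hop n k s2 (slist n k s2) [::] (vecof v).
  rewrite /H /condensed_mx /result_H /= mulmxDl vecofD -mulmxA.
  apply: functional_extensionality => r; congr (_ + _).
    have -> : [seq givens_mx n g | g <- hout s4] =
        [seq elementary_mx n e | e <- [seq Rotation g | g <- hout s4]].
      by rewrite -map_comp.
    rewrite compose_act; last by rewrite all_map.
    rewrite -/(acth _ _) L4 L3 h2 /wop /= /slist S3.
    congr (act _ (lam _ _ _ _) _); apply: vecof_diag => i.
    by rewrite mxE /dd /col c4.
  rewrite (@vecof_lowrank _ _ _ _ _ (col s2 4) (col s2 5)).
  - by rewrite r4.
  - by move=> i j; rewrite mxE c4.
  - by move=> i j; rewrite mxE c4.
  by move=> j; rewrite r4; apply: Xs.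
have QE v : vecof (Q *m v) = act (R2 ++ R1) (vecof v).
  by rewrite compose_act // q4 (conj_q E) q0.
have AE v : vecof (A *m v) = hop n k s0 [::] [::] (vecof v).
  rewrite /A mulmxDl vecofD; apply: functional_extensionality => r.
  rewrite /hop /wop /= lam_id; last by move=> i p ik pn; apply: G0 => //; lia.
  congr (_ + _).
    have /is_diag_mxP dP := dD.
    have -> : D = diag_mx (\row_i D i i).
      apply/matrixP => i j; rewrite !mxE; case: (eqVneq i j) => [->|ij].
        by rewrite mulr1n.
      by rewrite mulr0n dP.
    rewrite (vecof_diag (f := dd s0)) // => i.
    by rewrite D0 entryE !mxE.
  rewrite (@vecof_lowrank _ _ _ _ _ (col s0 4) (col s0 5)) //.
  - by move=> i j; case: (XY0 j (ltn_ord j)) => -> _; rewrite entryE.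
  by move=> i j; case: (XY0 j (ltn_ord j)) => _ ->; rewrite entryE.
have uQ : Q \is unitarymx by exact: compose_unitary.
(* The two phases conjugate A by the rotations that were output as Q, so [hop_conj] is the relation
   H Q = Q A between operators; unitarity of Q turns it into the claim. *)
have HQ : H *m Q = Q *m A.
  apply: mulmx_ext => v.
  by rewrite -!mulmxA HE QE (hop_conj _ E) -AE -QE.
split=> //.
- by split=> //; move: z3 z4; rewrite h2 /=; lia.
- by rewrite -HQ -mulmxA (unitarymxP uQ) mulmx1.
move=> i j ji; have := He j (ltn_ord j) i ji.
by rewrite -vecof_delta -HE vecofE -colE mxE.
Qed.
End Main.

Theorem mainTheorem2 (R : realType) :
  exists (p : prog) (c : nat),
  forall (n k : nat) (D : 'M[R[i]]_n) (U V : 'M[R[i]]_(n, k)),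
    (0 < k)%N -> (k <= n)%N ->
    is_diag_mx D -> D \is unitarymx ->
    let A := D + U *m V^t* in
    let s := exec p (init D U V) in
    let Q := result_Q n s in
    let H := condensed_mx (result_H n s) in
    [/\ all (elementary_ok n) (qout s) /\ Q \is unitarymx,
        condensed_ok c k (result_H n s),
        H = Q *m A *m Q^t*,
        upper_hessenberg H
      & (ops s <= c * (n ^ 2 * k))%N].
Proof.
have [c cb] := hess_cost.
(* One constant for three bounds: [c] for the operations, and the summand 2 for the 2 n k rotations
   of the representation and for its rank k. *)
exists hess, (c + 2)%N => n k D U V k0 kn dD uD A s Q H.
have [qok [hok hs] r2 HE Hh] := hessP U V k0 kn dD uD.
have okE g : okh n g -> givens_ok n g.
  move=> /and3P[/eqP E l u]; apply/and4P; split=> //; rewrite ?E; lia.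
split=> //.
- split; last exact: compose_unitary.
  by apply: sub_all qok => -[g|//]; apply: okE.
- apply/and3P; split=> /=.
  + by apply: sub_all hok => g /okE.
  + by apply: leq_trans hs _; rewrite leq_mul2r; apply/orP; right; lia.
  by rewrite -/s r2; nia.
apply: leq_trans (@cost_le _ n k hess (init D U V) isT isT isT erefl erefl) _.
by rewrite add0n (leq_trans (cb n k k0 kn)) // leq_mul2r leq_addr orbT.
Qed.
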